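(* Let $\Omega\subseteq\mathbb{H}$ be a domain, let $f:\Omega\to\hat{\mathbb{H}}=\mathbb{H}\cup\{\infty\}$ and let $\rho>0$ be such that $\overline{\mathbb{B}_{\rho}}\subset\Omega$ and $f(0)\neq0,\infty$ (zeros and singularities of $f$ on $\partial\mathbb{B}_\rho$ are allowed). (i) Suppose $f$ is a slice preserving semiregular function with real zeros $\{r_k\}_k$, real poles $\{p_h\}_h$, spherical zeros $\{\mathbb{S}_{a_i}\}_i$ and spherical poles $\{\mathbb{S}_{b_j}\}_j$, repeated according to multiplicity. Then $$\begin{aligned}\log|f(0)| ={}& \frac{1}{|\partial \mathbb{B}_{\rho}|}\int_{\partial \mathbb{B}_{\rho}}\log|f(y)|\,d\sigma(y)-\frac{\rho^{2}}{8}\,\Delta\log|f(x)|_{|x=0}\\ &+\sum_{|p_{h}|<\rho}\left(\log\frac{\rho}{|p_{h}|}+\frac14\,\frac{p_{h}^{4}-\rho^{4}}{\rho^{2}p_{h}^{2}}\right)-\sum_{|r_{k}|<\rho}\left(\log\frac{\rho}{|r_{k}|}+\frac14\,\frac{r_{k}^{4}-\rho^{4}}{\rho^{2}r_{k}^{2}}\right)\\ &+\sum_{|b_{j}|<\rho}\left(\log\frac{\rho^{2}}{|b_{j}|^{2}}+\frac14\,\frac{\rho^{4}-|b_{j}|^{4}}{\rho^{2}|b_{j}|^{4}}\,[2|b_{j}|^{2}-(b_{j}+b_{j}^{c})^{2}]\right)\\ &-\sum_{|a_{i}|<\rho}\left(\log\frac{\rho^{2}}{|a_{i}|^{2}}+\frac14\,\frac{\rho^{4}-|a_{i}|^{4}}{\rho^{2}|a_{i}|^{4}}\,[2|a_{i}|^{2}-(a_{i}+a_{i}^{c})^{2}]\right).\end{aligned}$$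 (ii) Suppose $f$ is a PQL function $f(x)=a_{0}\prod_{k=1}^{N}(x-q_{k})^{M_{k}}a_{k}$ with $M_k=\pm1$ and $|q_k|\leq\rho$ for every $k$. Then $$\log|f(0)|=\frac{1}{|\partial \mathbb{B}_{\rho}|}\int_{\partial \mathbb{B}_{\rho}}\log|f(y)|\,d\sigma(y)-\frac{\rho^{2}}{8}\,\Delta\log|f(x)|_{|x=0}-\sum_{|q_k|<\rho}M_{k}\left(\log\frac{\rho}{|q_{k}|}+\frac14\,\frac{|q_{k}|^{4}-\rho^{4}}{\rho^{2}|q_{k}|^{2}}\right).$$ That is, zeros and singularities lying on $\partial\mathbb{B}_\rho$ give no contribution.
   Context: $\mathbb{H}$ denotes the quaternions, identified with $\mathbb{R}^4$, $x^c$ is the usual conjugate, $|x|^2=xx^c$, $\mathbb{B}_\rho=\{|x|<\rho\}$, $d\sigma$ is the 3-dimensional surface measure on $\partial\mathbb{B}_\rho$ and $|\partial\mathbb{B}_\rho|$ its total mass, $\Delta$ is the Laplacian of $\mathbb{R}^4$. $\mathbb{S}=\{I\in\mathbb{H}: I^2=-1\}$, $\mathbb{C}_I=\mathbb{R}+I\mathbb{R}$, and $\mathbb{S}_{\alpha+I\beta}=\{\alpha+J\beta: J\in\mathbb{S}\}$. Slice functions. Let $\mathbb{H}_{\mathbb{C}}=\mathbb{H}\otimes_{\mathbb{R}}\mathbb{C}=\{p+\imath q: p,q\in\mathbb{H}\}$ with product $(p_1+\imath q_1)(p_2+\imath q_2)=p_1p_2-q_1q_2+\imath(p_1q_2+q_1p_2)$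 and $\overline{p+\imath q}=p-\imath q$. For an open $D\subseteq\mathbb{C}$ symmetric under complex conjugation, $\Omega_D=\{\alpha+I\beta:\alpha+i\beta\in D, I\in\mathbb{S}\}$ (a circular set; a slice domain if it is a domain and $D\cap\mathbb{R}\ne\emptyset$). A stem function is $F=F_1+\imath F_2:D\to\mathbb{H}_{\mathbb{C}}$ with $F(\bar z)=\overline{F(z)}$; it induces the slice function $f=\mathcal{I}(F):\Omega_D\to\mathbb{H}$, $f(\alpha+I\beta)=F_1(\alpha+i\beta)+IF_2(\alpha+i\beta)$. $f$ is regular if $F$ is $C^1$ and $\partial F/\partial\alpha+\imath\,\partial F/\partial\beta=0$, and slice preserving if $f(\Omega_D\cap\mathbb{C}_J)\subset\mathbb{C}_J$ for all $J\in\mathbb{S}$ (equivalently $F_1,F_2$ are real valued). A semiregular function on $\Omega_D$ is a function regular on some circular open $\Omega_{D'}\subset\Omega_D$ such that every point of $\Omega_D\setminus\Omega_{D'}$ is a pole or a removable singularity; the value $\infty$ is assigned at poles. In case (i), $\Omega$ is understood to be a circular (slice) domain. For $q\in\mathbb{H}$, $(x-q)^s=x^2-x(q+q^c)+qq^c$; it vanishes exactly on $\mathbb{S}_q$. A slice preserving semiregular function not identically zero on a slice domain containing $\overline{\mathbb{B}_\rho}$ can be written near $\overline{\mathbb{B}_\rho}$ as a finite product of factors $(x-r)^{n}$ ($r\in\mathbb{R}$) and $((x-q)^s)^{n}$ ($q\notin\mathbb{R}$), with nonzero integer exponents (positive for zeros, negative for poles), times a zero-free slice preserving regular function. The multiplicity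 of a real zero/pole $r$ or of a spherical zero/pole $\mathbb{S}_q$ here is the absolute value $|n|$ of the corresponding exponent. A PQL function is $f(x)=a_{0}(x-q_{1})^{M_{1}}a_{1}(x-q_2)^{M_2}a_2\cdots(x-q_{N})^{M_{N}}a_{N}$ with pointwise quaternionic multiplication, $q_k\in\mathbb{H}$ and $a_k\in\mathbb{H}\setminus\{0\}$ (repetitions allowed) and $M_k\in\{\pm1\}$. For a PQL function the hypothesis $f(0)\ne0,\infty$ means $q_k\neq0$ for all $k$. *)

(* Defs.v *)
From HB Require Import structures.
From mathcomp Require Import all_boot all_order all_algebra.
From mathcomp Require Import all_classical all_reals all_analysis.
From mathcomp Require Import measurable_realfun.
From mathcomp Require Import ring lra.
Set Implicit Arguments.
Unset Strict Implicit.
Unset Printing Implicit Defensive.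
Import Order.TTheory GRing.Theory Num.Theory.
Import numFieldNormedType.Exports.
Local Open Scope classical_set_scope.
Local Open Scope card_scope.
Local Open Scope ring_scope.

(* A record rather than a product of copies of R: products already carry the
   componentwise ring structure and the sup norm. *)
Record quat (R : realType) := Quat { qre : R; qim1 : R; qim2 : R; qim3 : R }.

Section QuatAlgebra.
Context {R : realType}.
Implicit Types p q x : quat R.

Definition quat_tuple q : R * R * R * R := (qre q, qim1 q, qim2 q, qim3 q).
Definition tuple_quat (t : R * R * R * R) : quat R :=
  Quat t.1.1.1 t.1.1.2 t.1.2 t.2.

Fact quat_tupleK : cancel quat_tuple tuple_quat.
Proof. by case. Qed.

HB.instance Definition _ := Choice.copy (quat R) (can_type quat_tupleK).

Definition qadd p q :=
  Quat (qre p + qre q) (qim1 p + qim1 q) (qim2 p + qim2 q) (qim3 p + qim3 q).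
Definition qopp q := Quat (- qre q) (- qim1 q) (- qim2 q) (- qim3 q).
Definition qzero : quat R := Quat 0 0 0 0.

Let quat_eq (a b c d a' b' c' d' : R) :
  a = a' -> b = b' -> c = c' -> d = d' -> Quat a b c d = Quat a' b' c' d'.
Proof. by move=> -> -> -> ->. Qed.

Fact qaddA : associative qadd.
Proof. by move=> p q x; apply: quat_eq => /=; ring. Qed.
Fact qaddC : commutative qadd.
Proof. by move=> p q; apply: quat_eq => /=; ring. Qed.
Fact qadd0 : left_id qzero qadd.
Proof. by case=> *; apply: quat_eq => /=; ring. Qed.
Fact qaddN : left_inverse qzero qopp qadd.
Proof. by case=> *; apply: quat_eq => /=; ring. Qed.

HB.instance Definition _ :=
  GRing.isZmodule.Build (quat R) qaddA qaddC qadd0 qaddN.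

Definition qmul p q :=
  let: Quat a b c d := p in let: Quat a' b' c' d' := q in
  Quat (a * a' - b * b' - c * c' - d * d')
       (a * b' + b * a' + c * d' - d * c')
       (a * c' - b * d' + c * a' + d * b')
       (a * d' + b * c' - c * b' + d * a').
Definition qone : quat R := Quat 1 0 0 0.

Fact qmulA : associative qmul.
Proof. by move=> [? ? ? ?] [? ? ? ?] [? ? ? ?]; apply: quat_eq => /=; ring. Qed.
Fact qmul1q : left_id qone qmul.
Proof. by move=> [? ? ? ?]; apply: quat_eq => /=; ring. Qed.
Fact qmulq1 : right_id qone qmul.
Proof. by move=> [? ? ? ?]; apply: quat_eq => /=; ring. Qed.
Fact qmulDl : left_distributive qmul +%R.
Proof. by move=> [? ? ? ?] [? ? ? ?] [? ? ? ?]; apply: quat_eq => /=; ring. Qed.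
Fact qmulDr : right_distributive qmul +%R.
Proof. by move=> [? ? ? ?] [? ? ? ?] [? ? ? ?]; apply: quat_eq => /=; ring. Qed.
Fact qone_neq0 : qone != 0 :> quat R.
Proof. by apply/eqP => -[] /eqP; rewrite oner_eq0. Qed.

HB.instance Definition _ := GRing.Zmodule_isNzRing.Build (quat R)
  qmulA qmul1q qmulq1 qmulDl qmulDr qone_neq0.

Definition qscale (a : R) q :=
  Quat (a * qre q) (a * qim1 q) (a * qim2 q) (a * qim3 q).

Fact qscaleA a b q : qscale a (qscale b q) = qscale (a * b) q.
Proof. by apply: quat_eq => /=; ring. Qed.
Fact qscale1 : left_id 1 qscale.
Proof. by case=> *; apply: quat_eq => /=; ring. Qed.
Fact qscaleDr : right_distributive qscale +%R.
Proof. by move=> a p q; apply: quat_eq => /=; ring. Qed.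
Fact qscaleDl q : {morph qscale^~ q : a b / a + b}.
Proof. by move=> a b; apply: quat_eq => /=; ring. Qed.

HB.instance Definition _ := GRing.Zmodule_isLmodule.Build R (quat R)
  qscaleA qscale1 qscaleDr qscaleDl.

Fact qscalerAl (a : R) p q : a *: (p * q) = (a *: p) * q.
Proof. by move: p q => [? ? ? ?] [? ? ? ?]; apply: quat_eq => /=; ring. Qed.
Fact qscalerAr (a : R) p q : a *: (p * q) = p * (a *: q).
Proof. by move: p q => [? ? ? ?] [? ? ? ?]; apply: quat_eq => /=; ring. Qed.

HB.instance Definition _ := GRing.Lmodule_isLalgebra.Build R (quat R) qscalerAl.
HB.instance Definition _ := GRing.Lalgebra_isAlgebra.Build R (quat R) qscalerAr.

Definition qconj q := Quat (qre q) (- qim1 q) (- qim2 q) (- qim3 q).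

Definition qnorm q : R :=
  Num.sqrt (qre q ^+ 2 + qim1 q ^+ 2 + qim2 q ^+ 2 + qim3 q ^+ 2).

Fact qnorm_ge0 q : 0 <= qnorm q. Proof. exact: sqrtr_ge0. Qed.
Fact qnorm_sqr q :
  qnorm q ^+ 2 = qre q ^+ 2 + qim1 q ^+ 2 + qim2 q ^+ 2 + qim3 q ^+ 2.
Proof. by rewrite sqr_sqrtr// !addr_ge0// sqr_ge0. Qed.
Fact ler_qnormD p q : qnorm (p + q) <= qnorm p + qnorm q.
Proof.
pose s := qre p * qre q + qim1 p * qim1 q + qim2 p * qim2 q + qim3 p * qim3 q.
have spq : s <= qnorm p * qnorm q.
  have [s0|/ltW s0] := leP s 0; first exact/(le_trans s0)/mulr_ge0/qnorm_ge0/qnorm_ge0.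
  rewrite -(@ler_pXn2r _ 2) ?nnegrE ?mulr_ge0 ?qnorm_ge0// exprMn !qnorm_sqr /s.
  move: p q {s s0} => [a b c d] [a' b' c' d'] /=; rewrite -subr_ge0.
  have -> : (a ^+ 2 + b ^+ 2 + c ^+ 2 + d ^+ 2) *
            (a' ^+ 2 + b' ^+ 2 + c' ^+ 2 + d' ^+ 2) -
            (a * a' + b * b' + c * c' + d * d') ^+ 2 =
    (a * b' - b * a') ^+ 2 + (a * c' - c * a') ^+ 2 + (a * d' - d * a') ^+ 2 +
    (b * c' - c * b') ^+ 2 + (b * d' - d * b') ^+ 2 + (c * d' - d * c') ^+ 2.
    by ring.
  by rewrite !addr_ge0// sqr_ge0.
rewrite -(@ler_pXn2r _ 2) ?nnegrE ?addr_ge0 ?qnorm_ge0//.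
rewrite sqrrD !qnorm_sqr /=; move: spq; rewrite /s mulr2n; lra.
Qed.
Fact qnormZ (a : R) q : qnorm (a *: q) = `|a| * qnorm q.
Proof. by rewrite /qnorm /= !exprMn -!mulrDr sqrtrM ?sqr_ge0// sqrtr_sqr. Qed.
Fact qnorm0_eq0 q : qnorm q = 0 -> q = 0.
Proof.
move=> q0; have /eqP := qnorm_sqr q; rewrite q0 expr0n/= eq_sym.
rewrite !paddr_eq0 ?addr_ge0 ?sqr_ge0// !sqrf_eq0 -!andbA.
by case: q {q0} => [a b c d] /= /and4P[/eqP-> /eqP-> /eqP-> /eqP->].
Qed.

HB.instance Definition _ :=
  Lmodule_isNormed.Build R (quat R) ler_qnormD qnormZ qnorm0_eq0.

Fact qmul_conj q : q * qconj q = (`|q| ^+ 2)%:A.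
Proof.
rewrite [X in X ^+ 2]/Num.norm/= qnorm_sqr; case: q => [a b c d].
by apply: quat_eq => /=; ring.
Qed.

Definition qinv q : quat R := (`|q| ^+ 2)^-1 *: qconj q.

Fact qmulqV : {in [pred q | q != 0], right_inverse 1 qinv *%R}.
Proof.
move=> q; rewrite inE => q0; rewrite /qinv -qscalerAr qmul_conj scalerA mulVf ?scale1r//.
by rewrite sqrf_eq0 normr_eq0.
Qed.
Fact qmulVq : {in [pred q | q != 0], left_inverse 1 qinv *%R}.
Proof.
move=> q q0; have <- := qmulqV q0; rewrite /qinv -qscalerAr -qscalerAl.
by congr (_ *: _); case: q q0 => [a b c d] _; apply: quat_eq => /=; ring.
Qed.
Fact qunitP p q : q * p = 1 /\ p * q = 1 -> p \in [pred q | q != 0].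
Proof.
move=> [qp _]; rewrite inE; apply/eqP => p0; move: qp.
by rewrite p0 mulr0 => /eqP; rewrite eq_sym oner_eq0.
Qed.
Fact qinv0id : {in [predC [pred q | q != 0]], qinv =1 id}.
Proof.
by move=> q; rewrite !inE negbK => /eqP ->; rewrite /qinv normr0 expr0n invr0 scale0r.
Qed.

HB.instance Definition _ := GRing.NzRing_hasMulInverse.Build (quat R)
  qmulVq qmulqV qunitP qinv0id.

(* The Borel sigma-algebra, obtained from that of R^4 through the coordinates. *)
Definition qmeasurable : set (set (quat R)) :=
  [set A | measurable (tuple_quat @^-1` A)].

Fact qmeasurable0 : qmeasurable set0.
Proof. by rewrite /qmeasurable/= preimage_set0. Qed.
Fact qmeasurableC A : qmeasurable A -> qmeasurable (~` A).
Proof. by rewrite /qmeasurable/= preimage_setC; exact: measurableC. Qed.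
Fact qmeasurable_bigcup (F : (set (quat R))^nat) :
  (forall i, qmeasurable (F i)) -> qmeasurable (\bigcup_i (F i)).
Proof.
by move=> mF; rewrite /qmeasurable/= preimage_bigcup; exact: bigcupT_measurable.
Qed.

HB.instance Definition _ := isMeasurable.Build default_measure_display (quat R)
  qmeasurable0 qmeasurableC qmeasurable_bigcup.

End QuatAlgebra.

Section SurfaceMeasure.
Context {R : realType}.

Let A3 := (measurableTypeR R * measurableTypeR R * measurableTypeR R)%type.
Let leb3 : {measure set A3 -> \bar R} :=
  (lebesgue_measure \x lebesgue_measure \x lebesgue_measure)%E.

Definition qsphere (rho : R) : set (quat R) := [set y | `|y| = rho].

(* Hyperspherical coordinates (psi, theta, phi) on the sphere of radius rho. *)
Definition hyperspherical (rho : R) (t : A3) : quat R :=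
  let: (psi, theta, phi) := t in
  Quat (rho * cos psi)
       (rho * (sin psi * cos theta))
       (rho * (sin psi * (sin theta * cos phi)))
       (rho * (sin psi * (sin theta * sin phi))).

Definition angles : set A3 := `[0, pi] `*` `[0, pi] `*` `[0, pi *+ 2].

(* The square root of the Gram determinant of the parametrization. *)
Definition hyperspherical_jacobian (rho : R) (t : A3) : R :=
  `|rho| ^+ 3 * (sin t.1.1 ^+ 2 * sin t.1.2).

Definition surface_measure (rho : R) (A : set (quat R)) : \bar R :=
  (\int[leb3]_(t in angles `&` hyperspherical rho @^-1` A)
     (hyperspherical_jacobian rho t)%:E)%E.

Let m1 : measurable_fun [set: A3] (fun t => t.1.1 : R).
Proof. exact: (measurableT_comp measurable_fst measurable_fst). Qed.
Let m2 : measurable_fun [set: A3] (fun t => t.1.2 : R).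
Proof. exact: (measurableT_comp measurable_snd measurable_fst). Qed.
Let m3 : measurable_fun [set: A3] (fun t => t.2 : R).
Proof. exact: measurable_snd. Qed.
Let msin (f : A3 -> R) :
  measurable_fun [set: A3] f -> measurable_fun [set: A3] (fun t => sin (f t)).
Proof.
by move=> mf; apply: measurableT_comp mf; apply: continuous_measurable_fun; exact: continuous_sin.
Qed.
Let mcos (f : A3 -> R) :
  measurable_fun [set: A3] f -> measurable_fun [set: A3] (fun t => cos (f t)).
Proof.
by move=> mf; apply: measurableT_comp mf; apply: continuous_measurable_fun; exact: continuous_cos.
Qed.

Fact measurable_hyperspherical rho : measurable_fun setT (hyperspherical rho).
Proof.
move=> _ A mA; rewrite setTI.
pose h t := quat_tuple (hyperspherical rho t).
have mh : measurable_fun setT h.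
  rewrite (_ : h = fun t => (rho * cos t.1.1, rho * (sin t.1.1 * cos t.1.2),
      rho * (sin t.1.1 * (sin t.1.2 * cos t.2)),
      rho * (sin t.1.1 * (sin t.1.2 * sin t.2)))); last first.
    by apply/funext => -[[? ?] ?].
  do 3?[apply: measurable_fun_pair];
    repeat (apply: measurable_funM => //);
    by [exact: mcos | exact: msin].
have := mh measurableT _ mA; rewrite setTI /h.
congr measurable; apply/seteqP; split => t /=; by rewrite quat_tupleK.
Qed.

Fact measurable_angles : measurable angles.
Proof. by apply: measurableX => //; exact: measurableX. Qed.

Let measurable_jacobian rho :
  measurable_fun setT (fun t => (hyperspherical_jacobian rho t)%:E).
Proof.
apply/measurable_EFinP; apply: measurable_funM => //.
by apply: measurable_funM; [apply: measurable_funX|]; exact: msin.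
Qed.

Let jacobian_ge0 rho t : angles t -> 0 <= hyperspherical_jacobian rho t.
Proof.
move=> [[]]/=; rewrite !in_itv/= => _ t2 _.
by rewrite mulr_ge0 ?exprn_ge0// mulr_ge0 ?sqr_ge0// sin_ge0_pi.
Qed.

Let surface_measure0 rho : surface_measure rho set0 = 0%E.
Proof. by rewrite /surface_measure preimage_set0 setI0 integral_set0. Qed.
Let surface_measure_ge0 rho A : (0 <= surface_measure rho A)%E.
Proof. by apply: integral_ge0 => t [ta _]; rewrite lee_fin jacobian_ge0. Qed.
Let surface_measure_sigma_additive rho : semi_sigma_additive (surface_measure rho).
Proof.
move=> F mF tF mUF; rewrite /surface_measure preimage_bigcup setI_bigcupr.
rewrite ge0_integral_bigcup//=.
- by apply: is_cvg_nneseries => n _ _; exact: surface_measure_ge0.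
- move=> k; apply: measurableI; first exact: measurable_angles.
  by rewrite -[X in measurable X]setTI; exact: measurable_hyperspherical.
- exact: measurable_funTS.
- by move=> t [n _ [ta _]]; rewrite lee_fin jacobian_ge0.
- apply/trivIsetP => i j _ _ ij; rewrite setIACA -preimage_setI.
  by move/trivIsetP : tF => /(_ _ _ Logic.I Logic.I ij) ->; rewrite preimage_set0 setI0.
Qed.

HB.instance Definition _ rho := isMeasure.Build _ _ _ (surface_measure rho)
  (surface_measure0 rho) (surface_measure_ge0 rho)
  (@surface_measure_sigma_additive rho).

End SurfaceMeasure.

Section SliceFunctions.
Context {R : realType}.
Implicit Types (x q w J : quat R) (D E : set (R * R)).

Definition imaginary_units : set (quat R) := [set J | J * J = -1].

Definition slice_plane J : set (quat R) :=
  [set x | exists a b : R, x = a%:A + b *: J].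

(* The sphere S_q, reduced to {q} when q is real. *)
Definition sphere_of q : set (quat R) := [set x | exists (a b : R) I J,
  [/\ imaginary_units I, imaginary_units J, q = a%:A + b *: I & x = a%:A + b *: J]].

Definition real_quat : set (quat R) := [set x | exists r : R, x = r%:A].

(* Subsets of the complex plane are sets of pairs (alpha, beta). *)
Definition conj_symmetric D := forall a b : R, D (a, b) -> D (a, - b).

Definition circularization D : set (quat R) := [set x | exists (a b : R) J,
  [/\ D (a, b), imaginary_units J & x = a%:A + b *: J]].

(* (p, q) stands for p + i q in the complexified quaternions. The
   componentwise product that the library puts on pairs is never used. *)
Definition hcomplex : Type := (quat R * quat R)%type.
Definition hmul (z w : hcomplex) : hcomplex :=
  (z.1 * w.1 - z.2 * w.2, z.1 * w.2 + z.2 * w.1).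
Definition hconj (z : hcomplex) : hcomplex := (z.1, - z.2).
Definition hi : hcomplex := (0, 1).

Definition is_stem D (F : R * R -> hcomplex) :=
  forall a b : R, D (a, b) -> F (a, - b) = hconj (F (a, b)).

Definition d_alpha (F : R * R -> hcomplex) : R * R -> hcomplex :=
  'D_((1, 0) : R * R) F.
Definition d_beta (F : R * R -> hcomplex) : R * R -> hcomplex :=
  'D_((0, 1) : R * R) F.

Definition is_C1 D (F : R * R -> hcomplex) := forall z, D z ->
  [/\ derivable F z (1, 0), derivable F z (0, 1),
      {for z, continuous (d_alpha F)} & {for z, continuous (d_beta F)}].

Definition induces D (F : R * R -> hcomplex) (g : quat R -> quat R) :=
  forall (a b : R) J, D (a, b) -> imaginary_units J ->
    g (a%:A + b *: J) = (F (a, b)).1 + J * (F (a, b)).2.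

Definition slice_regular D (g : quat R -> quat R) :=
  exists F : R * R -> hcomplex, [/\ is_stem D F, is_C1 D F,
    forall z, D z -> d_alpha F z + hmul hi (d_beta F z) = 0 & induces D F g].

(* Maps into the quaternions extended by a point at infinity, None. *)
Definition hquat : Type := option (quat R).

Definition slice_preserving (U : set (quat R)) (f : quat R -> hquat) :=
  forall J, imaginary_units J -> forall x w,
    U x -> slice_plane J x -> f x = Some w -> slice_plane J w.

(* (x - q)^s *)
Definition sph_factor q x : quat R := x ^+ 2 - x * (q + qconj q) + q * qconj q.

Definition circular_nbhd q E :=
  [/\ open E, conj_symmetric E & circularization E q].

(* f is regular around S_q, where it takes the values of its extension. *)
Definition removable (f : quat R -> hquat) q := exists E g,
  [/\ circular_nbhd q E, slice_regular E g &
      forall x, circularization E x -> f x = Some (g x)].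

(* The order of a pole is counted along the whole sphere S_q, on which all
   the points have the same order when f is slice preserving. *)
Definition pole (f : quat R -> hquat) q :=
  (exists E g n, [/\ circular_nbhd q E, slice_regular E g &
      forall x, circularization E x -> ~ sphere_of q x ->
        f x = Some ((sph_factor q x ^+ n)^-1 * g x)]) /\
  ~ (exists E g, [/\ circular_nbhd q E, slice_regular E g &
      forall x, circularization E x -> ~ sphere_of q x -> f x = Some (g x)]).

Definition semiregular D (f : quat R -> hquat) := exists D' : set (R * R),
  [/\ open D', conj_symmetric D', D' `<=` D,
      exists2 g, slice_regular D' g &
        forall x, circularization D' x -> f x = Some (g x) &
      forall q, circularization D q -> ~ circularization D' q ->
        (pole f q /\ f q = None) \/ removable f q].

(* Around S_q, f is P ^ n times a zero-free slice preserving regular function. *)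
Definition has_order (P : quat R -> quat R) (f : quat R -> hquat) q (n : int) :=
  exists E g, [/\ circular_nbhd q E, slice_regular E g,
    slice_preserving (circularization E) (fun x => Some (g x)),
    forall x, circularization E x -> g x != 0 &
    forall x, circularization E x -> ~ sphere_of q x -> f x = Some (P x ^ n * g x)].

Definition real_order (f : quat R -> hquat) (r : R) : int :=
  xget 0 [set n | has_order (fun x => x - r%:A) f r%:A n].
Definition sphere_order (f : quat R -> hquat) q : int :=
  xget 0 [set n | has_order (sph_factor q) f q n].

Definition zero_mult (n : int) : nat := `|Num.max n 0|%N.
Definition pole_mult (n : int) : nat := `|Num.min n 0|%N.

(* The family r lists the real points of U, each repeated m times. *)
Definition lists_reals (U : set (quat R)) (m : R -> nat) (K : Type) (r : K -> R) :=
  (forall k, U (r k)%:A) /\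
  (forall t : R, U t%:A -> [set k | r k = t] #= `I_(m t)).

(* The family a lists the spheres S_q in U with q not real, each repeated m
   times, through arbitrary representatives. *)
Definition lists_spheres (U : set (quat R)) (m : quat R -> nat) (K : Type)
    (a : K -> quat R) :=
  (forall k, U (a k) /\ ~ real_quat (a k)) /\
  (forall q, U q -> ~ real_quat q -> [set k | sphere_of q (a k)] #= `I_(m q)).

(* At a point q_k with M_k = -1 the value is infinity, unless some other
   factor vanishes there, in which case it is left unspecified. *)
Definition is_PQL (U : set (quat R)) (f : quat R -> hquat) (N : nat)
    (a0 : quat R) (a q : 'I_N -> quat R) (M : 'I_N -> int) :=
  [/\ a0 != 0, forall k, a k != 0, forall k, M k = 1 \/ M k = -1,
      forall x, U x -> (forall k, M k = -1 -> x <> q k) ->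
        f x = Some (a0 * \prod_(k < N) ((x - q k) ^ M k * a k)) &
      forall x, U x -> (exists2 k, M k = -1 & x = q k) ->
        (forall k, M k = 1 -> x <> q k) -> f x = None].

Definition log_abs (f : quat R -> hquat) x : \bar R :=
  lne (if f x is Some w then `|w|%:E else +oo%E).

Definition laplacian (u : quat R -> R) : quat R -> R := fun x =>
  \sum_(e <- [:: Quat 1 0 0 0; Quat 0 1 0 0; Quat 0 0 1 0; Quat 0 0 0 1])
     'D_e ('D_e u) x.

Definition real_term (rho t : R) : R :=
  ln (rho / `|t|) + 4^-1 * ((t ^+ 4 - rho ^+ 4) / (rho ^+ 2 * t ^+ 2)).

Definition sphere_term (rho : R) (b : quat R) : R :=
  ln (rho ^+ 2 / `|b| ^+ 2) +
  4^-1 * ((rho ^+ 4 - `|b| ^+ 4) / (rho ^+ 2 * `|b| ^+ 4)) *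
    (2 * `|b| ^+ 2 - qre (b + qconj b) ^+ 2).

End SliceFunctions.

Arguments hquat R : clear implicits.
Arguments hcomplex R : clear implicits.

(* Main.v *)
(* The divergence on the unit sphere of p(c) grad c, where c(y) = <y, n> / rho,
   integrates to 0.  Applied to Chebyshev polynomials this gives the spherical
   means of T_k(c): 0 for k different from 0 and 2, and -1/2 for k = 2.  As
   ln |y - q| and ln |(y - q)^s| are series in such T_k(c) for |q| < rho, and
   monotone limits of them for |q| = rho, their means are explicit; so are their
   Laplacians at 0.  This settles (ii), where log|f| is a sum of such terms.

   In (i), f acts on all slices through one meromorphic function Phi.  Cauchy's
   formula yields Phi(w) = G(w) * prod_z (w - z)^(m_z) near the closed disc of
   radius rho, with G holomorphic and free of zeros, so log|f(y)| is one half of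
   sum_z m_z ln |(y - z)^s| plus the symmetrization of ln |G|.  The latter is a
   series of terms Re (c_n w^n), that is of multiples of rho^n T_n(Re w / rho),
   and only c_0 and c_2 contribute to its mean and to its Laplacian at 0.
   Finally m_z is the order of f along S_z: a sphere collects the two conjugate
   points of a slice, and at a real point the real term is half of the spherical
   one. *)
Require Import Defs.
From HB Require Import structures.
From mathcomp Require Import all_boot all_order all_algebra.
From mathcomp Require Import all_classical all_reals all_analysis.
From mathcomp Require Import complex measurable_realfun.
From mathcomp Require Import ring lra.
Import Order.TTheory GRing.Theory Num.Theory.
Import numFieldNormedType.Exports.
Import HBNNSimple.
Local Open Scope classical_set_scope.
Local Open Scope ring_scope.
Local Open Scope complex_scope.
Set Implicit Arguments.
Unset Strict Implicit.
Unset Printing Implicit Defensive.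

(** * Chebyshev polynomials *)

(** For integration L over the sphere the divergence identity amounts to (j + 4) L(T_(j+2)) = (j -
    2) L(T_j); the factor j - 2 ends the chain of even degrees at T_2. Only ratios to the mass of
    the sphere occur, so that mass is shown positive and finite but never computed.

    The constant rho^2 / 8 is fixed by degree two: Re (w^2) has mean - rho^2 / 2 over the sphere and
    Laplacian -4, so the mean minus rho^2 / 8 times the Laplacian returns the value at 0 of every
    such series. For the logarithm of a factor with a zero inside the ball, the expansion valid on
    the sphere differs from the one valid at 0, and the defect is the real or spherical term.

    Two obstacles shape the rest. A branch of the logarithm of G is avoided as well: ln |G| is
    recovered from G' / G along radii. *)

Section Chebyshev.
Context {R : realType}.

(* [chebT k] and [chebV k] are the Chebyshev polynomials of the first kind of
   degree k and of the second kind of degree k - 1. *)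
Fixpoint cheb (k : nat) : {poly R} * {poly R} :=
  if k is k'.+1 then
    ('X * (cheb k').1 - (1 - 'X ^+ 2) * (cheb k').2, 'X * (cheb k').2 + (cheb k').1)
  else (1, 0).
Definition chebT k : {poly R} := locked (cheb k).1.
Definition chebV k : {poly R} := locked (cheb k).2.

Lemma chebT0 : chebT 0 = 1. Proof. by rewrite /chebT -lock. Qed.
Lemma chebV0 : chebV 0 = 0. Proof. by rewrite /chebV -lock. Qed.
Lemma chebTS k : chebT k.+1 = 'X * chebT k - (1 - 'X ^+ 2) * chebV k.
Proof. by rewrite /chebT /chebV -!lock. Qed.
Lemma chebVS k : chebV k.+1 = 'X * chebV k + chebT k.
Proof. by rewrite /chebT /chebV -!lock. Qed.

Lemma chebV_pred k : chebV k = 'X * chebV k.+1 - chebT k.+1.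
Proof. by rewrite chebTS chebVS; ring. Qed.

Lemma chebT_rec k : chebT k.+2 = 'X * chebT k.+1 *+ 2 - chebT k.
Proof. by rewrite chebTS [in LHS]chebVS !chebTS; ring. Qed.

(** Under x = cos t these are the x-derivatives of sin (k t) / sin t and of cos (k t). They are
    proved together because the induction step of each uses both. *)
Lemma deriv_chebV k :
  (1 - 'X ^+ 2) * (chebV k)^`() = 'X * chebV k - chebT k *+ k
  /\ (chebT k)^`() = chebV k *+ k.
Proof.
elim: k => [|k [IHV IHT]].
  by rewrite chebV0 chebT0 !mulr0n deriv0 -polyC1 derivC !mulr0 subr0.
have d1 : (1 : {poly R})^`() = 0 by rewrite -polyC1 derivC.
rewrite chebVS chebTS derivB !derivD !derivM derivB d1 derivX derivXn IHT expr1; split.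
  transitivity ((1 - 'X ^+ 2) * chebV k *+ k.+1 + 'X * ((1 - 'X ^+ 2) * (chebV k)^`())).
    by ring.
  by rewrite IHV; ring.
transitivity (chebT k + 'X * chebV k *+ k + 'X * chebV k *+ 2 - (1 - 'X ^+ 2) * (chebV k)^`()).
  by ring.
by rewrite IHV; ring.
Qed.

(** The identity cos^2 + sin^2 = 1 in polynomial form; it bounds T_k on [-1, 1] without angles. *)
Lemma cheb_norm k : chebT k ^+ 2 + (1 - 'X ^+ 2) * chebV k ^+ 2 = 1.
Proof.
elim: k => [|k IH]; first by rewrite chebT0 chebV0; ring.
rewrite chebTS chebVS -[RHS]IH; ring.
Qed.

Lemma chebT_le1 k (c : R) : `|c| <= 1 -> `|(chebT k).[c]| <= 1.
Proof.
move=> c1; rewrite -(@expr_le1 _ 2)// -normrX ger0_norm ?sqr_ge0//.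
have E : (chebT k).[c] ^+ 2 + (1 - c ^+ 2) * (chebV k).[c] ^+ 2 = 1.
  have := congr1 (fun p => p.[c]) (cheb_norm k).
  by rewrite hornerD [X in _ + X]hornerM hornerD hornerN !horner_exp hornerX -polyC1 !hornerC.
rewrite -[leRHS]E lerDl; apply: mulr_ge0; last exact: sqr_ge0.
rewrite subr_ge0.
by rewrite -[leLHS]ger0_norm ?sqr_ge0// normrX expr_le1.
Qed.

Lemma cheb_cos k (x : R) :
  (chebT k).[cos x] = cos (k%:R * x) /\ (chebV k).[cos x] * sin x = sin (k%:R * x).
Proof.
elim: k => [|k [IHT IHV]].
  by rewrite chebT0 chebV0 !mul0r cos0 sin0 hornerC horner0 mul0r.
have -> : k.+1%:R * x = k%:R * x + x by rewrite -natr1 mulrDl mul1r.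
rewrite chebTS chebVS !hornerE cosD sinD -IHT -IHV.
split; last by ring.
rewrite -[X in X - _]mulrC; congr (_ - _).
by rewrite -sin2cos2; ring.
Qed.

Lemma chebTM k (a b : R) : (chebT k).[cos (a - b)] + (chebT k).[cos (a + b)] =
  2 * (chebT k).[cos a] * (chebT k).[cos b].
Proof.
rewrite !(proj1 (cheb_cos _ _)) mulrBr mulrDr cosB cosD; ring.
Qed.

Section Functional.
Context (L : {poly R} -> R).
Hypothesis LD : forall p q, L (p + q) = L p + L q.
Hypothesis LZ : forall (a : R) p, L (a *: p) = a * L p.
Hypothesis Ldiv : forall p, L ((1 - 'X ^+ 2) * p^`() - ('X * p) *+ 3) = 0.

Let LB p q : L (p - q) = L p - L q.
Proof. by rewrite LD -scaleN1r LZ mulN1r. Qed.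
Let LMn p n : L (p *+ n) = L p *+ n.
Proof. by rewrite -scaler_nat LZ mulr_natl. Qed.

(** For integration over the sphere, [Ldiv] is the divergence theorem. Taken at p = V_j it relates
    L(T_j) to L(X V_j); eliminating the latter leaves a recurrence of step two. *)
Lemma functional_chebT k : k != 0%N ->
  L (chebT k) = - (L 1 / 2) *+ (k == 2%N).
Proof.
have xy j : j%:R * L (chebT j) + 2 * L ('X * chebV j) = 0.
  have := Ldiv (chebV j); rewrite (deriv_chebV j).1 !LB !LMn !mulr_natl => H.
  by apply/eqP; rewrite -oppr_eq0 -H; apply/eqP; ring.
(* V_(j+1) is written both as X V_j + T_j and as X V_(j+2) - T_(j+2), and [xy] removes the terms in
   V. The factor j - 2 makes L(T_4) vanish, and with it all even degrees from 4 on. *)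
have rec j : L (chebT j.+2) * j.+4%:R = (j%:R - 2) * L (chebT j).
  have := chebV_pred j.+1; rewrite chebVS => /(congr1 L); rewrite LB LD => H.
  have := xy j; have := xy j.+2; rewrite -!natr1.
  move: H; set a := L _; set b := L _; set c := L _; set d := L _; set e := j%:R.
  move=> H H1 H2; nra.
have x1 : L (chebT 1) = 0.
  have := xy 1%N; rewrite chebVS chebTS chebT0 chebV0.
  rewrite !mulr0 subr0 !mulr1 add0r mulr1 => ?; lra.
elim/ltn_ind: k => -[//|[|[|k]]] IH _.
- by rewrite x1 mulr0n.
- by have := rec 0%N; rewrite chebT0 eqxx mulr1n => ?; lra.
- have := rec k.+1.
  have -> : (k.+1%:R - 2) * L (chebT k.+1) = 0.
    rewrite IH//; case: k {IH} => [|[|k]]/=; rewrite ?mulr0n ?mulr0//.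
    by rewrite subrr mul0r.
  by move/eqP; rewrite mulf_eq0 pnatr_eq0 orbF => /eqP.
Qed.

End Functional.

(** The generating function of the T_k, truncated: the three-term recurrence telescopes the product
    and leaves two boundary terms. *)
Lemma cheb_sum_gen (c s : R) N :
  (\sum_(n < N) s ^+ n * (chebT n.+1).[c]) * (1 - 2 * c * s + s ^+ 2) =
  c - s - s ^+ N * (chebT N.+1).[c] + s ^+ N.+1 * (chebT N).[c].
Proof.
elim: N => [|N IH].
  by rewrite big_ord0 chebTS chebT0 chebV0 !hornerE; ring.
rewrite big_ord_recr/= mulrDl IH chebT_rec !hornerE [s ^+ N.+2]exprS [s ^+ N.+1]exprS.
by set e := s ^+ N; set t1 := (chebT N.+1).[c]; set t0 := (chebT N).[c]; ring.
Qed.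

(** The series of ln (1 - 2 c t + t^2) with an explicit remainder. The bound is uniform in c, which
    allows integration term by term over the sphere. *)
Lemma cheb_log (c t : R) N : `|c| <= 1 -> 0 <= t < 1 ->
  `| ln (1 - 2 * c * t + t ^+ 2) + 2 * \sum_(n < N) t ^+ n.+1 * (chebT n.+1).[c] / n.+1%:R |
    <= 4 * t ^+ N / (1 - t) ^+ 2.
Proof.
move=> c1 /andP[t0 t1].
pose E s := ln (1 - 2 * c * s + s ^+ 2) +
  2 * \sum_(n < N) s ^+ n.+1 * (chebT n.+1).[c] / n.+1%:R.
have c1' : -1 <= c <= 1 by rewrite -ler_norml.
have pos (s : R) : 0 <= s -> s < 1 -> (1 - s) ^+ 2 <= 1 - 2 * c * s + s ^+ 2.
  by move=> s0 s1; move: c1'; nra.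
have pos' (s : R) : 0 <= s -> s < 1 -> 0 < 1 - 2 * c * s + s ^+ 2.
  by move=> s0 s1; apply: lt_le_trans (pos _ s0 s1); rewrite exprn_gt0// subr_gt0.
have dP (s : R) : is_derive s (1 : R) (fun s => 2 * \sum_(n < N) s ^+ n.+1 * (chebT n.+1).[c] / n.+1%:R)
    (2 * \sum_(n < N) s ^+ n * (chebT n.+1).[c]).
  pose p : {poly R} := 2 *: \sum_(n < N) ((chebT n.+1).[c] / n.+1%:R) *: 'X^(n.+1).
  have -> : (fun s => 2 * \sum_(n < N) s ^+ n.+1 * (chebT n.+1).[c] / n.+1%:R) = horner p.
    apply/funext => z; rewrite /p hornerZ horner_sum; congr (_ * _).
    by apply: eq_bigr => i _; rewrite !hornerE; ring.
  have -> : 2 * \sum_(n < N) s ^+ n * (chebT n.+1).[c] = p^`().[s].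
    rewrite /p derivZ hornerZ raddf_sum horner_sum; congr (_ * _).
    apply: eq_bigr => i _; rewrite /= derivZ derivXn !hornerE/= ?hornerMn ?hornerXn.
    have n0 : i.+1%:R != 0 :> R by rewrite pnatr_eq0.
    by rewrite -[s ^+ i *+ _]mulr_natr mulrA mulrAC divfK// mulrC.
  exact: is_derive_poly.
have dE (s : R) : 0 <= s -> s < 1 -> is_derive s (1 : R) E
    ((2 * s - 2 * c) / (1 - 2 * c * s + s ^+ 2) + 2 * \sum_(n < N) s ^+ n * (chebT n.+1).[c]).
  move=> s0 s1.
  apply: (is_deriveD (f := fun s => ln (1 - 2 * c * s + s ^+ 2)) _ (dP s)).
  rewrite [X in is_derive _ _ _ X]mulrC; apply: (@is_derive1_comp _ (@ln R) (fun s => 1 - 2 * c * s + s ^+ 2)).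
    by apply: is_derive1_ln; exact: pos'.
  pose p : {poly R} := 1 - (2 * c) *: 'X + 'X ^+ 2.
  have -> : (fun s => 1 - 2 * c * s + s ^+ 2) = horner p.
    by apply/funext => z; rewrite /p !hornerE.
  have -> : 2 * s - 2 * c = p^`().[s].
    have d1 : (1 : {poly R})^`() = 0 by rewrite -polyC1 derivC.
    by rewrite /p derivD derivB derivZ d1 derivX derivXn expr1 hornerD hornerMn hornerD hornerN hornerZ
      -polyC1 !hornerE /=; ring.
  exact: is_derive_poly.
rewrite -/(E t).
have E0 : E 0 = 0.
  rewrite /E mulr0 subr0 expr0n addr0 ln1 add0r big1 ?mulr0// => i _.
  by rewrite expr0n !mul0r.
have [->|t0'] := eqVneq t 0.
  by rewrite E0 normr0 divr_ge0 ?sqr_ge0// mulr_ge0// exprn_ge0.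
have {t0'} t0' : 0 < t by rewrite lt_neqAle eq_sym t0' t0.
have [||x /[!in_itv]/= /andP[x0 xt] Et] := @MVT _ E
  (fun s => (2 * s - 2 * c) / (1 - 2 * c * s + s ^+ 2) +
     2 * \sum_(n < N) s ^+ n * (chebT n.+1).[c]) 0 t t0'.
- by move=> x /[!in_itv]/= /andP[x0 xt]; apply: dE; [exact: ltW|exact: lt_trans t1].
- apply: derivable_within_continuous => x /[!in_itv]/= /andP[x0 xt].
  by have [] := dE _ x0 (le_lt_trans xt t1).
move: Et; rewrite E0 !subr0 => ->.
have x1 : x < 1 by exact: lt_trans t1.
have Q0 := pos' _ (ltW x0) x1.
(* The partial sum cancels the logarithmic derivative up to truncation terms, so the mean value
   theorem yields a geometric bound. *)
have -> : (2 * x - 2 * c) / (1 - 2 * c * x + x ^+ 2) +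
     2 * \sum_(n < N) x ^+ n * (chebT n.+1).[c] =
  2 * (x ^+ N.+1 * (chebT N).[c] - x ^+ N * (chebT N.+1).[c]) / (1 - 2 * c * x + x ^+ 2).
  apply: (mulIf (lt0r_neq0 Q0)); rewrite mulrDl !divfK ?lt0r_neq0//.
  have := cheb_sum_gen c x N; set S := \sum_(n < N) _; set Q := 1 - _ + _ => SQ.
  by rewrite -mulrA SQ; ring.
rewrite normrM (ger0_norm t0) normrM normfV (gtr0_norm Q0) normrM ger0_norm//.
have num : `|x ^+ N.+1 * (chebT N).[c] - x ^+ N * (chebT N.+1).[c]| <= 2 * t ^+ N.
  have xN : x ^+ N <= t ^+ N by rewrite lerXn2r ?nnegrE ?(ltW x0)// ltW.
  rewrite (le_trans (ler_normB _ _))// !normrM !(ger0_norm (exprn_ge0 _ (ltW x0))).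
  rewrite mulr_natl mulr2n lerD//; last first.
    by rewrite -[leRHS]mulr1 ler_pM ?exprn_ge0 ?chebT_le1// ltW.
  rewrite -[leRHS]mulr1 ler_pM ?exprn_ge0 ?chebT_le1// ?(ltW x0)//.
  by rewrite exprS (le_trans _ xN)// ler_piMl ?exprn_ge0 ?(ltW x0)// ltW.
rewrite -[leRHS]mulr1 ler_pM ?(ltW t1)//.
  by rewrite !mulr_ge0// invr_ge0 ltW.
rewrite ler_pM// ?mulr_ge0 ?invr_ge0 ?(ltW Q0)//.
  by move: num; set u := `|_|; set v := t ^+ N => ?; lra.
rewrite lef_pV2 ?posrE// ?exprn_gt0 ?subr_gt0//.
apply: le_trans (pos _ (ltW x0) x1).
by rewrite lerXn2r ?nnegrE ?subr_ge0 ?(ltW t1) ?(ltW x1)// lerB// ltW.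
Qed.

End Chebyshev.

(** * Surface integrals *)

Section BoundedMeasurable.
Context d (T : measurableType d) (R : realType).
Implicit Types f g : T -> R.

(** A class of integrands closed under the ring operations and integrable on every set of finite
    measure, so that integrability can be read off the shape of an expression. *)
Definition bounded_measurable f :=
  measurable_fun setT f /\ exists M, forall t, `|f t| <= M.

Lemma bounded_measurable_cst (a : R) : bounded_measurable (cst a).
Proof. by split=> //; exists `|a|. Qed.

Lemma bounded_measurableD f g : bounded_measurable f -> bounded_measurable g ->
  bounded_measurable (fun t => f t + g t).
Proof.
move=> [mf [M fM]] [mg [N gN]]; split; first exact: measurable_funD.
by exists (M + N) => t; rewrite (le_trans (ler_normD _ _))// lerD.
Qed.

Lemma bounded_measurableM f g : bounded_measurable f -> bounded_measurable g ->
  bounded_measurable (fun t => f t * g t).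
Proof.
move=> [mf [M fM]] [mg [N gN]]; split; first exact: measurable_funM.
by exists (M * N) => t; rewrite normrM ler_pM.
Qed.

Lemma bounded_measurableN f : bounded_measurable f ->
  bounded_measurable (fun t => - f t).
Proof.
move=> [mf [M fM]]; split; first exact: measurable_funN.
by exists M => t; rewrite normrN.
Qed.

Lemma bounded_measurable_sub f : measurable_fun setT f -> forall a b : R,
  (forall t, a <= f t <= b) -> bounded_measurable f.
Proof.
move=> mf a b fab; split => //; exists (`|a| + `|b|) => t.
have /andP[fa fb] := fab t; rewrite ler_norml; apply/andP; split.
  by rewrite (le_trans _ fa)// lerNl -normrN (le_trans (ler_norm _))// lerDl.
by rewrite (le_trans fb)// (le_trans (ler_norm _))// lerDr.
Qed.

Lemma bounded_measurable_horner (p : {poly R}) f : bounded_measurable f ->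
  bounded_measurable (fun t => p.[f t]).
Proof.
move=> bf; elim/poly_ind: p => [|p c IH].
  by under [X in bounded_measurable X]eq_fun do rewrite horner0; exact: bounded_measurable_cst.
under [X in bounded_measurable X]eq_fun do rewrite hornerMXaddC.
by apply: bounded_measurableD; [exact: bounded_measurableM|exact: bounded_measurable_cst].
Qed.

Lemma bounded_measurable_integrable (mu : {measure set T -> \bar R}) (A : set T) f :
  measurable A -> (mu A < +oo)%E -> bounded_measurable f ->
  mu.-integrable A (EFin \o f).
Proof.
move=> mA fA [mf [M fM]]; apply: measurable_bounded_integrable => //.
  exact: measurable_funTS.
exists M; split; first exact: num_real.
by move=> N MN t _ /=; rewrite (le_trans (fM t))// ltW.
Qed.

Lemma integral_bounded_measurableD (mu : {measure set T -> \bar R}) (A : set T) f g :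
  measurable A -> (mu A < +oo)%E -> bounded_measurable f -> bounded_measurable g ->
  (\int[mu]_(x in A) (f x + g x)%:E =
   \int[mu]_(x in A) (f x)%:E + \int[mu]_(x in A) (g x)%:E)%E.
Proof.
move=> mA fA bf bg; under eq_integral do rewrite EFinD.
by rewrite integralD//; exact: bounded_measurable_integrable.
Qed.

End BoundedMeasurable.

Lemma bounded_measurable_comp d d' (T : measurableType d) (T' : measurableType d')
    (R : realType) (f : T -> R) (g : T' -> T) :
  measurable_fun setT g -> bounded_measurable f -> bounded_measurable (f \o g).
Proof.
move=> mg [mf [M fM]]; split; first exact: measurableT_comp.
by exists M => t /=.
Qed.

Section Fubini0.
Context d1 d2 (T1 : measurableType d1) (T2 : measurableType d2) (R : realType).
Context (m1 : {sigma_finite_measure set T1 -> \bar R}).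
Context (m2 : {sigma_finite_measure set T2 -> \bar R}).
Context (D1 : set T1) (D2 : set T2) (F : T1 * T2 -> R).
Hypotheses (mD1 : measurable D1) (mD2 : measurable D2).
Hypotheses (fD1 : (m1 D1 < +oo)%E) (fD2 : (m2 D2 < +oo)%E).
Hypothesis bF : bounded_measurable F.

Let F' := (EFin \o F) \_ (D1 `*` D2).

Lemma product_measure_lty : ((m1 \x m2)%E (D1 `*` D2) < +oo)%E.
Proof.
by rewrite product_measure1E// lte_mul_pinfty// ge0_fin_numE.
Qed.

Let iF : (m1 \x m2)%E.-integrable setT F'.
Proof.
apply/(integrable_mkcond (EFin \o F)); first exact: measurableX.
apply: bounded_measurable_integrable => //; first exact: measurableX.
exact: product_measure_lty.
Qed.

(** Boundedness on a product of sets of finite measure gives the integrability that Fubini's theorem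
    asks for. *)
Lemma fubini_eq0l :
  (forall y, D2 y -> (\int[m1]_(x in D1) (F (x, y))%:E = 0)%E) ->
  (\int[m1 \x m2]_(z in D1 `*` D2) (F z)%:E = 0)%E.
Proof.
move=> F0; rewrite integral_mkcond -(integral21_prod_meas1 iF).
apply: integral0_eq => y _; rewrite /fubini_G /F'.
have [D2y|D2y] := pselect (D2 y).
  rewrite -[RHS](F0 y D2y) [RHS]integral_mkcond; apply: eq_integral => x _.
  rewrite !patchE; congr (if _ then _ else _); apply/idP/idP; rewrite !inE/=.
    by case.
  by move=> ?; split.
apply: integral0_eq => x _; rewrite patchE; case: ifPn => //.
by rewrite inE => -[].
Qed.

Lemma fubini_eq0r :
  (forall x, D1 x -> (\int[m2]_(y in D2) (F (x, y))%:E = 0)%E) ->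
  (\int[m1 \x m2]_(z in D1 `*` D2) (F z)%:E = 0)%E.
Proof.
move=> F0; rewrite integral_mkcond -(integral12_prod_meas1 iF).
apply: integral0_eq => x _; rewrite /fubini_F /F'.
have [D1x|D1x] := pselect (D1 x).
  rewrite -[RHS](F0 x D1x) [RHS]integral_mkcond; apply: eq_integral => y _.
  rewrite !patchE; congr (if _ then _ else _); apply/idP/idP; rewrite !inE/=.
    by case.
  by move=> ?; split.
apply: integral0_eq => y _; rewrite patchE; case: ifPn => //.
by rewrite inE => -[].
Qed.

End Fubini0.

Lemma integral_derive (R : realType) (F f : R -> R) (a b : R) : a < b ->
  (forall x, is_derive x (1 : R) F (f x)) -> continuous f ->
  (\int[lebesgue_measure]_(x in `[a, b]) (f x)%:E)%E = (F b - F a)%:E.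
Proof.
move=> ab dF cf; rewrite (continuous_FTC2 (F := F))//.
- exact: continuous_subspaceT.
- have cF : continuous F.
    by move=> x; apply: differentiable_continuous; apply/derivable1_diffP; case: (dF x).
  by split; [move=> x _; case: (dF x)|apply: cvg_at_right_filter; exact: cF|
    apply: cvg_at_left_filter; exact: cF].
- by move=> x _; rewrite derive1E; case: (dF x).
Qed.

Section DensityPushforward.
Context d d' (T : measurableType d) (T' : measurableType d') (R : realType).
Context (m : {measure set T -> \bar R}) (nu : {measure set T' -> \bar R}).
Context (D : set T) (H : T -> T') (J : T -> R).
Hypotheses (mD : measurable D) (mH : measurable_fun setT H).
Hypotheses (mJ : measurable_fun D J) (J0 : forall t, D t -> 0 <= J t).
Hypothesis nuE : forall A, nu A = (\int[m]_(t in D `&` H @^-1` A) (J t)%:E)%E.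

(** On indicator functions the claim is [nuE]; simple functions and monotone convergence extend
    it. *)
Lemma ge0_integral_density_pushforward (h : T' -> \bar R) :
  measurable_fun setT h -> (forall y, 0 <= h y)%E ->
  (\int[nu]_y h y = \int[m]_(t in D) (h (H t) * (J t)%:E))%E.
Proof.
move=> mh h0.
have mgH (g : T' -> R) : measurable_fun setT g -> measurable_fun D (g \o H).
  by move=> mg; apply: measurable_funTS; exact: measurableT_comp.
pose g := nnsfun_approx measurableT mh.
have gh y : (g n y)%:E @[n --> \oo] --> h y by exact: cvg_nnsfun_approx.
have ndg y : {homo (fun n => (g n y)%:E) : n m / (n <= m)%N >-> (n <= m)%E}.
  by move=> k n kn; rewrite lee_fin; exact/lefP/nd_nnsfun_approx.
transitivity (limn (fun n => \int[nu]_y (g n y)%:E))%E.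
  rewrite -monotone_convergence//.
  - by apply: eq_integral => y _; apply/esym/cvg_lim => //; exact: gh.
  - by move=> n; apply/measurable_EFinP.
  - by move=> n y _; rewrite lee_fin.
transitivity (limn (fun n => \int[m]_(t in D) ((g n (H t))%:E * (J t)%:E)))%E; last first.
  rewrite -monotone_convergence//.
  - apply: eq_integral => t /[!inE] At; apply: cvg_lim => //.
    by apply: cvgeZr => //; exact: gh.
  - by move=> n; apply: emeasurable_funM; apply/measurable_EFinP => //; exact: mgH.
  - by move=> n t At; rewrite mule_ge0// lee_fin ?J0.
  - move=> t At k n kn; apply: lee_wpmul2r; first by rewrite lee_fin J0.
    exact: ndg.
congr (limn _); apply/funext => n.
rewrite integralT_nnsfun sintegralE.
transitivity (\int[m]_(t in D) (\sum_(x \in range (g n))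
    (x * \1_(g n @^-1` [set x]) (H t) * J t)%:E))%E.
  rewrite ge0_integral_fsum//.
  - apply: eq_fsbigr => x; rewrite inE => -[y _ <-]; rewrite nuE.
    under [RHS]eq_integral do rewrite -mulrA EFinM.
    rewrite ge0_integralZl_EFin//; last 2 first.
    - by move=> t At; rewrite lee_fin mulr_ge0// J0.
    - apply/measurable_EFinP; apply: measurable_funM => //.
      by apply: mgH; exact: measurable_indic.
    congr (_ * _)%E; rewrite integral_mkcondr; apply: eq_integral => t At.
    rewrite patchE indicE (_ : (t \in _) = (H t \in g n @^-1` [set g n y])).
      by case: ifP => _; rewrite ?mul1r ?mul0r.
    by apply/idP/idP; rewrite !inE.
  - move=> x; apply/measurable_EFinP; apply: measurable_funM => //.
    by apply: measurable_funM => //; apply: mgH; exact: measurable_indic.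
  - move=> x t At; rewrite lee_fin mulr_ge0 ?J0//.
    rewrite indicE; case: (boolP (_ \in _)) => [|_]; last by rewrite mulr0.
    by rewrite inE/= mulr1 => <-.
apply: eq_integral => t At.
rewrite -EFinM fimfunE fsumEFin//; congr _%:E.
by rewrite mulr_fsuml.
Qed.

End DensityPushforward.

(* The library declares the sigma-finiteness of products canonically only for
   subprobabilities, hence this copy of the product measure. *)
Section SigmaFiniteProduct.
Context d1 d2 (T1 : measurableType d1) (T2 : measurableType d2) (R : realType).
Context (m1 : {sigma_finite_measure set T1 -> \bar R}).
Context (m2 : {sigma_finite_measure set T2 -> \bar R}).

Definition sigma_finite_prod : set (T1 * T2) -> \bar R := (m1 \x m2)%E.

Let sigma_finite_prodT : sigma_finite setT sigma_finite_prod.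
Proof.
have /sigma_finiteP[A [AT ndA Afin]] := sigma_finiteT m1.
have /sigma_finiteP[B [BT ndB Bfin]] := sigma_finiteT m2.
exists (fun n => A n `*` B n) => [|n].
  apply/seteqP; split => // -[x y] _.
  have [n _ Anx] : (\bigcup_n A n) x by rewrite -AT.
  have [m _ Bmy] : (\bigcup_n B n) y by rewrite -BT.
  exists (n + m)%N => //; split => /=.
    by move: x Anx; apply/subsetPset/ndA; exact: leq_addr.
  by move: y Bmy; apply/subsetPset/ndB; exact: leq_addl.
have [[mA fA] [mB fB]] := (Afin n, Bfin n).
split; first exact: measurableX.
exact: product_measure_lty.
Qed.

HB.instance Definition _ := Measure.copy sigma_finite_prod (m1 \x m2)%E.
HB.instance Definition _ :=
  Measure_isSigmaFinite.Build _ _ _ sigma_finite_prod sigma_finite_prodT.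

End SigmaFiniteProduct.

Section SurfaceIntegral.
Context {R : realType}.
Let A3 := (measurableTypeR R * measurableTypeR R * measurableTypeR R)%type.
Definition leb1 : {sigma_finite_measure set (measurableTypeR R) -> \bar R} :=
  @lebesgue_measure R.
(** Convertible to the triple product inside [surface_measure], in a form known to be sigma-finite
    at each stage. *)
Definition leb3 : {sigma_finite_measure set A3 -> \bar R} := sigma_finite_prod (sigma_finite_prod leb1 leb1) leb1.

Lemma integral_derive_eq0 (F f : R -> R) (a b : R) : a < b ->
  (forall x, is_derive x (1 : R) F (f x)) -> continuous f -> F a = F b ->
  (\int[leb1]_(x in `[a, b]) (f x)%:E = 0)%E.
Proof. by move=> ab dF cf Fab; rewrite /leb1/= (integral_derive ab dF cf) Fab subrr. Qed.

Lemma measurable_coord1 : measurable_fun [set: A3] (fun t => t.1.1 : R).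
Proof. exact: (measurableT_comp measurable_fst measurable_fst). Qed.
Lemma measurable_coord2 : measurable_fun [set: A3] (fun t => t.1.2 : R).
Proof. exact: (measurableT_comp measurable_snd measurable_fst). Qed.
Lemma measurable_coord3 : measurable_fun [set: A3] (fun t => t.2 : R).
Proof. exact: measurable_snd. Qed.

Lemma bounded_measurable_sin d (T : measurableType d) (f : T -> R) :
  measurable_fun setT f -> bounded_measurable (fun t => sin (f t)).
Proof.
move=> mf; apply: (@bounded_measurable_sub _ _ _ _ _ (-1) 1).
  by apply: measurableT_comp mf; apply: continuous_measurable_fun; exact: continuous_sin.
by move=> t; rewrite sin_geN1 sin_le1.
Qed.
Lemma bounded_measurable_cos d (T : measurableType d) (f : T -> R) :
  measurable_fun setT f -> bounded_measurable (fun t => cos (f t)).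
Proof.
move=> mf; apply: (@bounded_measurable_sub _ _ _ _ _ (-1) 1).
  by apply: measurableT_comp mf; apply: continuous_measurable_fun; exact: continuous_cos.
by move=> t; rewrite cos_geN1 cos_le1.
Qed.

Lemma leb3_angles_lty : (leb3 angles < +oo)%E.
Proof.
rewrite /angles; apply: product_measure_lty => //.
- exact: measurableX.
- apply: product_measure_lty => //=; rewrite lebesgue_measure_itv/=; case: ifP => // _;
  by rewrite -EFinB ltry.
- by rewrite /= lebesgue_measure_itv/=; case: ifP => // _; rewrite -EFinB ltry.
Qed.

Lemma bounded_measurable_jacobian rho :
  bounded_measurable (hyperspherical_jacobian rho : A3 -> R).
Proof.
apply: bounded_measurableM; first exact: bounded_measurable_cst.
rewrite (_ : (fun _ => _) = fun t : A3 => sin t.1.1 * sin t.1.1 * sin t.1.2)//.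
by repeat (apply: bounded_measurableM); apply: bounded_measurable_sin;
  [exact: measurable_coord1|exact: measurable_coord1|exact: measurable_coord2].
Qed.

Lemma jacobian_ge0 rho t : angles t -> 0 <= hyperspherical_jacobian rho t :> R.
Proof.
move=> [[]]/=; rewrite !in_itv/= => _ t2 _.
by rewrite mulr_ge0 ?exprn_ge0// mulr_ge0 ?sqr_ge0// sin_ge0_pi.
Qed.

Lemma ge0_integral_surface rho (h : quat R -> \bar R) :
  measurable_fun setT h -> (forall y, 0 <= h y)%E ->
  (\int[surface_measure rho]_y h y = \int[leb3]_(t in angles)
     (h (hyperspherical rho t) * (hyperspherical_jacobian rho t)%:E))%E.
Proof.
move=> mh h0; apply: (@ge0_integral_density_pushforward _ _ _ _ _ leb3) => //.
- exact: measurable_angles.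
- exact: measurable_hyperspherical.
- by apply: measurable_funTS; have [] := bounded_measurable_jacobian rho.
- by move=> t /jacobian_ge0.
Qed.

End SurfaceIntegral.

(** * The divergence theorem on the sphere in angular coordinates *)

Section Divergence.
Context {R : realType} (n : quat R).
Let A3 := (measurableTypeR R * measurableTypeR R * measurableTypeR R)%type.
Let n0 := qre n. Let n1 := qim1 n. Let n2 := qim2 n. Let n3 := qim3 n.

(** For n of norm 1, [c] is the cosine <y, n> / rho in the angles s, h, f, nested through [w] and
    [v]. The primed functions are the derivatives of [v] in f, of [w] in h and of [c] in s. *)
Let v (f : R) := n2 * cos f + n3 * sin f.
Let v' (f : R) := - n2 * sin f + n3 * cos f.
Let w (h f : R) := n1 * cos h + sin h * v f.
Let w' (h f : R) := - n1 * sin h + cos h * v f.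
Let c (s h f : R) := n0 * cos s + sin s * w h f.
Let c' (s h f : R) := - n0 * sin s + cos s * w h f.

Definition sphere_cos (t : A3) : R := c t.1.1 t.1.2 t.2.

(** The metric is diagonal in these angles, with volume density g = sin(s)^2 sin(h). [F1], [F2],
    [F3] are the expanded derivatives in s, h, f of g p(c) times the components of grad c. The
    density cancels the denominators of the inverse metric, so all three are polynomial in sines,
    cosines and values of p and p', hence bounded up to the poles. *)
Let F1 (p : {poly R}) (t : A3) : R :=
  (2 * sin t.1.1 * cos t.1.1 * sin t.1.2 * c' t.1.1 t.1.2 t.2
    - sin t.1.1 * sin t.1.1 * sin t.1.2 * c t.1.1 t.1.2 t.2) * p.[c t.1.1 t.1.2 t.2] +
  sin t.1.1 * sin t.1.1 * sin t.1.2 * c' t.1.1 t.1.2 t.2 * c' t.1.1 t.1.2 t.2 *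
    p^`().[c t.1.1 t.1.2 t.2].
Let F2 (p : {poly R}) (t : A3) : R :=
  (sin t.1.1 * (cos t.1.2 * w' t.1.2 t.2 - sin t.1.2 * w t.1.2 t.2)) *
     p.[c t.1.1 t.1.2 t.2] +
  sin t.1.1 * sin t.1.1 * sin t.1.2 * w' t.1.2 t.2 * w' t.1.2 t.2 *
    p^`().[c t.1.1 t.1.2 t.2].
Let F3 (p : {poly R}) (t : A3) : R :=
  - sin t.1.1 * v t.2 * p.[c t.1.1 t.1.2 t.2] +
  sin t.1.1 * sin t.1.1 * sin t.1.2 * v' t.2 * v' t.2 * p^`().[c t.1.1 t.1.2 t.2].

Let trig1 (x : R) : sin x * sin x = 1 - cos x * cos x.
Proof. by rewrite -!expr2 sin2cos2. Qed.

(** The divergence of p(c) grad c is p'(c) |grad c|^2 plus p(c) times the Laplacian of c; on the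
    unit sphere |grad c|^2 = 1 - c^2 and the Laplacian of c is -3 c. *)
Let divE (p : {poly R}) (t : A3) : n0 ^+ 2 + n1 ^+ 2 + n2 ^+ 2 + n3 ^+ 2 = 1 ->
  F1 p t + (F2 p t + F3 p t) =
  ((1 - 'X ^+ 2) * p^`() - ('X * p) *+ 3).[sphere_cos t] * (sin t.1.1 ^+ 2 * sin t.1.2).
Proof.
move=> n1E; rewrite /F1 /F2 /F3 /sphere_cos; move: t => [[s h] f] /=.
rewrite !hornerE /= -/(c s h f).
have cc : c s h f * c s h f = n0 * n0 + w h f * w h f - c' s h f * c' s h f.
  by rewrite /c /c'; have := trig1 s; move: (sin s) (cos s) (w h f) => x y z xy; ring: xy.
have ww : w h f * w h f = n1 * n1 + v f * v f - w' h f * w' h f.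
  by rewrite /w /w'; have := trig1 h; move: (sin h) (cos h) (v f) => x y z xy; ring: xy.
have vv : v f * v f = n2 * n2 + n3 * n3 - v' f * v' f.
  by rewrite /v /v'; have := trig1 f; move: (sin f) (cos f) => x y xy; ring: xy.
have cw : cos s * c' s h f = w h f - sin s * c s h f.
  by rewrite /c /c'; have := trig1 s; move: (sin s) (cos s) (w h f) => x y z xy; ring: xy.
have wv : cos h * w' h f = v f - sin h * w h f.
  by rewrite /w /w'; have := trig1 h; move: (sin h) (cos h) (v f) => x y z xy; ring: xy.
move: cc ww vv cw wv.
move: (c s h f) (c' s h f) (w h f) (w' h f) (v f) (v' f) (p.[c s h f]) (p^`().[c s h f]).
move: n1E (sin s) (cos s) (sin h) (cos h) => n1E a b d e C C' W W' V V' P P' cc ww vv cw wv.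
have C2 : C' * C' + W' * W' + V' * V' = 1 - C * C.
  by rewrite cc ww vv -n1E; ring.
transitivity (a * a * d * (C' * C' + W' * W' + V' * V') * P' +
  (2 * a * d * (b * C') - a * a * d * C + a * (e * W') - a * d * W - a * V) * P).
  by ring.
by rewrite C2 cw wv; ring.
Qed.

Let dtrig (a b x : R) :
  is_derive x (1 : R) (fun x => a * cos x + b * sin x) (- a * sin x + b * cos x).
Proof.
have H : is_derive x (1 : R) (fun x => a *: cos x + b *: sin x) (a *: - sin x + b *: cos x).
  by apply: is_deriveD.
by apply: is_derive_eq H _; rewrite scalerN mulNr.
Qed.

Let dM (f g : R -> R) (x a b : R) : is_derive x (1 : R) f a -> is_derive x (1 : R) g b ->
  is_derive x (1 : R) (fun x => f x * g x) (a * g x + f x * b).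
Proof.
move=> fa gb; apply: is_derive_eq; rewrite addrC /GRing.scale/= [a * _]mulrC//.
Qed.

Let dpoly (p : {poly R}) (f : R -> R) (x a : R) : is_derive x (1 : R) f a ->
  is_derive x (1 : R) (fun x => p.[f x]) (p^`().[f x] * a).
Proof. by move=> fa; apply: is_derive1_comp; exact: is_derive_poly. Qed.

Let ctrig (a b : R) : continuous (fun x => a * cos x + b * sin x).
Proof.
move=> x; apply: differentiable_continuous; apply/derivable1_diffP.
by have [] := dtrig a b x.
Qed.

Let csin : continuous (@sin R). Proof. exact: continuous_sin. Qed.
Let ccos : continuous (@cos R). Proof. exact: continuous_cos. Qed.

Let cM (f g : R -> R) : continuous f -> continuous g -> continuous (fun x => f x * g x).
Proof. by move=> cf cg x; apply: cvgM; [exact: cf|exact: cg]. Qed.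
Let cD (f g : R -> R) : continuous f -> continuous g -> continuous (fun x => f x + g x).
Proof. by move=> cf cg x; apply: cvgD; [exact: cf|exact: cg]. Qed.
Let cC (a : R) : continuous (fun _ : R => a : R).
Proof. by move=> x; exact: cvg_cst. Qed.
Let cpoly (p : {poly R}) (f : R -> R) : continuous f -> continuous (fun x => p.[f x]).
Proof.
by move=> cf x; apply: (@continuous_comp _ _ _ f (horner p)); [exact: cf|exact: continuous_horner].
Qed.

Let cN (f : R -> R) : continuous f -> continuous (fun x => - f x).
Proof. by move=> cf x; apply: cvgN; exact: cf. Qed.

Local Ltac ctac :=
  repeat lazymatch goal with
  | |- continuous (fun _ => ?a) => exact: (cC a)
  | |- continuous (fun x => @?f x + @?g x) => apply: (@cD f g)
  | |- continuous (fun x => - (@?f x)) => apply: (@cN f)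
  | |- continuous (fun x => @?f x * @?g x) => apply: (@cM f g)
  | |- continuous (fun x => horner ?p (@?f x)) => apply: (@cpoly p f)
  | |- continuous (fun x => sin x) => exact: csin
  | |- continuous (fun x => cos x) => exact: ccos
  | |- _ => assumption
  end.

(** In [int1], [int2] and [int3] a pure derivative is integrated: sin s, respectively sin h,
    vanishes at both ends, and the third antiderivative has period 2 pi. *)
Let int1 p (h f : R) :
  (\int[leb1]_(s in `[0%R, pi]) (F1 p (s, h, f))%:E = 0)%E.
Proof.
apply: (@integral_derive_eq0 _ (fun s => sin s * (sin s * (sin h * c' s h f)) * p.[c s h f])).
- exact: pi_gt0.
- by move=> s; apply: is_derive_eq; rewrite /F1 /c' /c /GRing.scale /=; ring.
- have cc : continuous (fun s => c s h f).
    by rewrite /c; under eq_fun do rewrite [sin _ * _]mulrC; exact: ctrig.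
  have cc' : continuous (fun s => c' s h f).
    rewrite (_ : (fun _ => _) = fun s => w h f * cos s + - n0 * sin s); first exact: ctrig.
    by apply/funext => x; rewrite /c'; ring.
  rewrite /F1 /=.
  by ctac.
- by rewrite sinpi sin0 !mul0r.
Qed.

Let int2 p (s f : R) :
  (\int[leb1]_(h in `[0%R, pi]) (F2 p (s, h, f))%:E = 0)%E.
Proof.
apply: (@integral_derive_eq0 _ (fun h => sin h * (sin s * w' h f) * p.[c s h f])).
- exact: pi_gt0.
- move=> h; have dw : is_derive h (1 : R) (fun h => w h f) (w' h f).
    by rewrite /w; under eq_fun do rewrite [sin _ * _]mulrC; rewrite /w' [cos _ * _]mulrC; exact: dtrig.
  have dw' : is_derive h (1 : R) (fun h => w' h f) (- w h f).
    rewrite (_ : (fun _ => _) = fun s => v f * cos s + - n1 * sin s); last first.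
      by apply/funext => x; rewrite /w'; ring.
    by apply: (is_derive_eq (dtrig _ _ _)); rewrite /w; ring.
  by apply: is_derive_eq; rewrite /F2 /c /GRing.scale /=; ring.
- have cw : continuous (fun h => w h f).
    by rewrite /w; under eq_fun do rewrite [sin _ * _]mulrC; exact: ctrig.
  have cw' : continuous (fun h => w' h f).
    rewrite (_ : (fun _ => _) = fun s => v f * cos s + - n1 * sin s); first exact: ctrig.
    by apply/funext => x; rewrite /w'; ring.
  rewrite /F2 /c /=.
  by ctac.
- by rewrite sinpi sin0 !mul0r.
Qed.

Let int3 p (s h : R) :
  (\int[leb1]_(f in `[0%R, (pi *+ 2)%R]) (F3 p (s, h, f))%:E = 0)%E.
Proof.
have dv f : is_derive f (1 : R) v (v' f) by exact: dtrig.
have dv' f : is_derive f (1 : R) v' (- v f).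
  rewrite (_ : v' = fun s => n3 * cos s + - n2 * sin s); last first.
    by apply/funext => x; rewrite /v'; ring.
  by apply: (is_derive_eq (dtrig _ _ _)); rewrite /v; ring.
apply: (@integral_derive_eq0 _ (fun f => (sin s * v' f) * p.[c s h f])).
- by rewrite pmulrn_lgt0// pi_gt0.
- by move=> f; apply: is_derive_eq; rewrite /F3 /c /w /GRing.scale /=; ring.
- have cv : continuous v by exact: ctrig.
  have cv' : continuous v'.
    rewrite (_ : v' = fun s => n3 * cos s + - n2 * sin s); first exact: ctrig.
    by apply/funext => x; rewrite /v'; ring.
  rewrite /F3 /c /w /=.
  by ctac.
- have sin2pi : sin (pi *+ 2) = 0 :> R by rewrite mulr2n sinD sinpi mul0r mulr0 addr0.
  have cos2pi : cos (pi *+ 2) = 1 :> R.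
    by rewrite mulr2n cosD sinpi cospi mulr0 subr0 mulrNN mulr1.
  by rewrite /c /w /v /v' sin2pi cos2pi sin0 cos0.
Qed.

Let bmt : forall f : A3 -> R, measurable_fun setT f ->
  bounded_measurable (fun t => sin (f t)) /\ bounded_measurable (fun t => cos (f t)).
Proof. by move=> f mf; split; [exact: bounded_measurable_sin|exact: bounded_measurable_cos]. Qed.

Let bmsc : [/\ bounded_measurable (fun t : A3 => sin t.1.1 : R),
  bounded_measurable (fun t : A3 => cos t.1.1 : R),
  bounded_measurable (fun t : A3 => sin t.1.2 : R),
  bounded_measurable (fun t : A3 => cos t.1.2 : R) &
  bounded_measurable (fun t : A3 => sin t.2 : R) /\
  bounded_measurable (fun t : A3 => cos t.2 : R)].
Proof.
have [[m1 m2] m3] := (@measurable_coord1 R, @measurable_coord2 R, @measurable_coord3 R).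
by split; [exact: (bmt m1).1|exact: (bmt m1).2|exact: (bmt m2).1|exact: (bmt m2).2|exact: bmt m3].
Qed.

Local Ltac bmtac :=
  case: bmsc => ? ? ? ? [? ?];
  rewrite /F1 /F2 /F3 /sphere_cos /c /c' /w /w' /v /v';
  repeat lazymatch goal with
  | |- bounded_measurable (fun _ => ?a) => apply: (bounded_measurable_cst _ a)
  | |- bounded_measurable (fun x => @?f x + @?g x) => apply: (@bounded_measurableD _ _ _ f g)
  | |- bounded_measurable (fun x => - (@?f x)) => apply: (@bounded_measurableN _ _ _ f)
  | |- bounded_measurable (fun x => @?f x * @?g x) => apply: (@bounded_measurableM _ _ _ f g)
  | |- bounded_measurable (fun x => horner ?p (@?f x)) =>
      apply: (@bounded_measurable_horner _ _ _ p f)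
  | |- _ => assumption
  end.

Lemma bounded_measurable_sphere_cos : bounded_measurable sphere_cos.
Proof. bmtac. Qed.

(* The integrand is the divergence of the product of [p] of [sphere_cos] with
   the gradient of [sphere_cos] on the unit sphere. *)
Lemma integral_sphere_divergence (p : {poly R}) :
  n0 ^+ 2 + n1 ^+ 2 + n2 ^+ 2 + n3 ^+ 2 = 1 ->
  (\int[leb3]_(t in angles)
     (((1 - 'X ^+ 2) * p^`() - ('X * p) *+ 3).[sphere_cos t]
       * (sin t.1.1 ^+ 2 * sin t.1.2))%:E = 0)%E.
Proof.
move=> n1E.
have b1 : bounded_measurable (F1 p) by bmtac.
have b2 : bounded_measurable (F2 p) by bmtac.
have b3 : bounded_measurable (F3 p) by bmtac.
have mA := @measurable_angles R.
have fA := @leb3_angles_lty R.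
have fin (a b : R) : (leb1 `[a, b]%classic < +oo)%E.
  by rewrite /= lebesgue_measure_itv/=; case: ifP => // _; rewrite -EFinB ltry.
have fin2 : (sigma_finite_prod leb1 leb1 (`[(0 : R), pi]%classic `*` `[(0 : R), pi]%classic)%R < +oo)%E.
  exact: product_measure_lty.
have i1 : (\int[leb3]_(t in angles) (F1 p t)%:E = 0)%E.
  apply: (@fubini_eq0l _ _ _ _ _ (sigma_finite_prod leb1 leb1) leb1) => //.
    exact: measurableX.
  move=> f _; apply: (@fubini_eq0l _ _ _ _ _ leb1 leb1 _ _ (fun z => F1 p (z, f))) => //.
    by exact: (bounded_measurable_comp (pair2_measurable f) b1).
have i2 : (\int[leb3]_(t in angles) (F2 p t)%:E = 0)%E.
  apply: (@fubini_eq0l _ _ _ _ _ (sigma_finite_prod leb1 leb1) leb1) => //.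
    exact: measurableX.
  move=> f _; apply: (@fubini_eq0r _ _ _ _ _ leb1 leb1 _ _ (fun z => F2 p (z, f))) => //.
    by exact: (bounded_measurable_comp (pair2_measurable f) b2).
have i3 : (\int[leb3]_(t in angles) (F3 p t)%:E = 0)%E.
  apply: (@fubini_eq0r _ _ _ _ _ (sigma_finite_prod leb1 leb1) leb1) => //.
    exact: measurableX.
  by move=> -[s h] _; exact: int3.
move: (F1 p) (F2 p) (F3 p) b1 b2 b3 i1 i2 i3 (divE p) => G1 G2 G3 b1 b2 b3 i1 i2 i3 E.
under eq_integral do rewrite -E//.
rewrite integral_bounded_measurableD//; last exact: bounded_measurableD.
by rewrite integral_bounded_measurableD// i1 i2 i3 !add0e.
Qed.

End Divergence.

(** * Means over the sphere *)

Section QuatBasics.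
Context {R : realType}.
Implicit Types x y q : quat R.

Lemma quat_normE x :
  `|x| ^+ 2 = qre x ^+ 2 + qim1 x ^+ 2 + qim2 x ^+ 2 + qim3 x ^+ 2.
Proof. exact: qnorm_sqr. Qed.

Definition qdot x y : R :=
  qre x * qre y + qim1 x * qim1 y + qim2 x * qim2 y + qim3 x * qim3 y.

Lemma qnormB_sqr x y : `|x - y| ^+ 2 = `|x| ^+ 2 - 2 * qdot x y + `|y| ^+ 2.
Proof. by rewrite !quat_normE /qdot; case: x y => [? ? ? ?] [? ? ? ?] /=; ring. Qed.

Lemma qdotZ x (a : R) y : qdot x (a *: y) = a * qdot x y.
Proof. by rewrite /qdot /=; ring. Qed.

Lemma qdot_le x y : `|qdot x y| <= `|x| * `|y|.
Proof.
rewrite -(@ler_pXn2r _ 2) ?nnegrE ?mulr_ge0// exprMn -normrX ger0_norm ?sqr_ge0//.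
rewrite !quat_normE /qdot; case: x y => [a b c d] [a' b' c' d'] /=; rewrite -subr_ge0.
have -> : (a ^+ 2 + b ^+ 2 + c ^+ 2 + d ^+ 2) *
            (a' ^+ 2 + b' ^+ 2 + c' ^+ 2 + d' ^+ 2) -
            (a * a' + b * b' + c * c' + d * d') ^+ 2 =
    (a * b' - b * a') ^+ 2 + (a * c' - c * a') ^+ 2 + (a * d' - d * a') ^+ 2 +
    (b * c' - c * b') ^+ 2 + (b * d' - d * b') ^+ 2 + (c * d' - d * c') ^+ 2 by ring.
by rewrite !addr_ge0// sqr_ge0.
Qed.

Lemma measurable_quat d (T : measurableType d) (h : quat R -> T) :
  measurable_fun setT (h \o tuple_quat) -> measurable_fun setT h.
Proof.
move=> mh _ B mB; rewrite setTI; have := mh measurableT _ mB; rewrite setTI.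
by [].
Qed.

Lemma measurable_qcoord : [/\ measurable_fun setT (@qre R), measurable_fun setT (@qim1 R),
  measurable_fun setT (@qim2 R) & measurable_fun setT (@qim3 R)].
Proof.
split; apply: measurable_quat.
- exact: (measurableT_comp measurable_fst (measurableT_comp measurable_fst measurable_fst)).
- exact: (measurableT_comp measurable_snd (measurableT_comp measurable_fst measurable_fst)).
- exact: (measurableT_comp measurable_snd measurable_fst).
- exact: measurable_snd.
Qed.

Lemma measurable_qnorm : measurable_fun setT (fun x : quat R => `|x| : R).
Proof.
have [m0 m1 m2 m3] := measurable_qcoord.
rewrite (_ : (fun x => _) = fun x => Num.sqrt (qre x ^+ 2 + qim1 x ^+ 2 + qim2 x ^+ 2 + qim3 x ^+ 2))//.
apply: measurableT_comp; last first.
  by do 3![apply: measurable_funD; last exact: measurable_funX]; exact: measurable_funX.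
by apply: continuous_measurable_fun; exact: sqrt_continuous.
Qed.

Lemma measurable_qsphere (rho : R) : measurable (qsphere rho : set (quat R)).
Proof.
have := measurable_qnorm measurableT (measurable_set1 rho).
by rewrite setTI.
Qed.

Lemma measurable_qdot n : measurable_fun setT (fun y : quat R => qdot y n).
Proof.
have [m0 m1 m2 m3] := measurable_qcoord.
by do 3![apply: measurable_funD; last exact: measurable_funM]; exact: measurable_funM.
Qed.

Lemma qnorm_hyperspherical (rho : R) t : 0 <= rho -> `|hyperspherical rho t| = rho.
Proof.
move=> rho0; apply/eqP; rewrite -(@eqrXn2 _ 2)//; apply/eqP.
rewrite quat_normE; case: t => [[s h] f] /=.
transitivity (rho ^+ 2 * (cos s ^+ 2 + sin s ^+ 2 *
    (cos h ^+ 2 + sin h ^+ 2 * (cos f ^+ 2 + sin f ^+ 2)))); first by ring.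
by rewrite cos2Dsin2 mulr1 cos2Dsin2 mulr1 cos2Dsin2 mulr1.
Qed.

Lemma qdot_hyperspherical (rho : R) t n :
  qdot (hyperspherical rho t) n = rho * sphere_cos n t.
Proof. by rewrite /qdot /sphere_cos; case: t => [[s h] f] /=; ring. Qed.

End QuatBasics.

Section SphereMean.
Context {R : realType} (rho : R).
Hypothesis rho0 : 0 < rho.
Notation mu := (surface_measure rho).
Notation S := (qsphere rho : set (quat R)).

(** Every value of the parametrization lies on the sphere, so the restriction to it disappears on
    the side of the angles; positive and negative parts are treated separately. *)
Lemma integral_surface (h : quat R -> \bar R) : measurable_fun S h ->
  (\int[mu]_(y in S) h y = \int[leb3]_(t in angles)
     (h (hyperspherical rho t) * (hyperspherical_jacobian rho t)%:E))%E.
Proof.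
move=> mh; have mS := @measurable_qsphere R rho.
have SH t : S (hyperspherical rho t) by exact: qnorm_hyperspherical (ltW rho0).
have mhS : measurable_fun setT (h \_ S) by apply/(measurable_restrictT h mS).
rewrite integral_mkcond integralE [RHS]integralE.
rewrite !ge0_integral_surface; last 4 first.
- exact: measurable_funeneg.
- by move=> y; exact: funeneg_ge0.
- exact: measurable_funepos.
- by move=> y; exact: funepos_ge0.
congr (_ - _)%E; apply: eq_integral => t /[!inE] At;
  rewrite ?funeposE ?funenegE patchE mem_set//.
  by rewrite maxe_pMl ?mul0e// lee_fin jacobian_ge0.
by rewrite maxe_pMl ?mul0e ?mulNe// lee_fin jacobian_ge0.
Qed.

Lemma surface_measure_qsphere :
  mu S = (\int[leb3]_(t in angles) (hyperspherical_jacobian rho t)%:E)%E.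
Proof.
rewrite -(mul1e (mu S)) -(integral_cst mu (measurable_qsphere rho)).
rewrite integral_surface//; apply: eq_integral => t _; rewrite mul1e//.
Qed.

Lemma surface_measure_lty : (mu S < +oo)%E.
Proof.
rewrite surface_measure_qsphere.
have /integrable_lty -> // := bounded_measurable_integrable (@measurable_angles R)
  (@leb3_angles_lty R) (bounded_measurable_jacobian rho).
exact: measurable_angles.
Qed.

(** A zero mass would make the density vanish almost everywhere, yet it is positive on the open box
    of angles, whose measure is positive. *)
Lemma surface_measure_gt0 : (0 < mu S)%E.
Proof.
rewrite lt0e measure_ge0 andbT; apply/eqP; rewrite surface_measure_qsphere => J0.
have mA := @measurable_angles R.
have mJ : measurable_fun angles (EFin \o hyperspherical_jacobian rho).
  by apply/measurable_EFinP/measurable_funTS; have [] := bounded_measurable_jacobian rho.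
have : (\int[leb3]_(t in angles) `|(hyperspherical_jacobian rho t)%:E| = 0)%E.
  rewrite -[RHS]J0; apply: eq_integral => t /[!inE] At.
  by rewrite gee0_abs// lee_fin jacobian_ge0.
move/(ae_eq_integral_abs leb3 mA mJ) => -[N [mN N0 JN]].
pose B : set (measurableTypeR R * measurableTypeR R * measurableTypeR R) :=
  `]0, pi[%classic `*` `]0, pi[%classic `*` `]0, (pi *+ 2)[%classic.
have pi0 := pi_gt0 R.
have BN : B `<=` N.
  apply: subset_trans JN => -[[s h] f] [[/= sp hp] fp] H.
  have : angles (s, h, f).
    move: sp hp fp; rewrite /angles /= !in_itv/= => /andP[? ?] /andP[? ?] /andP[? ?].
    by split; first split; apply/andP; split; exact: ltW.
  move: sp hp; rewrite !in_itv/= => sp hp /H[]; apply/eqP.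
  rewrite /hyperspherical_jacobian /= gt_eqF// (gtr0_norm rho0).
  by rewrite !mulr_gt0// ?exprn_gt0// sin_gt0_pi// in_itv.
have mB : measurable B by apply: measurableX => //; exact: measurableX.
have : (leb3 B <= leb3 N)%E by apply: le_measure => //; rewrite inE.
rewrite N0 leNgt => /negP; apply.
pose I1 : set (measurableTypeR R) := `]0, pi[%classic.
pose I2 : set (measurableTypeR R) := `]0, (pi *+ 2)[%classic.
have mI1 : measurable I1 by exact: measurable_itv.
have mI2 : measurable I2 by exact: measurable_itv.
have -> : leb3 B = (leb1 I1 * leb1 I1 * leb1 I2)%E.
  rewrite -(@product_measure1E _ _ _ _ _ leb1 leb1)//.
  rewrite -(@product_measure1E _ _ _ _ _ (sigma_finite_prod leb1 leb1) leb1)//.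
  exact: measurableX.
rewrite /leb1 /I1 /I2 /= !lebesgue_measure_itv/= !lte_fin pi0 pmulrn_lgt0// pi0.
by rewrite -!EFinB -!EFinM lte_fin !subr0 !mulr_gt0// pmulrn_lgt0.
Qed.

Definition sphere_mass : R := fine (mu S).

Lemma sphere_massE : mu S = sphere_mass%:E.
Proof. by rewrite /sphere_mass fineK// ge0_fin_numE ?measure_ge0// surface_measure_lty. Qed.

Lemma sphere_mass_gt0 : 0 < sphere_mass.
Proof. by rewrite -lte_fin -sphere_massE surface_measure_gt0. Qed.

Lemma sphere_bounded_integrable (h : quat R -> R) (M : R) : measurable_fun S h ->
  (forall y, S y -> `|h y| <= M) -> mu.-integrable S (EFin \o h).
Proof.
move=> mh hM; apply: measurable_bounded_integrable => //.
- exact: measurable_qsphere.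
- exact: surface_measure_lty.
- exists M; split; first exact: num_real.
  by move=> N MN t St /=; rewrite (le_trans (hM _ St))// ltW.
Qed.

(** Integrability travels with the value, so that sums and multiples combine without side
    conditions. *)
Definition has_mean (h : quat R -> R) (A : R) :=
  mu.-integrable S (EFin \o h) /\ \int[mu]_(y in S) h y = sphere_mass * A.

Lemma has_mean_cst (a : R) : has_mean (fun=> a) a.
Proof.
split; first by apply: (@sphere_bounded_integrable _ `|a|).
rewrite Rintegral_cst; last exact: measurable_qsphere.
by rewrite mulrC.
Qed.

Lemma has_meanD h g A B : has_mean h A -> has_mean g B ->
  has_mean (fun y => h y + g y) (A + B).
Proof.
move=> [ih hA] [ig gB]; split.
  by apply: eq_integrable (integrableD _ ih ig) => //; exact: measurable_qsphere.
by rewrite RintegralD// ?hA ?gB ?mulrDr//; exact: measurable_qsphere.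
Qed.

Lemma has_meanZ (a : R) h A : has_mean h A -> has_mean (fun y => a * h y) (a * A).
Proof.
move=> [ih hA]; split.
  by apply: eq_integrable (integrableZl _ a ih) => //; exact: measurable_qsphere.
by rewrite RintegralZl// ?hA 1?mulrCA//; exact: measurable_qsphere.
Qed.

Lemma has_mean_sum (I : Type) (s : seq I) (P : pred I) (h : I -> quat R -> R) (A : I -> R) :
  (forall i, P i -> has_mean (h i) (A i)) ->
  has_mean (fun y => \sum_(i <- s | P i) h i y) (\sum_(i <- s | P i) A i).
Proof.
move=> hA; elim: s => [|i s IH].
  under [X in has_mean X]eq_fun do rewrite big_nil.
  by rewrite big_nil; exact: has_mean_cst.
under [X in has_mean X]eq_fun do rewrite big_cons.
rewrite big_cons; case: ifPn => // Pi.
by apply: has_meanD => //; exact: hA.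
Qed.

Lemma eq_has_mean h g A : {in S, h =1 g} -> has_mean h A -> has_mean g A.
Proof.
move=> hg [ih hA]; split; last by rewrite -hA; apply/esym/eq_Rintegral.
apply: eq_integrable ih => //; first exact: measurable_qsphere.
by move=> y Sy /=; rewrite hg.
Qed.

Section ChebMean.
Context (n : quat R).
Hypothesis n1 : `|n| = 1.

Let cosn y := qdot y n / rho.

Let mcosn : measurable_fun setT cosn.
Proof. by apply: measurable_funM => //; exact: measurable_qdot. Qed.

Lemma qdot_rho_le y : S y -> `|cosn y| <= 1.
Proof.
move=> Sy; rewrite normrM normfV (gtr0_norm rho0) ler_pdivrMr// mul1r.
by rewrite (le_trans (qdot_le _ _))// n1 mulr1 Sy.
Qed.

Let mpoly (p : {poly R}) : measurable_fun S (fun y => p.[cosn y]).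
Proof.
apply: measurable_funTS; apply: (@measurableT_comp _ _ _ _ _ _ (horner p)) => //.
by apply: continuous_measurable_fun; exact: continuous_horner.
Qed.

Let ipoly (p : {poly R}) : mu.-integrable S (EFin \o (fun y => p.[cosn y])).
Proof.
have [M pM] : exists M, forall c : R, `|c| <= 1 -> `|p.[c]| <= M.
  elim/poly_ind: p => [|p a [M pM]].
    by exists 0 => c _; rewrite horner0 normr0.
  exists (M + `|a|) => c c1; rewrite hornerMXaddC (le_trans (ler_normD _ _))// lerD2r.
  by rewrite normrM -[M]mulr1 ler_pM// pM.
by apply: (@sphere_bounded_integrable _ M) => // y Sy; apply: pM; exact: qdot_rho_le.
Qed.

(** Integration of polynomials in [cosn] satisfies [Ldiv] by the divergence identity, the density on
    the sphere being rho^3 times that on the unit sphere. *)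
Lemma has_mean_chebT k : k != 0%N ->
  has_mean (fun y => (chebT k).[cosn y]) (- 2^-1 *+ (k == 2%N)).
Proof.
move=> k0; split; first exact: ipoly.
have mS := @measurable_qsphere R rho.
pose L (p : {poly R}) := \int[mu]_(y in S) p.[cosn y].
rewrite -/(L (chebT k)) (@functional_chebT _ L)//.
- have -> : L 1 = sphere_mass.
    rewrite /L; under eq_Rintegral do rewrite hornerC.
    by rewrite Rintegral_cst// mul1r.
  by case: (k == _); rewrite ?mulr1n ?mulr0n; lra.
- move=> p q; rewrite /L -RintegralD//.
  by apply: eq_Rintegral => y _; rewrite hornerD.
- move=> a p; rewrite /L -RintegralZl//.
  by apply: eq_Rintegral => y _; rewrite hornerZ.
- move=> p; rewrite /L /Rintegral integral_surface; last first.
    by apply/measurable_EFinP; exact: mpoly.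
  have n1E : qre n ^+ 2 + qim1 n ^+ 2 + qim2 n ^+ 2 + qim3 n ^+ 2 = 1.
    by rewrite -quat_normE n1 expr1n.
  have := integral_sphere_divergence p n1E; set q := (_ - _ : {poly R}) => I0.
  under eq_integral => t _.
    rewrite /cosn qdot_hyperspherical mulrAC divff ?gt_eqF// mul1r.
    rewrite /hyperspherical_jacobian -EFinM mulrCA EFinM.
    over.
  rewrite integralZl; [by rewrite I0 mule0|exact: measurable_angles|].
  apply: bounded_measurable_integrable; [exact: measurable_angles|exact: leb3_angles_lty|].
  apply: bounded_measurableM.
    by apply: bounded_measurable_horner; exact: bounded_measurable_sphere_cos.
  rewrite (_ : (fun _ => _) = fun t => sin t.1.1 * sin t.1.1 * sin t.1.2)//.
  by repeat (apply: bounded_measurableM); apply: bounded_measurable_sin;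
    [exact: measurable_coord1|exact: measurable_coord1|exact: measurable_coord2].
Qed.

(** Uniform geometric convergence passes to the integral; only the degrees 0 and 2 contribute, with
    means 1 and -1/2. *)
Lemma has_mean_cheb_series (h : quat R -> R) (a : nat -> R) (C t : R) :
  measurable_fun S h -> 0 <= t < 1 ->
  (forall N y, S y ->
    `|h y - a 0 - \sum_(k < N) a k.+1 * (chebT k.+1).[cosn y]| <= C * t ^+ N) ->
  has_mean h (a 0%N - a 2%N / 2).
Proof.
move=> mh /andP[t0 t1] hC; have mS := @measurable_qsphere R rho.
have ih : mu.-integrable S (EFin \o h).
  apply: (@sphere_bounded_integrable _ (C + `|a 0%N|)) => // y Sy.
  have := hC 0%N y Sy; rewrite big_ord0 subr0 expr0 mulr1 => H.
  by rewrite -[h y](subrK (a 0%N)) (le_trans (ler_normD _ _))// lerD2r.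
split => //; set I := Rintegral _ _ _.
have ge0C : 0 <= C.
  have := hC 0%N (hyperspherical rho (0, 0, 0)) (qnorm_hyperspherical _ (ltW rho0)).
  by rewrite expr0 mulr1; exact: le_trans.
(* Taking N + 2 terms keeps the coefficient of degree 2 in every partial sum. *)
have bound N : `|I - sphere_mass * (a 0%N - a 2%N / 2)| <= C * t ^+ N.+2 * sphere_mass.
  pose g y := a 0%N + \sum_(k < N.+2) a k.+1 * (chebT k.+1).[cosn y].
  have gA : has_mean g (a 0%N - a 2%N / 2).
    have -> : a 0%N - a 2%N / 2 = a 0%N + \sum_(k < N.+2) a k.+1 * (- 2^-1 *+ (k.+1 == 2%N)).
      rewrite (bigD1 (lift ord0 ord0))//= mulr1n big1 ?addr0 ?mulrN// => i.
      rewrite -val_eqE/= /bump leq0n add1n => i1.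
      by rewrite (_ : (_ == 2%N) = false) ?mulr0n ?mulr0//; apply/negbTE; rewrite eqSS.
    apply: has_meanD; first exact: has_mean_cst.
    by apply: has_mean_sum => k _; apply: has_meanZ; exact: has_mean_chebT.
  rewrite -gA.2 /I -RintegralB//; last exact: gA.1.
  have ib : mu.-integrable S (EFin \o (fun y => h y - g y)).
    by apply: eq_integrable (integrableB mS ih gA.1).
  rewrite (le_trans (le_normr_Rintegral mS ib))//.
  rewrite -[sphere_mass]/(fine (mu S)) -Rintegral_cst//.
  apply: le_Rintegral => //.
  - exact: integrable_norm.
  - apply: (@sphere_bounded_integrable _ `|C * t ^+ N.+2|) => //.
  - by move=> y Sy; rewrite /g opprD addrA; exact: hC.
apply/eqP; rewrite -subr_eq0 -normr_le0; apply/ler_addgt0Pr => e e0.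
rewrite add0r.
have : (fun N => C * t ^+ N * sphere_mass) @ \oo --> (C * 0 * sphere_mass : R).
  apply: cvgM; last exact: cvg_cst.
  apply: cvgM; first exact: cvg_cst.
  by apply: cvg_expr; rewrite ger0_norm.
rewrite mulr0 mul0r => /cvgr_lt /(_ e e0)[N _ /(_ N.+2)] H.
by apply/ltW/(le_lt_trans (bound N))/H => /=; exact/leqW/leqW.
Qed.

End ChebMean.

(** Monotone convergence for g k - g 0 gives a limit of finite integral. That limit is infinite on
    [Z], so [Z] is null in the sphere, and off [Z] it equals h - g 0; the mean and the nullity come
    from the same argument. *)
Lemma has_mean_monotone (g : nat -> quat R -> R) (h : quat R -> R) (A : nat -> R) (a : R)
    (Z : set (quat R)) :
  measurable_fun S h -> measurable Z ->
  (forall k, has_mean (g k) (A k)) -> A @ \oo --> a ->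
  (forall y, S y -> {homo (g ^~ y) : k l / (k <= l)%N >-> k <= l}) ->
  (forall y, S y -> ~ Z y -> g ^~ y @ \oo --> h y) ->
  (forall y, S y -> Z y -> g ^~ y @ \oo --> +oo) ->
  has_mean h a /\ mu (S `&` Z) = 0%E.
Proof.
move=> mh mZ gA Aa gnd gh gZ; have mS := @measurable_qsphere R rho.
pose f k y := (g k y - g 0%N y)%:E.
have mg k : measurable_fun S (g k) by have [/(measurable_int mu) /measurable_EFinP] := gA k.
have mf k : measurable_fun S (f k) by apply/measurable_EFinP; exact: measurable_funB.
have f0 k y : S y -> (0 <= f k y)%E by move=> Sy; rewrite lee_fin subr_ge0 gnd.
have fnd y : S y -> {homo f^~ y : k l / (k <= l)%N >-> (k <= l)%E}.
  by move=> Sy k l kl; rewrite lee_fin lerB// gnd.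
have If k : (\int[mu]_(y in S) f k y)%E = (sphere_mass * (A k - A 0%N))%:E.
  have [[ik kA] [i0 A0]] := (gA k, gA 0%N).
  have ib : mu.-integrable S (EFin \o (fun y => g k y - g 0%N y)).
    by apply: eq_integrable (integrableB mS ik i0).
  rewrite -[LHS]fineK; last exact: integrable_fin_num.
  have := RintegralB mS ik i0; rewrite /Rintegral => ->.
  by rewrite -!/(Rintegral _ _ _) kA A0 mulrBr.
pose F y := limn (f ^~ y).
have cf y : S y -> cvgn (f ^~ y).
  by move=> Sy; apply: ereal_nondecreasing_is_cvgn => k l; exact: fnd.
have IF : (\int[mu]_(y in S) F y)%E = (sphere_mass * (a - A 0%N))%:E.
  rewrite (monotone_convergence mu mS mf f0 fnd); apply: cvg_lim => //.
  under eq_fun do rewrite If.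
  apply: cvg_EFin; first by near=> k.
  apply: cvgM; first exact: cvg_cst.
  by apply: cvgB => //; exact: cvg_cst.
have mF : measurable_fun S F.
  by apply: (emeasurable_fun_cvg f) => // y Sy; exact: cf.
have F0 y : S y -> (0 <= F y)%E.
  by move=> Sy; apply: lime_ge; [exact: cf|near=> k; exact: f0].
have iF : mu.-integrable S F.
  apply/integrableP; split => //.
  under eq_integral => y /[!inE] Sy do rewrite gee0_abs ?F0//.
  by rewrite IF ltry.
have FZ y : S y -> Z y -> F y = +oo%E.
  move=> Sy Zy; apply: cvg_lim => //; apply/cvgeyPge => M.
  have /cvgryPge/(_ (M + g 0%N y)) := gZ _ Sy Zy.
  by apply: filterS => k; rewrite lee_fin lerBrDr.
have Fh y : S y -> ~ Z y -> F y = (h y - g 0%N y)%:E.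
  move=> Sy Zy; apply: cvg_lim => //; apply: cvg_EFin; first by near=> k.
  by apply: cvgB; [exact: gh|exact: cvg_cst].
have Z0 : mu (S `&` Z) = 0%E.
  have [N [mN N0 FN]] := integrable_ae mS iF.
  apply/eqP; rewrite -measure_le0 -N0; apply: le_measure; rewrite ?inE//.
    exact: measurableI.
  by move=> y [Sy Zy]; apply: FN => /= /(_ Sy); rewrite FZ.
have Fae : ae_eq mu S F (fun y => (h y - g 0%N y)%:E).
  exists (S `&` Z); split; [exact: measurableI|exact: Z0|].
  move=> y /= /not_implyP[Sy] H; split => //; apply: contrapT => Zy; apply: H.
  exact: Fh.
have mhg : measurable_fun S (fun y => (h y - g 0%N y)%:E).
  by apply/measurable_EFinP; exact: measurable_funB.
have hgm : has_mean (fun y => h y - g 0%N y) (a - A 0%N).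
  have Ihg : (\int[mu]_(y in S) (h y - g 0%N y)%:E)%E = (sphere_mass * (a - A 0%N))%:E.
    by rewrite -IF; apply: ae_eq_integral => //; exact: ae_eq_sym.
  split; last by rewrite /Rintegral Ihg.
  apply/integrableP; split => //.
  have -> : (\int[mu]_(y in S) `|(h y - g 0%N y)%:E| = \int[mu]_(y in S) `|F y|)%E.
    apply: ae_eq_integral => //; [exact: measurableT_comp|exact: measurableT_comp|].
    by move: Fae; apply: filterS => y /= H Sy; rewrite H.
  by have /integrableP[] := iF.
split => //.
have := has_meanD hgm (gA 0%N); rewrite subrK; apply: eq_has_mean => y _.
by rewrite subrK.
Unshelve. all: by end_near.
Qed.

End SphereMean.

Section SphericalFactor.
Context {R : realType}.
Implicit Types x y q : quat R.

(** By x^2 = 2 Re(x) x - |x|^2 the factor is a real combination of x and 1, which makes its modulus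
    computable. *)
Lemma sph_factorE q x :
  sph_factor q x = (2 * (qre x - qre q)) *: x + (`|q| ^+ 2 - `|x| ^+ 2)%:A.
Proof.
rewrite /sph_factor qmul_conj !quat_normE expr2.
case: x q => [a b c d] [a' b' c' d'] /=.
by congr Quat; rewrite /=; ring.
Qed.

Lemma sph_factor_norm q x : `|sph_factor q x| ^+ 2 =
  (`|x| ^+ 2 + `|q| ^+ 2 - 2 * qre x * qre q) ^+ 2
  - 4 * (`|x| ^+ 2 - qre x ^+ 2) * (`|q| ^+ 2 - qre q ^+ 2).
Proof.
rewrite sph_factorE; move: (`|q| ^+ 2) => Q.
have := quat_normE x; move: (`|x| ^+ 2) => X.
rewrite quat_normE; case: x q => [a b c d] [a' b' c' d'] /= XE.
transitivity (4 * (a - a') ^+ 2 * (a ^+ 2 + b ^+ 2 + c ^+ 2 + d ^+ 2) +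
  4 * (a - a') * a * (Q - X) + (Q - X) ^+ 2); first by ring.
by rewrite -XE; ring.
Qed.

(** Let a and b be the angles of y and q with the real axis. In a slice the spherical factor is a
    product over the two conjugate roots, at angles a - b and a + b from y, hence two quadratics in
    t with cosines c1 and c2. The product formula for cosines merges their Chebyshev expansions into
    one in Re y. *)
Lemma sph_split rho q y : 0 < rho -> q != 0 -> `|y| = rho -> exists c1 c2 : R,
  [/\ `|c1| <= 1, `|c2| <= 1,
   forall t : R, `|sph_factor (t *: q) y| ^+ 2 = rho ^+ 4 *
     ((1 - 2 * c1 * (t * `|q| / rho) + (t * `|q| / rho) ^+ 2) *
      (1 - 2 * c2 * (t * `|q| / rho) + (t * `|q| / rho) ^+ 2)) &
   forall k, (chebT k).[c1] + (chebT k).[c2] =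
     2 * (chebT k).[qre y / rho] * (chebT k).[qre q / `|q|] ].
Proof.
move=> rho0 q0 yrho.
have re_le (x : quat R) : `|qre x| <= `|x|.
  rewrite -(@ler_pXn2r _ 2) ?nnegrE// -normrX ger0_norm ?sqr_ge0// quat_normE.
  by rewrite -!addrA lerDl !addr_ge0// sqr_ge0.
have q0' : 0 < `|q| by rewrite normr_gt0.
pose a := acos (qre y / rho); pose b := acos (qre q / `|q|).
have Ea : cos a = qre y / rho.
  apply: acosK; rewrite in_itv/= -ler_norml normrM normfV (gtr0_norm rho0).
  by rewrite ler_pdivrMr// mul1r -yrho.
have Eb : cos b = qre q / `|q|.
  apply: acosK; rewrite in_itv/= -ler_norml normrM normfV normr_id.
  by rewrite ler_pdivrMr// mul1r.
exists (cos (a - b)), (cos (a + b)); split.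
- by rewrite ler_norml cos_geN1 cos_le1.
- by rewrite ler_norml cos_geN1 cos_le1.
- move=> t; rewrite sph_factor_norm yrho normrZ exprMn -normrX (ger0_norm (sqr_ge0 t)).
  rewrite cosB cosD /=.
  have -> : qre y = rho * cos a by rewrite Ea mulrC divfK// gt_eqF.
  have -> : qre q = `|q| * cos b by rewrite Eb mulrC divfK// gt_eqF.
  have Sa : sin a ^+ 2 = 1 - cos a ^+ 2 by rewrite sin2cos2.
  have Sb : sin b ^+ 2 = 1 - cos b ^+ 2 by rewrite sin2cos2.
  pose T := t * `|q| / rho.
  have Tr : t * `|q| = T * rho by rewrite /T divfK// gt_eqF.
  transitivity ((rho ^+ 2 + (t * `|q|) ^+ 2 - 2 * rho * cos a * (t * `|q|) * cos b) ^+ 2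
    - 4 * rho ^+ 2 * (1 - cos a ^+ 2) * (t * `|q|) ^+ 2 * (1 - cos b ^+ 2)); first by ring.
  by rewrite -/T Tr -Sa -Sb; ring.
- by move=> k; rewrite chebTM Ea Eb.
Qed.

End SphericalFactor.

Lemma measurable_qdist_sqr (R : realType) (q : quat R) :
  measurable_fun setT (fun y : quat R => `|y - q| ^+ 2 : R).
Proof.
under eq_fun do rewrite qnormB_sqr.
apply: measurable_funD => //; apply: measurable_funB.
  by apply: measurable_funX; exact: measurable_qnorm.
by apply: measurable_funM => //; exact: measurable_qdot.
Qed.

Lemma measurable_sph_sqr (R : realType) (q : quat R) :
  measurable_fun setT (fun y : quat R => `|sph_factor q y| ^+ 2 : R).
Proof.
have [mre _ _ _] := @measurable_qcoord R.
have mn : measurable_fun setT (fun y : quat R => `|y| ^+ 2 : R).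
  by apply: measurable_funX; exact: measurable_qnorm.
under eq_fun do rewrite sph_factor_norm.
apply: measurable_funB.
  apply: measurable_funX; apply: measurable_funB; first exact: measurable_funD.
  by apply: measurable_funM => //; exact: measurable_funM.
apply: measurable_funM => //; apply: measurable_funM => //.
by apply: measurable_funB => //; exact: measurable_funX.
Qed.

(** * Means of the logarithms of linear and spherical factors *)

Section LogMeans.
Context {R : realType} (rho : R).
Hypothesis rho0 : 0 < rho.
Notation mu := (surface_measure rho).
Notation S := (qsphere rho : set (quat R)).

(** A zero on the sphere is approached from inside, [w t] belonging to the zero scaled by t. ln (w
    t) need not be monotone in t, but it becomes so after division of [w t] by t^k, and k ln t tends
    to 0. The exponent is 1 for a point and 2 for a sphere of zeros. *)
Lemma has_mean_boundary (w : R -> quat R -> R) (k : nat) (A : R -> R) :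
  (forall t y, 0 < t < 1 -> S y -> 0 < w t y) ->
  (forall s t y, 0 < s -> s <= t -> t < 1 -> S y -> w t y / t ^+ k <= w s y / s ^+ k) ->
  (forall y, S y -> w t y @[t --> (1 : R)] --> w 1 y) ->
  (forall t, 0 < t < 1 -> has_mean rho (fun y => ln (w t y)) (A t)) ->
  A t @[t --> (1 : R)] --> A 1 ->
  measurable_fun setT (w 1) ->
  has_mean rho (fun y => ln (w 1 y)) (A 1) /\ mu (S `&` [set y | w 1 y = 0]) = 0%E.
Proof.
move=> w0 wle wc wA cA mw.
(* The shift by 2 starts the sequence at 1/2, so that it stays strictly between 0 and 1. *)
pose t (n : nat) : R := 1 - n.+2%:R^-1.
have t01 n : 0 < t n < 1.
  by rewrite /t subr_gt0 invf_lt1 ?ltr1n// gtrBl invr_gt0 ltr0n.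
have tnd n m : (n <= m)%N -> t n <= t m.
  by move=> nm; rewrite lerB// lef_pV2 ?posrE ?ltr0n// ler_nat !ltnS.
have ct : t @ \oo --> (1 : R).
  rewrite -[X in _ --> X]subr0; apply: cvgB; first exact: cvg_cst.
  have := @cvg_harmonic R; rewrite -(cvg_shiftS).
  by apply: cvg_trans; apply: near_eq_cvg; near=> n.
have ctw y : S y -> w (t n) y @[n --> \oo] --> w 1 y.
  by move=> Sy; exact: (cvg_comp _ (w ^~ y) ct (wc y Sy)).
have w10 y : S y -> 0 <= w 1 y.
  move=> Sy; rewrite -(cvg_lim _ (ctw y Sy))//; apply: limr_ge.
    by apply/cvg_ex; exists (w 1 y); exact: ctw.
  by near=> n; apply/ltW/w0.
have cln (x : R) : 0 < x -> ln y @[y --> x] --> ln x by exact: continuous_ln.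
pose g n y := k%:R * ln (t n) - ln (w (t n) y).
have gE n y : S y -> g n y = - ln (w (t n) y / t n ^+ k).
  move=> Sy; have /andP[tn0 tn1] := t01 n.
  by rewrite lnM ?posrE ?invr_gt0 ?exprn_gt0 ?w0 ?tn0// lnV ?posrE ?exprn_gt0// lnXn//
    opprB /g mulr_natl.
pose Z := [set y : quat R | w 1 y = 0].
have [] := @has_mean_monotone _ rho g (fun y => - ln (w 1 y))
   (fun n => k%:R * ln (t n) - A (t n)) (- A 1) Z.
- apply: measurable_funTS; apply: measurable_funN.
  by apply: measurableT_comp mw; exact: measurable_ln.
- by rewrite /Z -[X in measurable X]setTI; exact: mw (measurable_set1 0).
- move=> n; apply: has_meanD => //; first exact: has_mean_cst.
  rewrite -mulN1r; apply: eq_has_mean (has_meanZ (-1) (wA _ (t01 n))).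
  by move=> y _; rewrite mulN1r.
- rewrite -[- A 1]add0r -[X in X + _](mulr0 k%:R) -ln1; apply: cvgB.
    apply: cvgM; first exact: cvg_cst.
    by apply: (cvg_comp _ (@ln R) ct); exact: cln.
  exact: (cvg_comp _ A ct).
- move=> y Sy n m nm; rewrite !gE// lerN2 ler_ln ?posrE.
  + by apply: wle; rewrite ?tnd//; have /andP[] := t01 n; have /andP[] := t01 m.
  + by rewrite divr_gt0 ?exprn_gt0 ?w0//; have /andP[] := t01 m.
  + by rewrite divr_gt0 ?exprn_gt0 ?w0//; have /andP[] := t01 n.
- move=> y Sy Zy; rewrite -[X in _ --> X]add0r -[X in X + _](mulr0 k%:R) -ln1; apply: cvgB.
    apply: cvgM; first exact: cvg_cst.
    by apply: (cvg_comp _ (@ln R) ct); exact: cln.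
  apply: (cvg_comp _ (@ln R) (ctw y Sy)); apply: cln.
  by rewrite lt_neqAle eq_sym w10// andbT; apply/eqP.
- move=> y Sy Zy; apply/cvgryPge => M.
  have /andP[t00 t0'] := t01 0%N.
  (* Once ln (w t) lies below k ln (t 0) - M, the value g exceeds M, because k ln t is at least k ln
     (t 0). *)
  have := ctw y Sy; rewrite Zy => /cvgr_lt /(_ (expR (k%:R * ln (t 0%N) - M)))[].
    exact: expR_gt0.
  move=> N _ NH; exists N => // n Nn /=.
  rewrite /g lerBrDr -lerBrDl; apply: le_trans (_ : k%:R * ln (t 0%N) - M <= _); last first.
    rewrite lerB// ler_wpM2l// ler_ln ?posrE//; first exact: tnd.
    by have /andP[] := t01 n.
  rewrite -[leRHS]expRK ler_ln ?posrE ?expR_gt0//; last exact: w0.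
  by apply/ltW/NH.
move=> h Z0; split => //.
rewrite -[A 1]opprK -mulN1r; apply: eq_has_mean (has_meanZ (-1) h).
by move=> y _; rewrite mulN1r opprK.
Unshelve. all: by end_near.
Qed.

(** On the sphere |y - q|^2 = rho^2 (1 - 2 c t + t^2), with t = |q| / rho < 1 and c the cosine of
    the angle between y and q. The logarithmic series then has degree 2 coefficient - t^2. *)
Lemma has_mean_log_dist_interior q : 0 < `|q| < rho ->
  has_mean rho (fun y => ln (`|y - q| ^+ 2)) (2 * ln rho + `|q| ^+ 2 / (2 * rho ^+ 2)).
Proof.
move=> /andP[q0 qr]; pose n := `|q|^-1 *: q; pose t := `|q| / rho.
have qn0 : `|q| != 0 by rewrite gt_eqF.
have n1 : `|n| = 1 by rewrite normrZ ger0_norm ?invr_ge0// mulVf.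
have t01 : 0 <= t < 1 by rewrite divr_ge0 ?(ltW rho0)//= ltr_pdivrMr// mul1r.
pose a k := if k is k'.+1 then - 2 * t ^+ k / k%:R else 2 * ln rho.
have r0 : rho != 0 by rewrite gt_eqF.
have -> : 2 * ln rho + `|q| ^+ 2 / (2 * rho ^+ 2) = a 0%N - a 2%N / 2.
  by rewrite /a /t; field.
apply: (@has_mean_cheb_series _ _ rho0 n n1 _ a (4 / (1 - t) ^+ 2) t) => //.
  apply: measurable_funTS; apply: measurableT_comp; first exact: measurable_ln.
  exact: measurable_qdist_sqr.
move=> N y Sy; have c1 := qdot_rho_le rho0 n1 Sy; set c := qdot y n / rho in c1 *.
have -> : `|y - q| ^+ 2 = rho ^+ 2 * (1 - 2 * c * t + t ^+ 2).
  have -> : q = `|q| *: n by rewrite scalerA mulfV// scale1r.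
  rewrite qnormB_sqr qdotZ normrZ n1 Sy normr_id.
  rewrite /c /t; move: (qdot y n) => d; field.
  exact: r0.
have P0 : 0 < 1 - 2 * c * t + t ^+ 2.
  have : 0 < (1 - t) ^+ 2 by rewrite exprn_gt0// subr_gt0; case/andP: t01.
  by move: c1 t01; rewrite ler_norml => /andP[? ?] /andP[? ?]; nra.
rewrite lnM ?posrE ?exprn_gt0// lnXn// -[ln rho *+ 2]mulr_natl.
have -> L s : 2 * ln rho + L - a 0%N - s = L - s by rewrite /a; ring.
have := cheb_log N c1 t01; congr (_ <= _); last by ring.
congr `|_ + _|; rewrite mulr_sumr -sumrN; apply: eq_bigr => i _.
by rewrite /a; ring.
Qed.


(** For |q| = rho the value is the limit of the interior one along t q; the same limit shows that
    the point is null. *)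
Lemma has_mean_log_dist q : q != 0 -> `|q| <= rho ->
  has_mean rho (fun y => ln `|y - q|) (ln rho + `|q| ^+ 2 / (4 * rho ^+ 2)) /\
  mu (S `&` [set q]) = 0%E.
Proof.
move=> q0 qr.
have r0 : rho != 0 by rewrite gt_eqF.
suff [hm m0] : has_mean rho (fun y => ln (`|y - q| ^+ 2))
     (2 * ln rho + `|q| ^+ 2 / (2 * rho ^+ 2)) /\
   mu (S `&` [set y | `|y - q| ^+ 2 = 0]) = 0%E.
  split.
    have -> : ln rho + `|q| ^+ 2 / (4 * rho ^+ 2) =
        2^-1 * (2 * ln rho + `|q| ^+ 2 / (2 * rho ^+ 2)) by field.
    have := has_meanZ 2^-1 hm; apply: eq_has_mean => y _.
    (* The convention ln 0 = 0 makes the halving valid at the zero as well. *)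
    have [->|yq] := eqVneq y q; first by rewrite subrr normr0 expr0n ln0 ?mulr0.
    by rewrite lnXn ?normr_gt0 ?subr_eq0// -[ln _ *+ 2]mulr_natl mulrA mulVf// mul1r.
  rewrite -[RHS]m0; congr (mu (_ `&` _)); apply/seteqP; split => y /=.
    by move=> ->; rewrite subrr normr0 expr0n.
  by move=> /eqP; rewrite sqrf_eq0 normr_eq0 subr_eq0 => /eqP.
have q0' : 0 < `|q| by rewrite normr_gt0.
have [qlt|qge] := ltP `|q| rho.
  split; first by apply: has_mean_log_dist_interior; rewrite q0'.
  rewrite (_ : _ `&` _ = set0) ?measure0// -subset0 => y [Sy] /= /eqP.
  rewrite sqrf_eq0 normr_eq0 subr_eq0 => /eqP yq.
  by move: Sy; rewrite yq /qsphere/= => E; rewrite E ltxx in qlt.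
have {qge} qE : `|q| = rho by apply/eqP; rewrite eq_le qr.
pose w (t : R) (y : quat R) := `|y - t *: q| ^+ 2.
have wE t y : S y -> w t y = rho ^+ 2 * (1 + t ^+ 2) - 2 * t * qdot y q.
  move=> Sy; rewrite /w qnormB_sqr qdotZ normrZ qE Sy exprMn -normrX ger0_norm ?sqr_ge0//.
  by ring.
have cE (f : {poly R}) (x : R) : f.[t] @[t --> x] --> f.[x] by exact: continuous_horner.
have [//||||||h h0] := @has_mean_boundary w 1%N
    (fun t => 2 * ln rho + t ^+ 2 * `|q| ^+ 2 / (2 * rho ^+ 2)).
- move=> t y /andP[t0 t1] Sy; rewrite exprn_gt0// normr_gt0 subr_eq0; apply/eqP => yq.
  move: Sy; rewrite /qsphere/= yq normrZ qE gtr0_norm// => /eqP.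
  by rewrite -[X in _ == X]mul1r (inj_eq (mulIf r0)) lt_eqF.
- move=> s t y s0 st t1 Sy; rewrite !wE// !expr1.
  have t0 : 0 < t by exact: lt_le_trans st.
  rewrite ler_pdivrMr// [leRHS]mulrAC ler_pdivlMr// -subr_ge0.
  (* Hence w s / s - w t / t = rho^2 (t - s) (1 - s t) / (s t), which is nonnegative. *)
  have -> : (rho ^+ 2 * (1 + s ^+ 2) - 2 * s * qdot y q) * t -
    (rho ^+ 2 * (1 + t ^+ 2) - 2 * t * qdot y q) * s =
    rho ^+ 2 * ((t - s) * (1 - s * t)) by ring.
  rewrite mulr_ge0 ?sqr_ge0// mulr_ge0 ?subr_ge0//.
  by rewrite mulr_ile1 ?ltW//; apply: le_lt_trans st t1.
- move=> y Sy; rewrite wE//.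
  pose p : {poly R} := (rho ^+ 2) *: (1 + 'X ^+ 2) - (2 * qdot y q) *: 'X.
  under eq_fun do rewrite wE//.
  have E t : rho ^+ 2 * (1 + t ^+ 2) - 2 * t * qdot y q = p.[t].
    by rewrite /p !hornerE/=; ring.
  by under eq_fun do rewrite E; rewrite E; exact: cE.
- move=> t /andP[t0 t1].
  have tq : `|t *: q| = t * `|q| by rewrite normrZ gtr0_norm.
  have := @has_mean_log_dist_interior (t *: q); rewrite tq exprMn; apply.
  by rewrite mulr_gt0//= qE gtr_pMl.
- pose p : {poly R} := (2 * ln rho)%:P + (`|q| ^+ 2 / (2 * rho ^+ 2)) *: 'X ^+ 2.
  have E t : 2 * ln rho + t ^+ 2 * `|q| ^+ 2 / (2 * rho ^+ 2) = p.[t].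
    by rewrite /p !hornerE/=; field.
  by under eq_fun do rewrite E; rewrite E; exact: cE.
- by rewrite /w scale1r; exact: measurable_qdist_sqr.
- by move: h h0; rewrite /w scale1r expr1n mul1r.
Qed.

Let re1 (y : quat R) : qdot y 1 = qre y.
Proof. by rewrite /qdot /= mulr1 !mulr0 !addr0. Qed.

Let norm1q : `|1 : quat R| = 1.
Proof.
apply/eqP; rewrite -(@eqrXn2 _ 2)// quat_normE /= expr1n; apply/eqP; ring.
Qed.

(** The two quadratics of [sph_split] are expanded separately, each with coefficients -2 t^k T_k /
    k. Their sum involves 2 T_k(Re y / rho) T_k(Re q / |q|): hence the coefficient -4 and the choice
    of the real axis as direction. *)
Lemma has_mean_log_sph_interior q : 0 < `|q| < rho ->
  has_mean rho (fun y => ln (`|sph_factor q y| ^+ 2))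
    (4 * ln rho + (2 * qre q ^+ 2 - `|q| ^+ 2) / rho ^+ 2).
Proof.
move=> /andP[q0 qr]; pose t := `|q| / rho; pose c0 := qre q / `|q|.
have qn0 : `|q| != 0 by rewrite gt_eqF.
have q0' : q != 0 by rewrite -normr_gt0.
have t01 : 0 <= t < 1 by rewrite divr_ge0 ?(ltW rho0)//= ltr_pdivrMr// mul1r.
pose a k := if k is k'.+1 then - 4 * t ^+ k * (chebT k).[c0] / k%:R else 4 * ln rho.
have r0 : rho != 0 by rewrite gt_eqF.
have -> : 4 * ln rho + (2 * qre q ^+ 2 - `|q| ^+ 2) / rho ^+ 2 = a 0%N - a 2%N / 2.
  rewrite /a /t /c0 chebTS chebTS chebVS chebT0 chebV0 !hornerE/=; field.
  by rewrite qn0 r0.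
apply: (@has_mean_cheb_series _ _ rho0 1 norm1q _ a (8 / (1 - t) ^+ 2) t) => //.
  apply: measurable_funTS; apply: measurableT_comp; first exact: measurable_ln.
  exact: measurable_sph_sqr.
move=> N y Sy; have := sph_split rho0 q0' Sy => -[c1 [c2 [c1le c2le wE cc]]].
have := wE 1; rewrite scale1r mul1r -/t => ->.
have P0 c : `|c| <= 1 -> 0 < 1 - 2 * c * t + t ^+ 2.
  have : 0 < (1 - t) ^+ 2 by rewrite exprn_gt0// subr_gt0; case/andP: t01.
  by move: t01 => /andP[? ?] ?; rewrite ler_norml => /andP[? ?]; nra.
have P1 := P0 _ c1le; have P2 := P0 _ c2le.
rewrite lnM ?posrE ?exprn_gt0 ?mulr_gt0// lnXn// -[ln rho *+ 4]mulr_natl lnM//.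
have -> L1 L2 s : 4 * ln rho + (L1 + L2) - a 0%N - s = L1 + L2 - s by rewrite /a; ring.
have := lerD (cheb_log N c1le t01) (cheb_log N c2le t01).
move=> /(le_trans (ler_normD _ _)); congr (_ <= _); last by field; rewrite subr_eq0 gt_eqF//; case/andP: t01.
rewrite addrACA; congr `|_ + _|; rewrite -mulrDr -big_split/= mulr_sumr -sumrN.
apply: eq_bigr => i _; rewrite -mulrDl -mulrDr cc re1 /a.
by rewrite -/c0; ring.
Qed.

Lemma has_mean_log_sph q : q != 0 -> `|q| <= rho ->
  has_mean rho (fun y => ln `|sph_factor q y|)
    (2 * ln rho + (2 * qre q ^+ 2 - `|q| ^+ 2) / (2 * rho ^+ 2)) /\
  mu (S `&` [set y | sph_factor q y = 0]) = 0%E.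
Proof.
move=> q0 qr.
have r0 : rho != 0 by rewrite gt_eqF.
suff [hm m0] : has_mean rho (fun y => ln (`|sph_factor q y| ^+ 2))
    (4 * ln rho + (2 * qre q ^+ 2 - `|q| ^+ 2) / rho ^+ 2) /\
   mu (S `&` [set y | `|sph_factor q y| ^+ 2 = 0]) = 0%E.
  split.
    have -> : 2 * ln rho + (2 * qre q ^+ 2 - `|q| ^+ 2) / (2 * rho ^+ 2) =
      2^-1 * (4 * ln rho + (2 * qre q ^+ 2 - `|q| ^+ 2) / rho ^+ 2) by field.
    have := has_meanZ 2^-1 hm; apply: eq_has_mean => y _.
    have [->|yq] := eqVneq (sph_factor q y) 0; first by rewrite normr0 expr0n ln0 ?mulr0.
    by rewrite lnXn ?normr_gt0// -[ln _ *+ 2]mulr_natl mulrA mulVf// mul1r.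
  rewrite -[RHS]m0; congr (mu (_ `&` _)); apply/seteqP; split => y /=.
    by move=> ->; rewrite normr0 expr0n.
  by move=> /eqP; rewrite sqrf_eq0 normr_eq0 => /eqP.
have q0' : 0 < `|q| by rewrite normr_gt0.
have Pge (c t : R) : `|c| <= 1 -> 0 <= t -> t < 1 -> 0 < 1 - 2 * c * t + t ^+ 2.
  move=> + t0 t1; have : 0 < (1 - t) ^+ 2 by rewrite exprn_gt0// subr_gt0.
  by move=> ?; rewrite ler_norml => /andP[? ?]; nra.
have [qlt|qge] := ltP `|q| rho.
  split; first by apply: has_mean_log_sph_interior; rewrite q0'.
  rewrite (_ : _ `&` _ = set0) ?measure0// -subset0 => y [Sy] /=.
  have := sph_split rho0 q0 Sy => -[c1 [c2 [c1le c2le wE _]]].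
  have := wE 1; rewrite scale1r mul1r => ->.
  have t1 : `|q| / rho < 1 by rewrite ltr_pdivrMr// mul1r.
  by apply/eqP; rewrite gt_eqF// !mulr_gt0 ?exprn_gt0 ?Pge// divr_ge0// ltW.
have {qge} qE : `|q| = rho by apply/eqP; rewrite eq_le qr.
pose w (t : R) (y : quat R) := `|sph_factor (t *: q) y| ^+ 2.
have cE (f : {poly R}) (x : R) : f.[t] @[t --> x] --> f.[x] by exact: continuous_horner.
have wE y : S y -> exists c1 c2 : R, [/\ `|c1| <= 1, `|c2| <= 1 &
    forall t, w t y = rho ^+ 4 * ((1 - 2 * c1 * t + t ^+ 2) * (1 - 2 * c2 * t + t ^+ 2))].
  move=> Sy; have := sph_split rho0 q0 Sy => -[c1 [c2 [c1le c2le H _]]].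
  exists c1, c2; split => // t; rewrite /w H qE.
  by rewrite mulfK.
have [//||||||h h0] := @has_mean_boundary w 2%N
    (fun t => 4 * ln rho + t ^+ 2 * (2 * qre q ^+ 2 - `|q| ^+ 2) / rho ^+ 2).
- move=> t y /andP[t0 t1] /wE[c1 [c2 [c1le c2le ->]]].
  by rewrite !mulr_gt0 ?exprn_gt0 ?Pge// ltW.
- move=> s t y s0 st t1 /wE[c1 [c2 [c1le c2le E]]]; rewrite !E.
  have t0 : 0 < t by exact: lt_le_trans st.
  have s1 : s < 1 by exact: le_lt_trans t1.
  (* Each quadratic divided by its variable decreases; the product of the two is why the exponent is
     2. *)
  have dec c : `|c| <= 1 -> 0 <= (1 - 2 * c * t + t ^+ 2) / t <= (1 - 2 * c * s + s ^+ 2) / s.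
    move=> c1'; rewrite divr_ge0 ?(ltW t0)//=; last by rewrite ltW// Pge// ltW.
    rewrite ler_pdivrMr// [leRHS]mulrAC ler_pdivlMr// -subr_ge0.
    have -> : (1 - 2 * c * s + s ^+ 2) * t - (1 - 2 * c * t + t ^+ 2) * s =
      (t - s) * (1 - s * t) by ring.
    rewrite mulr_ge0 ?subr_ge0//.
    by rewrite mulr_ile1 ?ltW//.
  have /andP[a1 b1] := dec _ c1le; have /andP[a2 b2] := dec _ c2le.
  have := ler_pM a1 a2 b1 b2; rewrite -(ler_pM2l (exprn_gt0 4 rho0)).
  by congr (_ <= _); field; rewrite gt_eqF.
- move=> y /wE[c1 [c2 [c1le c2le E]]].
  pose p (c : R) : {poly R} := 1 - (2 * c) *: 'X + 'X ^+ 2.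
  have E' t : w t y = (rho ^+ 4 *: (p c1 * p c2)).[t].
    by rewrite E /p !hornerE/=; ring.
  by under eq_fun do rewrite E'; rewrite E'; exact: cE.
- move=> t /andP[t0 t1].
  have tq : `|t *: q| = t * `|q| by rewrite normrZ gtr0_norm.
  have := @has_mean_log_sph_interior (t *: q); rewrite tq !exprMn mulrCA -mulrBr; apply.
  by rewrite mulr_gt0//= qE gtr_pMl.
- pose p : {poly R} := (4 * ln rho)%:P + ((2 * qre q ^+ 2 - `|q| ^+ 2) / rho ^+ 2) *: 'X ^+ 2.
  have E t : 4 * ln rho + t ^+ 2 * (2 * qre q ^+ 2 - `|q| ^+ 2) / rho ^+ 2 = p.[t].
    by rewrite /p !hornerE/=; field.
  by under eq_fun do rewrite E; rewrite E; exact: cE.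
- by rewrite /w scale1r; exact: measurable_sph_sqr.
- by move: h h0; rewrite /w scale1r expr1n mul1r.
Qed.

End LogMeans.

(** * Integrals of functions changed on a null set *)

Section NullModification.
Context d (T : measurableType d) (R : realType) (mu : {measure set T -> \bar R}).

(** The integral of a nonnegative function is a supremum over the simple functions below it, hence
    monotone without any measurability. *)
Lemma ge0_le_integral_nomeas (D : set T) (f g : T -> \bar R) :
  (forall x, D x -> 0 <= f x)%E -> (forall x, D x -> f x <= g x)%E ->
  (\int[mu]_(x in D) f x <= \int[mu]_(x in D) g x)%E.
Proof.
move=> f0 fg.
have g0 x : D x -> (0 <= g x)%E by move=> Dx; exact: le_trans (f0 _ Dx) (fg _ Dx).
rewrite !ge0_integralE//; apply: le_ereal_sup => _ [h /= hf <-]; exists h => //= x.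
apply: le_trans (hf x) _; rewrite !patchE; case: ifPn => //.
by rewrite inE => /fg.
Qed.

(** f lies between [lo], which is 0 on N, and [hi], which is infinite there. Both are measurable and
    equal g off N, so both have the integral of g. *)
Lemma ge0_integral_null_modification (D N : set T) (f g : T -> \bar R) :
  measurable D -> measurable N -> mu N = 0%E -> measurable_fun D g ->
  (forall x, D x -> 0 <= f x)%E -> (forall x, D x -> 0 <= g x)%E ->
  (forall x, D x -> ~ N x -> f x = g x) ->
  (\int[mu]_(x in D) f x = \int[mu]_(x in D) g x)%E.
Proof.
move=> mD mN N0 mg f0 g0 fg.
pose lo := g \_ (~` N); pose hi x := (g x + ((cst +oo) \_ N) x)%E.
have mlo : measurable_fun D lo.
  apply/measurable_restrict => //; first exact: measurableC.
  by apply: measurable_funS mg => //; exact: subIsetr.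
have mhi : measurable_fun D hi.
  apply: emeasurable_funD => //.
  by apply/measurable_restrict => //; exact: measurable_cst.
have loE x : ~ N x -> lo x = g x by move=> Nx; rewrite /lo patchE mem_set.
have hiE x : ~ N x -> hi x = g x by move=> Nx; rewrite /hi patchE memNset// adde0.
have aelo : (\int[mu]_(x in D) lo x = \int[mu]_(x in D) g x)%E.
  apply: ae_eq_integral => //; exists N; split => // x /= /not_implyP[Dx gx].
  by apply: contrapT => /loE.
have aehi : (\int[mu]_(x in D) hi x = \int[mu]_(x in D) g x)%E.
  apply: ae_eq_integral => //; exists N; split => // x /= /not_implyP[Dx gx].
  by apply: contrapT => /hiE.
apply/eqP; rewrite eq_le -{1}aehi -{1}aelo; apply/andP; split; apply: ge0_le_integral_nomeas => //.
- move=> x Dx; have [Nx|Nx] := pselect (N x); last by rewrite hiE// fg.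
  by rewrite /hi patchE mem_set//= addey ?leey// gt_eqF// (lt_le_trans _ (g0 _ Dx))// ltNyr.
- by move=> x Dx; rewrite /lo patchE; case: ifP => // _; exact: g0.
- move=> x Dx; have [Nx|Nx] := pselect (N x); last by rewrite loE// fg.
  by rewrite /lo patchE memNset; [exact: f0|exact].
Qed.

(** Serves to replace [log_abs f], whose values on the null set are not controlled, by an explicit
    measurable function. *)
Lemma integral_null_modification (D N : set T) (f g : T -> \bar R) :
  measurable D -> measurable N -> mu N = 0%E -> measurable_fun D g ->
  (forall x, D x -> ~ N x -> f x = g x) ->
  (\int[mu]_(x in D) f x = \int[mu]_(x in D) g x)%E.
Proof.
move=> mD mN N0 mg fg; rewrite integralE [RHS]integralE; congr (_ - _)%E.
- apply: (@ge0_integral_null_modification _ N) => //.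
  + exact: measurable_funepos.
  + by move=> x Dx Nx; rewrite !funeposE fg.
- apply: (@ge0_integral_null_modification _ N) => //.
  + exact: measurable_funeneg.
  + by move=> x Dx Nx; rewrite !funenegE fg.
Qed.

End NullModification.

(** * Laplacians at the origin and PQL functions *)

Section SecondDerivative.
Context {R : realType}.
Implicit Types (v w : quat R -> R) (e q : quat R).

(** The second derivative at 0 along the line through e, with a witness for the first derivative
    near 0. Unlike the total function [derive] it asserts existence, and so it is additive. *)
Definition has_dd v e (k : R) := exists2 d : R -> R,
  \forall s \near (0 : R), is_derive s (1 : R) (fun s => v (s *: e)) (d s) &
  is_derive (0 : R) (1 : R) d k.

Lemma derive_line v e (s : R) : 'D_e v (s *: e) = 'D_1 (fun s : R => v (s *: e)) s.
Proof.
rewrite /derive; set F := (X in lim (X @ _)); set G := (X in _ = lim (X @ _)).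
suff -> : F = G by [].
by apply/funext => h; rewrite /F /G /= -scalerDl /GRing.scale/= mulr1.
Qed.

Lemma has_dd_derive v e k : has_dd v e k -> 'D_e ('D_e v) 0 = k.
Proof.
move=> [d dv dk].
have -> : (0 : quat R) = (0 : R) *: e by rewrite scale0r.
rewrite derive_line.
have -> : (fun s : R => 'D_e v (s *: e)) = fun s : R => 'D_1 (fun s : R => v (s *: e)) s.
  by apply/funext => s; rewrite derive_line.
rewrite (@near_eq_derive _ _ _ _ d) ?oner_neq0//; first by case: dk.
by apply: filterS dv => s [].
Qed.

Lemma has_dd_near v w e k : (\forall x \near (0 : quat R), v x = w x) ->
  has_dd v e k -> has_dd w e k.
Proof.
move=> vw [d dv dk]; exists d => //.
have ce : {for (0 : R), continuous (fun s : R => s *: e)}.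
  by move=> ?; apply: scalel_continuous.
have vws : \forall s \near (0 : R), v (s *: e) = w (s *: e).
  have : nbhs ((0 : R) *: e) [set x | v x = w x] by rewrite scale0r.
  by move=> /ce.
have := near_join vws; apply: filterS2 dv => s [ds <-] vws'.
split; first by apply: near_eq_derivable vws' ds; rewrite ?oner_neq0.
by apply/esym; apply: near_eq_derive => //; rewrite ?oner_neq0.
Qed.

Lemma has_ddD v w e k l : has_dd v e k -> has_dd w e l ->
  has_dd (fun x => v x + w x) e (k + l).
Proof.
move=> [d dv dk] [d' dw dl]; exists (fun s => d s + d' s); last exact: is_deriveD.
by apply: filterS2 dv dw => s ? ?; apply: is_deriveD.
Qed.

Lemma has_ddZ v e (a k : R) : has_dd v e k -> has_dd (fun x => a * v x) e (a * k).
Proof.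
move=> [d dv dk]; exists (fun s => a * d s).
  by apply: filterS dv => s ?; apply: is_deriveZ.
exact: is_deriveZ.
Qed.

Lemma has_dd_cst e (a : R) : has_dd (fun=> a) e 0.
Proof. by exists (fun=> 0); [apply: (@filterE _ (nbhs (0 : R))) => s|]; exact: is_derive_cst. Qed.

(** Along an axis each squared modulus is a polynomial in s, of which only the 2-jet at 0
    matters. *)
Lemma has_dd_ln_poly v e (a : R) (p : {poly R}) : 0 < p.[0] ->
  (\forall s \near (0 : R), v (s *: e) = a * ln p.[s]) ->
  has_dd v e (a * (p^`(2).[0] / p.[0] - (p^`().[0] / p.[0]) ^+ 2)).
Proof.
move=> p0 vp.
have pp : \forall s \near (0 : R), 0 < p.[s].
  have cp : horner p s @[s --> (0 : R)] --> p.[0] by exact: continuous_horner.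
  by have /cvgr_gt /(_ _ p0) := cp.
exists (fun s => a * (p^`().[s] / p.[s])).
  have := near_join vp; apply: filterS2 pp => s ps vs.
  have H : is_derive s (1 : R) (fun s => a * ln p.[s]) (a * (p^`().[s] / p.[s])).
    apply: is_deriveZ; rewrite mulrC; apply: (@is_derive1_comp _ (@ln R) (horner p)).
      exact: is_derive1_ln.
  have vs' : \forall t \near s, a * ln p.[t] = v (t *: e) by apply: filterS vs => t ->.
  case: H => H <-; split.
    by apply: near_eq_derivable vs' H; rewrite ?oner_neq0.
  by apply/esym; apply: near_eq_derive => //; rewrite ?oner_neq0.
have p0' : p.[0] != 0 by rewrite gt_eqF.
apply: is_deriveZ.
have H : is_derive (0 : R) (1 : R) (fun s => p^`().[s] * (p.[s])^-1)
   (p^`().[0] *: (- (p.[0] ^- 2) *: p^`().[0]) + (p.[0])^-1 *: p^`()^`().[0]).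
  exact: (is_deriveM (is_derive_poly _ _) (is_deriveV p0' (is_derive_poly _ _))).
apply: (is_derive_eq H).
by rewrite derivSn derivn1 /GRing.scale/=; field.
Qed.

Definition axes : seq (quat R) :=
  [:: Quat 1 0 0 0; Quat 0 1 0 0; Quat 0 0 1 0; Quat 0 0 0 1].

Definition has_lap v (k : R) := exists2 kk : quat R -> R,
  {in axes, forall e, has_dd v e (kk e)} & k = \sum_(e <- axes) kk e.

Lemma has_lap_laplacian v k : has_lap v k -> laplacian v 0 = k.
Proof.
move=> [kk hkk ->]; rewrite /laplacian; apply: eq_big_seq => e ea.
exact/has_dd_derive/hkk.
Qed.

Lemma has_lap_near v w k : (\forall x \near (0 : quat R), v x = w x) ->
  has_lap v k -> has_lap w k.
Proof.
by move=> vw [kk hkk ->]; exists kk => // e /hkk; exact: has_dd_near.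
Qed.

Lemma has_lapD v w k l : has_lap v k -> has_lap w l -> has_lap (fun x => v x + w x) (k + l).
Proof.
move=> [kk hkk ->] [ll hll ->]; exists (fun e => kk e + ll e).
  by move=> e ea; apply: has_ddD; [exact: hkk|exact: hll].
by rewrite big_split.
Qed.

Lemma has_lapZ v (a k : R) : has_lap v k -> has_lap (fun x => a * v x) (a * k).
Proof.
move=> [kk hkk ->]; exists (fun e => a * kk e).
  by move=> e ea; apply: has_ddZ; exact: hkk.
by rewrite mulr_sumr.
Qed.

Lemma has_lap_cst (a : R) : has_lap (fun=> a) 0.
Proof.
exists (fun=> 0) => [e _|]; first exact: has_dd_cst.
by rewrite big1.
Qed.

Lemma has_lap_sum (I : Type) (s : seq I) (P : pred I) (h : I -> quat R -> R) (A : I -> R) :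
  (forall i, P i -> has_lap (h i) (A i)) ->
  has_lap (fun y => \sum_(i <- s | P i) h i y) (\sum_(i <- s | P i) A i).
Proof.
move=> hA; elim: s => [|i s IH].
  under [X in has_lap X]eq_fun do rewrite big_nil.
  by rewrite big_nil; exact: has_lap_cst.
under [X in has_lap X]eq_fun do rewrite big_cons.
rewrite big_cons; case: ifPn => // Pi.
by apply: has_lapD => //; exact: hA.
Qed.

Let ln_half (x : R) : 0 <= x -> ln x = 2^-1 * ln (x ^+ 2).
Proof.
rewrite le_eqVlt => /predU1P[<-|x0]; first by rewrite expr0n ln0 ?mulr0.
by rewrite lnXn// -[ln x *+ 2]mulr_natl mulrA mulVf// mul1r.
Qed.

(** The sum over the axes recovers the Laplacian of ln |x| in dimension 4, namely 2 / |x|^2, at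
    distance |q| from the singularity. *)
Lemma has_lap_log_dist q : q != 0 ->
  has_lap (fun x => ln `|x - q|) (2 / `|q| ^+ 2).
Proof.
move=> q0; have Q0 : 0 < `|q| ^+ 2 by rewrite exprn_gt0// normr_gt0.
pose p e : {poly R} := (`|q| ^+ 2)%:P - (2 * qdot e q)%:P * 'X + (`|e| ^+ 2)%:P * 'X ^+ 2.
have dp e : (p e)^`() = (2 * `|e| ^+ 2)%:P * 'X - (2 * qdot e q)%:P.
  rewrite /p derivD derivB !derivM !derivC derivX ?derivXn ?expr1 [(2 * `|e| ^+ 2)%:P]polyCM.
  by rewrite [2%:P]polyCMn; ring.
have pE e : [/\ (p e).[0] = `|q| ^+ 2, (p e)^`().[0] = - (2 * qdot e q)
    & (p e)^`(2).[0] = 2 * `|e| ^+ 2].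
  split.
  - by rewrite /p !hornerE/=; ring.
  - by rewrite dp !hornerE/=; ring.
  - by rewrite derivSn derivn1 dp derivB derivM !derivC derivX !hornerE/=; ring.
exists (fun e => 2^-1 * ((p e)^`(2).[0] / (p e).[0] - ((p e)^`().[0] / (p e).[0]) ^+ 2)).
  move=> e _; apply: has_dd_ln_poly; first by have [-> _ _] := pE e.
  apply: (@filterE _ (nbhs (0 : R))) => s; rewrite ln_half//; congr (_ * ln _).
  rewrite qnormB_sqr /p !hornerE/= normrZ exprMn -normrX (ger0_norm (sqr_ge0 s)).
  by rewrite /qdot /=; ring.
rewrite !big_cons big_nil; move: (pE (Quat 1 0 0 0)) (pE (Quat 0 1 0 0)) (pE (Quat 0 0 1 0)) (pE (Quat 0 0 0 1)).
move=> [-> -> ->] [-> -> ->] [-> -> ->] [-> -> ->].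
rewrite !quat_normE /qdot /=.
have := Q0; rewrite quat_normE => /lt0r_neq0 Q0'.
by field.
Qed.

(** The form A^2 - k s^2 is that of the squared modulus of the spherical factor along an axis, by
    [sph_factor_norm]. *)
Let jet (A : {poly R}) (k : R) : let p := A * A - k%:P * 'X ^+ 2 in
  [/\ p.[0] = A.[0] ^+ 2, p^`().[0] = 2 * A.[0] * A^`().[0] &
    p^`(2).[0] = 2 * A^`().[0] ^+ 2 + 2 * A.[0] * A^`()^`().[0] - 2 * k].
Proof.
move=> p.
have dp : p^`() = A^`() * A + A * A^`() - (k%:P * 'X + k%:P * 'X).
  by rewrite /p derivB !derivM !derivC ?derivX ?derivXn ?expr1; ring.
split.
- by rewrite /p hornerD hornerN !hornerM hornerX mulr0 mulr0 subr0 expr2.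
- by rewrite dp hornerD hornerN !hornerD !hornerM hornerX !mulr0 addr0 subr0; ring.
- rewrite derivSn derivn1 dp derivB !derivD !derivM !derivC derivX !mul0r !mulr1 !add0r.
  by rewrite hornerD hornerN !hornerD !hornerM !hornerC; ring.
Qed.

Lemma has_lap_log_sph q : q != 0 ->
  has_lap (fun x => ln `|sph_factor q x|)
    ((8 * qre q ^+ 2 - 4 * `|q| ^+ 2) / `|q| ^+ 4).
Proof.
move=> q0; have Q0 : 0 < `|q| ^+ 2 by rewrite exprn_gt0// normr_gt0.
pose N := `|q| ^+ 2; pose a := qre q.
pose B (e : quat R) := 2 * qre e * a.
pose K (e : quat R) := 4 * (`|e| ^+ 2 - qre e ^+ 2) * (N - a ^+ 2).
pose E (e : quat R) := `|e| ^+ 2.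
pose A e : {poly R} := (E e)%:P * 'X ^+ 2 + N%:P - (B e)%:P * 'X.
pose p (e : quat R) : {poly R} := A e * A e - (K e)%:P * 'X ^+ 2.
have dA e : (A e)^`() = (E e)%:P * 'X + (E e)%:P * 'X - (B e)%:P.
  by rewrite /A derivB derivD !derivM !derivC derivX ?derivXn ?expr1; ring.
have A0 e : (A e).[0] = N by rewrite /A !hornerE/=; ring.
have dA0 e : (A e)^`().[0] = - B e by rewrite dA !hornerE/=; ring.
have ddA0 e : (A e)^`()^`().[0] = E e + E e.
  by rewrite dA derivB derivD !derivM !derivC derivX !hornerE/=; ring.
have pE e : [/\ (p e).[0] = N ^+ 2, (p e)^`().[0] = - (2 * N * B e)
    & (p e)^`(2).[0] = 2 * B e ^+ 2 + 4 * N * E e - 2 * K e].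
  have [-> -> ->] := jet (A e) (K e); rewrite A0 dA0 ddA0.
  have H (n b e' k : R) : [/\ n ^+ 2 = n ^+ 2, 2 * n * - b = - (2 * n * b) &
    2 * (- b) ^+ 2 + 2 * n * (e' + e') - 2 * k = 2 * b ^+ 2 + 4 * n * e' - 2 * k].
    by split; ring.
  exact: H.
exists (fun e => 2^-1 * ((p e)^`(2).[0] / (p e).[0] - ((p e)^`().[0] / (p e).[0]) ^+ 2)).
  move=> e _; apply: has_dd_ln_poly; first by have [-> _ _] := pE e; rewrite exprn_gt0.
  apply: (@filterE _ (nbhs (0 : R))) => s; rewrite ln_half//; congr (_ * ln _).
  rewrite sph_factor_norm /p /A /E /K /B !hornerE/= normrZ exprMn -normrX (ger0_norm (sqr_ge0 s)).
  by rewrite -/N -/a; ring.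
rewrite !big_cons big_nil; move: (pE (Quat 1 0 0 0)) (pE (Quat 0 1 0 0)) (pE (Quat 0 0 1 0)) (pE (Quat 0 0 0 1)).
move=> [-> -> ->] [-> -> ->] [-> -> ->] [-> -> ->].
rewrite /K /B /E (_ : `|q| ^+ 4 = N ^+ 2); last by rewrite /N -exprM.
have N0 : N != 0 by rewrite gt_eqF.
rewrite -/N -/a !quat_normE /=.
by move: (N) (a) N0 => n b n0; field.
Qed.

End SecondDerivative.

Section QuatNorm.
Context {R : realType}.
Implicit Types x y : quat R.

Lemma quat_normM x y : `|x * y| = `|x| * `|y|.
Proof.
apply/eqP; rewrite -(@eqrXn2 _ 2)//.
rewrite exprMn !quat_normE; case: x y => [a b c d] [a' b' c' d'] /=.
by apply/eqP; ring.
Qed.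

Lemma quat_norm1 : `|1 : quat R| = 1.
Proof.
apply/eqP; rewrite -(@eqrXn2 _ 2)// quat_normE /= expr1n; apply/eqP; ring.
Qed.

Lemma quat_unitE x : (x \is a GRing.unit) = (x != 0).
Proof. by []. Qed.

Lemma quat_normV x : `|x^-1| = `|x|^-1.
Proof.
have [->|x0] := eqVneq x 0; first by rewrite invr0 normr0 invr0.
have nx0 : `|x| != 0 by rewrite normr_eq0.
by apply: (mulfI nx0); rewrite -quat_normM mulrV// quat_norm1 mulfV.
Qed.

Lemma quat_normX x n : `|x ^+ n| = `|x| ^+ n.
Proof.
elim: n => [|n IH]; first by rewrite !expr0 quat_norm1.
by rewrite !exprS quat_normM IH.
Qed.

Lemma quat_normXz x (n : int) : `|x ^ n| = `|x| ^ n.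
Proof.
case: n => n; first exact: quat_normX.
by rewrite !NegzE -!exprnN quat_normV quat_normX.
Qed.

Lemma quat_norm_prod (n : nat) (F : 'I_n -> quat R) :
  `|\prod_(k < n) F k| = \prod_(k < n) `|F k|.
Proof.
elim/big_ind2 : _ => //; first exact: quat_norm1.
by move=> x a y b <- <-; rewrite quat_normM.
Qed.

End QuatNorm.

(** * The formula for PQL functions *)

Section PQL.
Context {R : realType} (rho : R).
Hypothesis rho0 : 0 < rho.
Notation mu := (surface_measure rho).
Notation S := (qsphere rho : set (quat R)).

Lemma lnXz (x : R) (n : int) : 0 < x -> ln (x ^ n) = n%:~R * ln x.
Proof.
move=> x0; case: n => n; first by rewrite -exprnP lnXn// -mulr_natl.
by rewrite NegzE -exprnN lnV ?posrE ?exprn_gt0// lnXn// mulrNz mulNr mulr_natl.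
Qed.

Lemma ln_prod (n : nat) (F : 'I_n -> R) : (forall k, 0 < F k) ->
  ln (\prod_(k < n) F k) = \sum_(k < n) ln (F k).
Proof.
move=> F0; suff [] : ln (\prod_(k < n) F k) = \sum_(k < n) ln (F k) /\ 0 < \prod_(k < n) F k by [].
elim/big_ind2 : _ => //; first by rewrite ln1.
move=> x a y b [<- x0] [<- y0].
by rewrite lnM// mulr_gt0.
Qed.

(** [L] is an explicit model of [log_abs f]: equal to it off a null subset of the sphere, which
    determines the integral, and near 0, which determines the Laplacian and the value. *)
Lemma mean_formula (f : quat R -> hquat R) (L : quat R -> R) (A k : R) (Z : set (quat R)) :
  has_mean rho L A -> has_lap L k -> measurable Z -> mu (S `&` Z) = 0%E ->
  (forall y, S y -> ~ Z y -> log_abs f y = (L y)%:E) ->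
  (\forall x \near (0 : quat R), log_abs f x = (L x)%:E) ->
  [/\ (((fine (mu S))^-1)%:E * (\int[mu]_(y in S) log_abs f y))%E = A%:E,
      laplacian (fun x => fine (log_abs f x)) 0 = k &
      log_abs f 0 = (L 0)%:E].
Proof.
move=> [iL LA] lapL mZ Z0 fL fL0; split.
- have mS := @measurable_qsphere R rho.
  rewrite (@integral_null_modification _ _ _ _ S (S `&` Z) _ (EFin \o L))//.
  + rewrite -[X in (_ * X)%E]fineK; last exact: integrable_fin_num.
    rewrite -EFinM; congr _%:E; move: LA; rewrite /Rintegral => ->.
    by rewrite mulrA mulVf ?mul1r// gt_eqF// sphere_mass_gt0.
  + exact: measurableI.
  + exact: (measurable_int mu).
  + by move=> y Sy SZ; apply: fL => // Zy; apply: SZ.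
- apply: has_lap_laplacian; apply: has_lap_near lapL.
  by apply: filterS fL0 => x ->.
- exact: nbhs_singleton fL0.
Qed.

Lemma PQL_formula (Omega : set (quat R)) (f : quat R -> hquat R) (N : nat)
   (a0 : quat R) (a q : 'I_N -> quat R) (M : 'I_N -> int) :
  open Omega -> [set x : quat R | `|x| <= rho] `<=` Omega ->
  is_PQL Omega f a0 a q M ->
  (forall k, q k != 0) -> (forall k, `|q k| <= rho) ->
     log_abs f 0 =
       (((fine (surface_measure rho (qsphere rho)))^-1)%:E
          * (\int[surface_measure rho]_(y in qsphere rho) log_abs f y)
        - (rho ^+ 2 / 8 * laplacian (fun x => fine (log_abs f x)) 0)%:E
        - (\sum_(k < N | (`|q k| < rho)%R) (M k)%:~R * real_term rho `|q k|)%:E)%E.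
Proof.
move=> oO BO [a00 ak0 M1 fE _] q0 qrho.
(* Multiplicativity of the norm makes the order of the quaternionic factors irrelevant: log|f| is a
   sum of real logarithms. *)
pose L x := ln `|a0| + \sum_(k < N) ((M k)%:~R * ln `|x - q k| + ln `|a k|).
have fL x : Omega x -> (forall k, x != q k) -> log_abs f x = (L x)%:E.
  move=> Ox xq; rewrite /log_abs fE//; last by move=> k _; apply/eqP.
  have p0 k : 0 < `|(x - q k) ^ M k * a k|.
      rewrite quat_normM; apply: mulr_gt0; last by rewrite normr_gt0.
    by rewrite quat_normXz exprz_gt0// normr_gt0 subr_eq0.
  rewrite quat_normM quat_norm_prod.
  have P0 : 0 < \prod_(k < N) `|(x - q k) ^ M k * a k| by rewrite prodr_gt0.
  rewrite lne_EFin ?mulr_gt0 ?normr_gt0//; congr _%:E.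
  rewrite lnM ?posrE ?normr_gt0// ln_prod// /L; congr (_ + _).
  apply: eq_bigr => k _; rewrite quat_normM lnM ?posrE ?normr_gt0//; last first.
    by rewrite -normr_gt0 quat_normXz exprz_gt0// normr_gt0 subr_eq0.
  by rewrite quat_normXz lnXz// normr_gt0 subr_eq0.
pose Z : set (quat R) := \bigcup_(k in [set: 'I_N]) [set q k].
have mq (x : quat R) : measurable [set x].
  have := measurable_qdist_sqr x measurableT (measurable_set1 0).
  rewrite setTI; congr measurable; apply/seteqP; split => y /=.
    by move/eqP; rewrite sqrf_eq0 normr_eq0 subr_eq0 => /eqP.
  by move=> ->; rewrite subrr normr0 expr0n.
have mZ : measurable Z by apply: fin_bigcup_measurable => // k _; exact: mq.
have qdist := fun k => has_mean_log_dist rho0 (q0 k) (qrho k).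
have Z0 : mu (S `&` Z) = 0%E.
  rewrite setI_bigcupr; apply/eqP; rewrite -measure_le0.
  have mSq k : measurable (S `&` [set q k]).
    by apply: measurableI; [exact: measurable_qsphere|exact: mq].
  have fT : finite_set [set: 'I_N] by [].
  have := @content_sub_fsum _ _ _ mu _ [set: 'I_N] _ (fun k => S `&` [set q k]) fT
    (fun k _ => mSq k) (fin_bigcup_measurable fT (fun k _ => mSq k)) (@subset_refl _ _).
  by rewrite fsbig1 // => k _; exact: (qdist k).2.
have [] := @mean_formula f L
  (ln `|a0| + \sum_(k < N) ((M k)%:~R * (ln rho + `|q k| ^+ 2 / (4 * rho ^+ 2)) + ln `|a k|))
  (0 + \sum_(k < N) ((M k)%:~R * (2 / `|q k| ^+ 2) + 0)) Z.
- apply: has_meanD; first exact: has_mean_cst.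
  apply: has_mean_sum => [//|k _]; apply: has_meanD; last exact: has_mean_cst.
  by apply: has_meanZ; exact: (qdist k).1.
- apply: has_lapD; first exact: has_lap_cst.
  apply: has_lap_sum => k _; apply: has_lapD; last exact: has_lap_cst.
  by apply: has_lapZ; exact: has_lap_log_dist.
- exact: mZ.
- exact: Z0.
- move=> y Sy Zy; apply: fL; first by apply: BO; rewrite /= Sy.
  by move=> k; apply/eqP => yq; apply: Zy; exists k.
- have O0 : Omega 0 by apply: BO; rewrite /= normr0 ltW.
  have : \forall x \near (0 : quat R), forall k, x != q k.
    apply: (@filter_forall _ _ (fun k => [set x : quat R | x != q k]) (nbhs (0 : quat R))) => k; have qk0 : 0 < `|q k| by rewrite normr_gt0.
    apply: filterS (nbhs0_lt qk0) => x xq; apply/eqP => xE.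
    by move: xq; rewrite xE ltxx.
  have : nbhs (0 : quat R) Omega by apply: open_nbhs_nbhs; split.
  by apply: filterS2 => x; exact: fL.
move=> -> -> ->; rewrite -!EFinB; congr _%:E.
(* The terms with |q k| = rho vanish, so the sum may run over all k, and the identity is then
   checked factor by factor. *)
rewrite [X in _ - X](_ : _ = \sum_(k < N) (M k)%:~R * real_term rho `|q k|); last first.
  rewrite big_mkcond/=; apply: eq_bigr => k _; case: ltP => // qk.
  have -> : `|q k| = rho by apply/eqP; rewrite eq_le qrho.
  rewrite /real_term subrr mul0r mulr0 addr0 ger0_norm ?ltW// divff ?gt_eqF// ln1 mulr0//.
rewrite /L add0r mulr_sumr -!addrA; congr (_ + _); rewrite -!sumrN -!big_split/=.
apply: eq_bigr => k _; rewrite sub0r normrN /real_term normr_id.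
have q0' : 0 < `|q k| by rewrite normr_gt0.
rewrite ln_div ?posrE//; field.
by rewrite !gt_eqF.
Qed.

End PQL.

(** * Holomorphic functions of one complex variable *)

Import ComplexField Normc.

(* Bundled as a [numFieldType] so that the topology of number fields applies. *)
Definition Cx (R : realType) : numFieldType := (R[i] : numFieldType).

Section ComplexPlane.
Context {R : realType}.
Local Notation C := (Cx R).
Implicit Types (z w : C).

Definition cre z : R := complex.Re (z : R[i]).
Definition cim z : R := complex.Im (z : R[i]).
Definition cx (a b : R) : C := (a +i* b : R[i]).
(** Real valued, whereas the norm of the field [Cx R] takes values in the field itself; [nbhs_cx]
    and [cvg_cxP] express its topology through [cnorm]. *)
Definition cnorm z : R := normc (z : R[i]).
Definition cconj z : C := conjc (z : R[i]).

Lemma cxE z : z = cx (cre z) (cim z). Proof. by case: z. Qed.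
Lemma cx_inj z w : cre z = cre w -> cim z = cim w -> z = w.
Proof. by case: z => a b; case: w => c d /= ; rewrite /cre /cim /= => -> ->. Qed.
Lemma cre_cx a b : cre (cx a b) = a. Proof. by []. Qed.
Lemma cim_cx a b : cim (cx a b) = b. Proof. by []. Qed.
Lemma creD z w : cre (z + w) = cre z + cre w. Proof. by case: z w => a b [c d]. Qed.
Lemma cimD z w : cim (z + w) = cim z + cim w. Proof. by case: z w => a b [c d]. Qed.
Lemma creN z : cre (- z) = - cre z. Proof. by case: z. Qed.
Lemma cimN z : cim (- z) = - cim z. Proof. by case: z. Qed.
Lemma creM z w : cre (z * w) = cre z * cre w - cim z * cim w.
Proof. by case: z w => a b [c d]. Qed.
Lemma cimM z w : cim (z * w) = cre z * cim w + cim z * cre w.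
Proof. by case: z w => a b [c d]. Qed.
Lemma creJ z : cre (cconj z) = cre z. Proof. by case: z. Qed.
Lemma cimJ z : cim (cconj z) = - cim z. Proof. by case: z. Qed.
Lemma cre0 : cre 0 = 0. Proof. by []. Qed.
Lemma cim0 : cim 0 = 0. Proof. by []. Qed.
Lemma cre1 : cre 1 = 1. Proof. by []. Qed.
Lemma cim1 : cim 1 = 0. Proof. by []. Qed.

Definition cpartE := (creD, cimD, creN, cimN, creM, cimM, creJ, cimJ, cre0, cim0, cre1, cim1,
  cre_cx, cim_cx).

Lemma cxD a b c d : cx a b + cx c d = cx (a + c) (b + d). Proof. by []. Qed.

Lemma cconjK : involutive cconj.
Proof. by move=> z; apply: cx_inj; rewrite !cpartE ?opprK. Qed.
Lemma cconjD z w : cconj (z + w) = cconj z + cconj w.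
Proof. by apply: cx_inj; rewrite !cpartE; ring. Qed.
Lemma cconjN z : cconj (- z) = - cconj z.
Proof. by apply: cx_inj; rewrite !cpartE; ring. Qed.
Lemma cconjB z w : cconj (z - w) = cconj z - cconj w.
Proof. by rewrite cconjD cconjN. Qed.
Lemma cconjM z w : cconj (z * w) = cconj z * cconj w.
Proof. by apply: cx_inj; rewrite !cpartE; ring. Qed.
Lemma cconj1 : cconj 1 = 1.
Proof. by apply: cx_inj; rewrite !cpartE ?oppr0. Qed.
Lemma cconj0 : cconj 0 = 0.
Proof. by apply: cx_inj; rewrite !cpartE ?oppr0. Qed.
Lemma cconjV z : cconj z^-1 = (cconj z)^-1.
Proof.
have [->|z0] := eqVneq z 0; first by rewrite invr0 cconj0 invr0.
have z0' : cconj z != 0.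
  by apply: contra_neq z0 => z0; rewrite -[z]cconjK z0 cconj0.
by apply: (mulfI z0'); rewrite -cconjM !divff// cconj1.
Qed.
Lemma cconjX z n : cconj (z ^+ n) = cconj z ^+ n.
Proof. by elim: n => [|n IH]; rewrite ?expr0 ?cconj1// !exprS cconjM IH. Qed.
Lemma cconjXz z (n : int) : cconj (z ^ n) = cconj z ^ n.
Proof. by case: n => n; rewrite ?NegzE -?exprnP ?exprN1 -?exprnN ?cconjV cconjX. Qed.

Lemma cnorm_sqr z : cnorm z ^+ 2 = cre z ^+ 2 + cim z ^+ 2.
Proof. by case: z => a b; rewrite /cnorm /= sqr_sqrtr// addr_ge0// sqr_ge0. Qed.
Lemma cnorm_ge0 z : 0 <= cnorm z.
Proof. by case: z => a b; rewrite sqrtr_ge0. Qed.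
Lemma cnorm0 : cnorm 0 = 0. Proof. exact: normc0. Qed.
Lemma cnorm1 : cnorm 1 = 1. Proof. exact: normc1. Qed.
Lemma cnorm_eq0 z : (cnorm z == 0) = (z == 0).
Proof. by apply/eqP/eqP => [/eq0_normc//|->]; rewrite cnorm0. Qed.
Lemma cnorm_gt0 z : (0 < cnorm z) = (z != 0).
Proof. by rewrite lt_neqAle cnorm_ge0 andbT eq_sym cnorm_eq0. Qed.
Lemma cnormM z w : cnorm (z * w) = cnorm z * cnorm w. Proof. exact: normcM. Qed.
Lemma cnormV z : cnorm z^-1 = (cnorm z)^-1. Proof. exact: normcV. Qed.
Lemma cnormD z w : cnorm (z + w) <= cnorm z + cnorm w.
Proof. exact: le_normcD. Qed.
Lemma cnormN z : cnorm (- z) = cnorm z. Proof. exact: normcN. Qed.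
Lemma cdistC z w : cnorm (z - w) = cnorm (w - z).
Proof. by rewrite -cnormN opprB. Qed.
Lemma cdist_trans y z w : cnorm (z - w) <= cnorm (z - y) + cnorm (y - w).
Proof. by rewrite (le_trans _ (cnormD _ _))// addrA subrK. Qed.
Lemma cnormJ z : cnorm (cconj z) = cnorm z.
Proof. by case: z => a b; rewrite /cnorm/= sqrrN. Qed.
Lemma cnormX z n : cnorm (z ^+ n) = cnorm z ^+ n.
Proof. by elim: n => [|n IH]; rewrite ?expr0 ?cnorm1// !exprS cnormM IH. Qed.
Lemma cnormXz z (n : int) : cnorm (z ^ n) = cnorm z ^ n.
Proof. by case: n => n; rewrite ?NegzE -?exprnP -?exprnN ?cnormV cnormX. Qed.
Lemma cnorm_real (a : R) : cnorm (cx a 0) = `|a|.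
Proof. by rewrite /cnorm/= expr0n addr0 sqrtr_sqr. Qed.
Lemma cre_le z : `|cre z| <= cnorm z.
Proof.
rewrite -(@ler_pXn2r _ 2) ?nnegrE ?cnorm_ge0// cnorm_sqr real_normK ?num_real//.
by rewrite lerDl sqr_ge0.
Qed.
Lemma cim_le z : `|cim z| <= cnorm z.
Proof.
rewrite -(@ler_pXn2r _ 2) ?nnegrE ?cnorm_ge0// cnorm_sqr real_normK ?num_real//.
by rewrite lerDr sqr_ge0.
Qed.
Lemma cnorm_le z : cnorm z <= `|cre z| + `|cim z|.
Proof.
rewrite -(@ler_pXn2r _ 2) ?nnegrE ?cnorm_ge0 ?addr_ge0// cnorm_sqr sqrrD.
rewrite !real_normK ?num_real// -addrA lerD2l lerDr mulrn_wge0// mulr_ge0//.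
Qed.

Definition cball z (r : R) : set C := [set w | cnorm (w - z) < r].

Lemma cballxx z r : 0 < r -> cball z r z.
Proof. by rewrite /cball/= subrr cnorm0. Qed.

Lemma nbhs_cx z (P : set C) : nbhs z P <-> exists2 d : R, 0 < d & cball z d `<=` P.
Proof.
split=> [/nbhs_ballP[e /= e0 eP]|[d d0 dP]].
  have := e0; rewrite ltcE/= => /andP[/eqP Ie Re0]; exists (cre e) => // w zw.
  apply: eP; rewrite -ball_normE/= distrC; rewrite /cball/= in zw.
  by rewrite ltcE/= Ie eqxx.
apply/nbhs_ballP; exists (d%:C : C) => /=; first by rewrite ltcR.
by move=> w; rewrite -ball_normE/= distrC ltcR => zw; exact: dP.
Qed.

Lemma nbhs_cball z r : 0 < r -> nbhs z (cball z r).
Proof. by move=> r0; apply/nbhs_cx; exists r. Qed.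

Lemma cball_in z r w : cball z r w -> exists2 d, 0 < d & cball w d `<=` cball z r.
Proof.
move=> zw; exists (r - cnorm (w - z)); first by rewrite subr_gt0.
move=> y; rewrite /cball/= ltrBrDr; apply: le_lt_trans; exact: cdist_trans.
Qed.

Lemma cball_open z r : open (cball z r).
Proof.
rewrite openE => w /cball_in[d d0 dr]; rewrite /interior.
by apply/nbhs_cx; exists d.
Qed.

Lemma cvg_cxP (T : Type) (F : set_system T) {FF : Filter F} (f : T -> C) (l : C) :
  f @ F --> l <-> forall e : R, 0 < e -> \forall x \near F, cnorm (f x - l) < e.
Proof.
split=> [/cvgrPdist_lt fl e e0|fl].
  have e0' : 0 < (e%:C : C) by rewrite ltcR.
  by apply: filterS (fl _ e0') => x; rewrite distrC ltcR.
apply/cvgrPdist_lt => e; rewrite ltcE/= => /andP[/eqP Ie Re0].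
by apply: filterS (fl _ Re0) => x xe; rewrite distrC ltcE/= Ie eqxx.
Qed.

Lemma cvg_cre (T : Type) (F : set_system T) {FF : Filter F} (f : T -> C) (l : C) :
  f @ F --> l -> (cre \o f) @ F --> cre l.
Proof.
move=> /cvg_cxP fl; apply/cvgrPdist_lt => e e0; apply: filterS (fl _ e0) => x xe /=.
by rewrite distrC (le_lt_trans _ xe)// -creN -creD cre_le.
Qed.

Lemma cvg_cim (T : Type) (F : set_system T) {FF : Filter F} (f : T -> C) (l : C) :
  f @ F --> l -> (cim \o f) @ F --> cim l.
Proof.
move=> /cvg_cxP fl; apply/cvgrPdist_lt => e e0; apply: filterS (fl _ e0) => x xe /=.
by rewrite distrC (le_lt_trans _ xe)// -cimN -cimD cim_le.
Qed.

Lemma cvg_cx (T : Type) (F : set_system T) {FF : Filter F} (f g : T -> R) (a b : R) :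
  f @ F --> a -> g @ F --> b -> (fun x => cx (f x) (g x)) @ F --> cx a b.
Proof.
move=> /cvgrPdist_lt fa /cvgrPdist_lt gb; apply/cvg_cxP => e e0.
have e2 : 0 < e / 2 by rewrite divr_gt0.
apply: filterS2 (fa _ e2) (gb _ e2) => x ax bx.
by rewrite (le_lt_trans (cnorm_le _))// !cpartE [e]splitr distrC ltrD// distrC.
Qed.

Lemma cvg_cnorm (T : Type) (F : set_system T) {FF : Filter F} (f : T -> C) (l : C) :
  f @ F --> l -> (cnorm \o f) @ F --> cnorm l.
Proof.
move=> /cvg_cxP fl; apply/cvgrPdist_lt => e e0; apply: filterS (fl _ e0) => x xe /=.
apply: le_lt_trans xe; rewrite ler_norml.
have := cnormD (f x - l) l; have := cnormD (l - f x) (f x); rewrite !subrK cdistC.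
by move=> h1 h2; apply/andP; split; lra.
Qed.

Lemma cvg_cconj (T : Type) (F : set_system T) {FF : Filter F} (f : T -> C) (l : C) :
  f @ F --> l -> (cconj \o f) @ F --> cconj l.
Proof.
move=> /cvg_cxP fl; apply/cvg_cxP => e e0; apply: filterS (fl _ e0) => x xe /=.
by rewrite -cconjB cnormJ.
Qed.

Definition cdisc (r : R) : set C := [set z | cnorm z <= r].

Lemma compact_cdisc r : compact (cdisc r).
Proof.
pose h (t : R * R) : C := cx t.1 t.2.
have ch : continuous h.
  by move=> t; apply: cvg_cx; [exact: cvg_fst|exact: cvg_snd].
pose B : set (R * R) := `[- r, r] `*` `[- r, r].
have cB : compact (h @` B).
  apply: continuous_compact; first exact: continuous_subspaceT.
  by apply: compact_setX; exact: segment_compact.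
apply: (subclosed_compact _ cB).
  rewrite (_ : cdisc r = cnorm @^-1` [set x | x <= r])//.
  apply: closed_comp; last exact: closed_le.
  by move=> z _; exact: (@cvg_cnorm _ _ (nbhs_filter z) id z).
move=> z zr; exists (cre z, cim z); last by rewrite /h/= -cxE.
by split => /=; rewrite in_itv/= -ler_norml (le_trans _ zr)// ?cre_le ?cim_le.
Qed.

End ComplexPlane.

Section PathDerivative.
Context {R : realType}.
Local Notation C := (Cx R).
Implicit Types (z w : C).

(** Coordinatewise, because [is_derive] wants source and target over the same scalars. *)
Definition cder (g : R -> C) (t : R) (d : C) :=
  is_derive t (1 : R) (cre \o g) (cre d) /\ is_derive t (1 : R) (cim \o g) (cim d).

Lemma is_derive_quotP (g : R -> R) (t d : R) : is_derive t (1 : R) g d <->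
  h^-1 * (g (h + t) - g t) @[h --> 0^'] --> d.
Proof.
have E : (fun h : R => h^-1 * (g (h + t) - g t)) =
   (fun h : R => h^-1 *: (g (h *: (1 : R) + t) - g t)).
  by apply/funext => h; rewrite /GRing.scale/= mulr1.
split=> [[dg <-]|]; first by rewrite E.
rewrite E => gd; split; first by apply/cvg_ex; exists d.
by apply: cvg_lim.
Qed.

Lemma cder_quotP g t d : cder g t d <->
  cx h^-1 0 * (g (h + t) - g t) @[h --> (0 : R)^'] --> d.
Proof.
have E1 h : cre (cx h^-1 0 * (g (h + t) - g t)) = h^-1 * (cre (g (h + t)) - cre (g t)).
  by rewrite !cpartE mul0r subr0.
have E2 h : cim (cx h^-1 0 * (g (h + t) - g t)) = h^-1 * (cim (g (h + t)) - cim (g t)).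
  by rewrite !cpartE mul0r addr0.
split=> [[/is_derive_quotP d1 /is_derive_quotP d2]|gd].
  rewrite [X in X @ _](_ : _ = (fun h => cx (h^-1 * (cre (g (h + t)) - cre (g t)))
    (h^-1 * (cim (g (h + t)) - cim (g t))))); last first.
    by apply/funext => h; rewrite [LHS]cxE E1 E2.
  by rewrite [X in _ --> X]cxE; apply: cvg_cx.
split; apply/is_derive_quotP.
- rewrite (_ : (fun h => _) = cre \o (fun h => cx h^-1 0 * (g (h + t) - g t))); first exact: cvg_cre.
  by apply/funext => h /=; rewrite E1.
- rewrite (_ : (fun h => _) = cim \o (fun h => cx h^-1 0 * (g (h + t) - g t))); first exact: cvg_cim.
  by apply/funext => h /=; rewrite E2.
Qed.

(** The difference quotient completed by d at 0 is continuous there, so it can be composed with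
    paths whose increments may vanish. *)
Lemma is_derive_slope (F : C -> C) z d : is_derive z (1 : C) F d ->
  (fun k => if k == 0 then d else k^-1 * (F (k + z) - F z)) @ (0 : C) --> d.
Proof.
move=> [dF <-]; have : (fun k => k^-1 * (F (k + z) - F z)) @ (0 : C)^' --> 'D_1 F z.
  move: dF; rewrite /derivable /derive.
  rewrite [X in X @ _](_ : _ = (fun k => k^-1 * (F (k + z) - F z)))//.
  by apply/funext => k; rewrite /GRing.scale/= mulr1.
move=> /cvg_cxP dF'; apply/(@cvg_cxP _ _ _ (nbhs_filter (0 : C))) => e e0.
have := dF' e e0; rewrite /dnbhs /within/= => /nbhs_cx[r r0 rP].
apply/nbhs_cx; exists r => // k kr; case: eqVneq => [_|k0]; last exact: rP.
by rewrite subrr cnorm0.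
Qed.

Lemma cder_comp (F : C -> C) (g : R -> C) t d d' :
  is_derive (g t) (1 : C) F d -> cder g t d' -> cder (F \o g) t (d * d').
Proof.
move=> /is_derive_slope dF /cder_quotP dg; apply/cder_quotP.
set s := fun k : C => _ in dF.
have g0 : g (h + t) - g t @[h --> (0 : R)^'] --> (0 : C).
  have h0 : cx h 0 @[h --> (0 : R)^'] --> (0 : C).
    by rewrite [X in _ --> X]cxE; apply: cvg_cx; [exact: cvg_within|exact: cvg_cst].
  rewrite -(mul0r d') (_ : (fun h => _) =
    fun h => cx h 0 * (cx h^-1 0 * (g (h + t) - g t))); first exact: cvgM h0 dg.
  apply/funext => h; have [->|h0'] := eqVneq h 0; first by rewrite add0r subrr !mulr0.
  rewrite mulrA (_ : cx h 0 * cx h^-1 0 = 1) ?mul1r//.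
  by apply: cx_inj; rewrite !cpartE ?mul0r ?mulr0 ?subr0 ?addr0// divff.
rewrite (_ : (fun h => _) = fun h => s (g (h + t) - g t) * (cx h^-1 0 * (g (h + t) - g t))).
  exact: cvgM (cvg_comp _ s g0 dF) dg.
apply/funext => h; rewrite /s /= subrK; case: ifPn => [/eqP E|k0].
  by rewrite (subr0_eq E) !subrr !mulr0.
by rewrite [RHS]mulrCA; congr (_ * _); rewrite mulrAC mulVf// mul1r.
Qed.

Lemma cder_continuous (f : R -> C) t d : cder f t d -> {for t, continuous f}.
Proof.
have ic (h : R -> R) e : is_derive t (1 : R) h e -> {for t, continuous h}.
  by move=> [dh _]; apply: differentiable_continuous; exact/derivable1_diffP.
move=> [/ic f1 /ic f2]; suff : f s @[s --> t] --> f t by [].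
rewrite [X in _ --> X]cxE.
rewrite (_ : f = fun s => cx (cre (f s)) (cim (f s))); last by apply/funext => s; exact: cxE.
exact: cvg_cx.
Qed.

Definition expi (t : R) : C := cx (cos t) (sin t).

Lemma cder_expi t : cder expi t (cx 0 1 * expi t).
Proof.
split; rewrite !cpartE.
- apply: is_derive_eq (is_derive_cos t) _; ring.
- apply: is_derive_eq (is_derive_sin t) _; ring.
Qed.

Lemma cnorm_expi t : cnorm (expi t) = 1.
Proof.
apply/eqP; rewrite -(@eqrXn2 _ 2) ?cnorm_ge0// cnorm_sqr !cpartE cos2Dsin2 expr1n//.
Qed.

Lemma expi_period : expi (pi *+ 2) = expi 0.
Proof. by rewrite /expi cos2pi sin2pi cos0 sin0. Qed.

End PathDerivative.

(** * Means over circles and their dependence on a parameter *)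

Section CircleIntegral.
Context {R : realType}.
Local Notation C := (Cx R).
Local Notation I := (`[0%R, (pi *+ 2)%R]%classic : set R).
Implicit Types (f g : R -> R) (phi psi : R -> C).

Definition rint f : R := (pi *+ 2)^-1 * \int[lebesgue_measure]_(t in I) f t.
Definition cint phi : C := cx (rint (cre \o phi)) (rint (cim \o phi)).

Let pi2 : 0 < (pi *+ 2 : R). Proof. by rewrite mulrn_wgt0 ?pi_gt0. Qed.

Lemma continuous_circle_integrable f : continuous f ->
  lebesgue_measure.-integrable I (EFin \o f).
Proof.
move=> cf; apply: continuous_compact_integrable; first exact: segment_compact.
exact: continuous_subspaceT.
Qed.
Let cii := continuous_circle_integrable.

Lemma rintD f g : continuous f -> continuous g -> rint (fun t => f t + g t) = rint f + rint g.
Proof. by move=> /cii cf /cii cg; rewrite /rint RintegralD// mulrDr. Qed.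

Lemma rintZ (a : R) f : continuous f -> rint (fun t => a * f t) = a * rint f.
Proof. by move=> /cii cf; rewrite /rint RintegralZl// mulrCA. Qed.

Lemma rint_cst (a : R) : rint (fun=> a) = a.
Proof. by rewrite /rint Rintegral_cst//= lebesgue_measure_itv/= lte_fin pi2 sube0/= mulrCA mulVf ?mulr1 ?gt_eqF. Qed.

Lemma rint_le f (M : R) : continuous f -> (forall t, `|f t| <= M) -> `|rint f| <= M.
Proof.
move=> cf fM; rewrite /rint normrM gtr0_norm ?invr_gt0// -(rint_cst M) /rint ler_pM2l ?invr_gt0//.
apply: le_trans (le_normr_Rintegral _ _) _ => //; first exact: cii.
apply: le_Rintegral => //; apply: cii => t; last exact: cvg_cst.
by apply: cvg_norm; exact: cf.
Qed.

Lemma rint_derive_eq0 f g : (forall t, is_derive t (1 : R) f (g t)) -> continuous g ->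
  f 0 = f (pi *+ 2) -> rint g = 0.
Proof.
move=> dF cg f0; rewrite /rint /Rintegral (integral_derive pi2 dF cg)/= f0 subrr mulr0//.
Qed.

(** Differentiation under the integral sign, dominated by the constant M, gives derivative 0 in the
    parameter. The interval is open because two-sided derivatives are taken. *)
Lemma rint_param_eq (g g' : R -> R -> R) (u v M : R) :
  (forall l, u < l < v -> continuous (g l)) ->
  (forall l, u < l < v -> forall t, is_derive l (1 : R) (g ^~ t) (g' l t)) ->
  (forall l, u < l < v -> forall t, `|g' l t| <= M) ->
  (forall l, u < l < v -> rint (g' l) = 0) ->
  forall a b, u < a < v -> u < b < v -> rint (g a) = rint (g b).
Proof.
move=> cg dg gM g0.
have D l : u < l < v -> is_derive l (1 : R) (fun l => rint (g l)) 0.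
  move=> luv; have lI : `]u, v[%classic l by rewrite /= in_itv.
  have H1 x : `]u, v[%classic x -> lebesgue_measure.-integrable I (EFin \o g x).
    by rewrite /= in_itv/= => xuv; apply/cii/cg.
  have H2 x t : `]u, v[%classic x -> I t -> derivable (g ^~ t) x 1.
    by rewrite /= in_itv/= => xuv _; case: (dg x xuv t).
  have M0 : 0 <= M by rewrite (le_trans _ (gM l luv 0)).
  have H3 : lebesgue_measure.-integrable I (EFin \o cst M) by apply/cii => ?; exact: cvg_cst.
  have H4 x t : `]u, v[%classic x -> I t -> `|partial1of2 g x t| <= cst M t.
    rewrite /= in_itv/= => xuv _; rewrite partial1of2E.
    by have [_ ->] := dg x xuv t; exact: gM.
  have mI : measurable I by exact: measurable_itv.
  have d1 := @derivable_under_integral R _ (measurableTypeR R) lebesgue_measure g I mI l u v lI H1 H2 (cst M) (fun=> M0) H3 H4.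
  have d2 := @differentiation_under_integral R _ (measurableTypeR R) lebesgue_measure g I mI l u v lI H1 H2 (cst M) (fun=> M0) H3 H4.
  have dR : is_derive l (1 : R) (fun l => \int[lebesgue_measure]_(t in I) g l t)
      (\int[lebesgue_measure]_(t in I) g' l t).
    split => //; rewrite -derive1E d2; apply: eq_Rintegral => t _.
    by rewrite partial1of2E; have [_ ->] := dg l luv t.
  rewrite -(g0 l luv) /rint; exact: is_deriveZ.
have W a b : a < b -> u < a < v -> u < b < v -> rint (g a) = rint (g b).
  move=> ab /andP[ua _] /andP[_ bv].
  have [||c _ /eqP] := @MVT _ (fun l => rint (g l)) (cst 0) a b ab.
  - move=> x; rewrite in_itv/= => /andP[ax xb]; apply: D.
    by rewrite (lt_trans ua ax) (lt_trans xb bv).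
  - apply: derivable_within_continuous => x; rewrite in_itv/= => /andP[ax xb].
    by have [] := D x; rewrite ?(lt_le_trans ua ax) ?(le_lt_trans xb bv).
  - by rewrite mul0r subr_eq0 => /eqP.
move=> a b auv buv; have [ab|ba|->//] := ltgtP a b; first exact: W.
by rewrite (W b a).
Qed.

Lemma continuous_cre phi : continuous phi -> continuous (cre \o phi).
Proof. by move=> cp t; apply: cvg_cre; exact: cp. Qed.
Lemma continuous_cim phi : continuous phi -> continuous (cim \o phi).
Proof. by move=> cp t; apply: cvg_cim; exact: cp. Qed.

Lemma cintD phi psi : continuous phi -> continuous psi ->
  cint (fun t => phi t + psi t) = cint phi + cint psi.
Proof.
move=> cp cq; rewrite /cint cxD; congr cx.
- rewrite -rintD ?continuous_cre//; [|exact: continuous_cre|exact: continuous_cre].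
  by congr rint; apply/funext => t; rewrite /= cpartE.
- rewrite -rintD ?continuous_cim//; [|exact: continuous_cim|exact: continuous_cim].
  by congr rint; apply/funext => t; rewrite /= cpartE.
Qed.

Lemma cintZ (a : C) phi : continuous phi -> cint (fun t => a * phi t) = a * cint phi.
Proof.
move=> cp; have c1 := continuous_cre cp; have c2 := continuous_cim cp.
have cM (b : R) (f : R -> R) : continuous f -> continuous (fun t => b * f t).
  by move=> cf t; apply: cvgM; [exact: cvg_cst|exact: cf].
apply: cx_inj; rewrite !cpartE -!rintZ//.
- rewrite -mulN1r -rintZ; last exact: cM.
  rewrite -rintD; [|exact: cM|by apply: (cM); exact: cM].
  by congr rint; apply/funext => t; rewrite /= !cpartE; ring.
- rewrite -rintD; [|exact: cM|exact: cM].
  by congr rint; apply/funext => t; rewrite /= !cpartE; ring.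
Qed.

Lemma cint_cst (a : C) : cint (fun=> a) = a.
Proof. by apply: cx_inj; rewrite !cpartE [LHS]rint_cst. Qed.

(** The factor 2 comes from bounding the real and imaginary parts separately. *)
Lemma cint_le phi (M : R) : continuous phi -> (forall t, cnorm (phi t) <= M) ->
  cnorm (cint phi) <= 2 * M.
Proof.
move=> cp pM; rewrite (le_trans (cnorm_le _))// mulr_natl mulr2n; apply: lerD.
  apply: rint_le; first exact: continuous_cre.
  by move=> t; rewrite (le_trans (cre_le _))//.
apply: rint_le; first exact: continuous_cim.
by move=> t; rewrite (le_trans (cim_le _))//.
Qed.

Lemma cint_derive_eq0 phi psi : (forall t, cder phi t (psi t)) -> continuous psi ->
  phi 0 = phi (pi *+ 2) -> cint psi = 0.
Proof.
move=> dp cp p0; apply: cx_inj; rewrite cpartE.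
- apply: (@rint_derive_eq0 (cre \o phi)); [|exact: continuous_cre|by rewrite /= p0].
  by move=> t; case: (dp t).
- apply: (@rint_derive_eq0 (cim \o phi)); [|exact: continuous_cim|by rewrite /= p0].
  by move=> t; case: (dp t).
Qed.

Lemma cint_param_eq (g g' : R -> R -> C) (u v M : R) :
  (forall l, u < l < v -> continuous (g l)) ->
  (forall l, u < l < v -> forall t, cder (g ^~ t) l (g' l t)) ->
  (forall l, u < l < v -> forall t, cnorm (g' l t) <= M) ->
  (forall l, u < l < v -> cint (g' l) = 0) ->
  forall a b, u < a < v -> u < b < v -> cint (g a) = cint (g b).
Proof.
move=> cg dg gM g0 a b auv buv; congr cx.
- apply: (@rint_param_eq (fun l t => cre (g l t)) (fun l t => cre (g' l t)) u v M) => // l luv.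
  + by apply: continuous_cre; exact: cg.
  + by move=> t; case: (dg l luv t).
  + by move=> t; rewrite (le_trans (cre_le _))// gM.
  + by have /(congr1 cre) := g0 l luv.
- apply: (@rint_param_eq (fun l t => cim (g l t)) (fun l t => cim (g' l t)) u v M) => // l luv.
  + by apply: continuous_cim; exact: cg.
  + by move=> t; case: (dg l luv t).
  + by move=> t; rewrite (le_trans (cim_le _))// gM.
  + by have /(congr1 cim) := g0 l luv.
Qed.

End CircleIntegral.

Section ContinuousAt.
Context {R : realType} {T : topologicalType}.
Local Notation C := (Cx R).
Implicit Types (F G : T -> C) (z : T).

Lemma contD F G z : {for z, continuous F} -> {for z, continuous G} ->
  {for z, continuous (fun w => F w + G w)}.
Proof. exact: continuousD. Qed.
Lemma contN F z : {for z, continuous F} -> {for z, continuous (fun w => - F w)}.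
Proof. exact: continuousN. Qed.
Lemma contM F G z : {for z, continuous F} -> {for z, continuous G} ->
  {for z, continuous (fun w => F w * G w)}.
Proof. exact: continuousM. Qed.
Lemma contV F z : F z != 0 -> {for z, continuous F} -> {for z, continuous (fun w => (F w)^-1)}.
Proof. exact: continuousV. Qed.
Lemma contX F n z : {for z, continuous F} -> {for z, continuous (fun w => F w ^+ n)}.
Proof.
move=> cF; elim: n => [|n IH]; first by apply: cvg_cst; exact: nbhs_filter.
rewrite (_ : (fun w => F w ^+ n.+1) = fun w => F w * F w ^+ n); first exact: contM.
by apply/funext => w; rewrite exprS.
Qed.
Lemma cont_cst (a : C) z : {for z, continuous (fun=> a)}.
Proof. by apply: cvg_cst; exact: nbhs_filter. Qed.
Lemma cont_near F G z : (\forall w \near z, F w = G w) ->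
  {for z, continuous F} -> {for z, continuous G}.
Proof.
move=> FG cF; have Ez := nbhs_singleton FG.
suff : G w @[w --> z] --> G z by [].
rewrite -Ez; apply: cvg_trans cF => A; rewrite /nbhs/= => FA.
by apply: filterS2 FG FA => w /= ->.
Qed.
Lemma cont_comp (S : topologicalType) (f : S -> T) F (x : S) : {for x, continuous f} ->
  {for f x, continuous F} -> {for x, continuous (fun y => F (f y))}.
Proof. exact: continuous_comp. Qed.
Lemma cont_conj F z : {for z, continuous F} -> {for z, continuous (fun w => cconj (F w))}.
Proof. by move=> cF; apply: (@cvg_cconj _ _ _ (nbhs_filter z)). Qed.

End ContinuousAt.

Section ComplexDerivative.
Context {R : realType}.
Local Notation C := (Cx R).
Implicit Types (z w d : C) (F G : C -> C).

Definition cd F z d := is_derive (z : C) (1 : C) F d.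

Lemma cdP F z d : cd F z d <-> forall e : R, 0 < e -> exists2 r : R, 0 < r &
  forall h, cnorm h < r -> cnorm (F (h + z) - F z - d * h) <= e * cnorm h.
Proof.
have E : (fun h : C => h^-1 * (F (h + z) - F z)) =
   (fun h : C => h^-1 *: (F (h *: (1 : C) + z) - F z)).
  by apply/funext => h; rewrite /GRing.scale/= mulr1.
have Q' (d' : C) h : h != 0 -> cnorm (h^-1 * (F (h + z) - F z) - d') =
    cnorm (F (h + z) - F z - d' * h) / cnorm h.
  move=> h0; rewrite -cnormV -cnormM mulrBl mulfK// [in RHS]mulrC//.
split=> [[dF <-] e e0|H].
  have : (fun h : C => h^-1 * (F (h + z) - F z)) @ (0 : C)^' --> 'D_1 F z by rewrite E.
  move=> /cvg_cxP/(_ _ e0); rewrite /dnbhs /within/= => /nbhs_cx[r r0 rP].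
  exists r => // h hr; have [->|h0] := eqVneq h 0.
    by rewrite add0r subrr mulr0 subrr cnorm0 mulr0.
  have := rP h; rewrite /cball/= subr0 => /(_ hr h0).
  by rewrite (Q' _ h h0) ltr_pdivrMr ?cnorm_gt0// => /ltW.
have : (fun h : C => h^-1 * (F (h + z) - F z)) @ (0 : C)^' --> d.
  apply/cvg_cxP => e e0; have e2 : 0 < e / 2 by rewrite divr_gt0.
  have [r r0 rP] := H _ e2; apply/nbhs_cx; exists r => // h; rewrite /cball/= subr0 => hr h0.
  rewrite (Q' _ h h0) ltr_pdivrMr ?cnorm_gt0// (le_lt_trans (rP _ hr))//.
  by rewrite ltr_pM2r ?cnorm_gt0// ltr_pdivrMr// ltr_pMr// ltrDl.
rewrite E => Fd; split; first by apply/cvg_ex; exists d.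
by apply: cvg_lim.
Qed.

Lemma cd_unique F z d d' : cd F z d -> cd F z d' -> d = d'.
Proof. by move=> [_ <-] [_ <-]. Qed.

Lemma cdD F G z d d' : cd F z d -> cd G z d' -> cd (fun w => F w + G w) z (d + d').
Proof. by move=> dF dG; exact: is_deriveD. Qed.
Lemma cdN F z d : cd F z d -> cd (fun w => - F w) z (- d).
Proof. by move=> dF; exact: is_deriveN. Qed.
Lemma cdM F G z d d' : cd F z d -> cd G z d' ->
  cd (fun w => F w * G w) z (d * G z + F z * d').
Proof.
move=> dF dG; apply: is_derive_eq (is_deriveM dF dG) _.
by rewrite /GRing.scale/=; ring.
Qed.
Lemma cd_cst (a : C) z : cd (fun=> a) z 0.
Proof. exact: is_derive_cst. Qed.
Lemma cd_id z : cd id z 1.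
Proof. exact: is_derive_id. Qed.
Lemma cdZ (a : C) F z d : cd F z d -> cd (fun w => a * F w) z (a * d).
Proof.
by move=> dF; have := cdM (cd_cst a z) dF; rewrite mul0r add0r.
Qed.
Lemma cdV F z d : F z != 0 -> cd F z d -> cd (fun w => (F w)^-1) z (- d / F z ^+ 2).
Proof.
move=> F0 [dF <-]; split; first exact: derivableV.
by rewrite deriveV// /GRing.scale/= mulNr mulNr mulrC.
Qed.
Lemma cdX F z d n : cd F z d -> cd (fun w => F w ^+ n) z (n%:R * F z ^+ n.-1 * d).
Proof.
move=> dF; elim: n => [|n IH]; first by rewrite /= !mul0r; exact: cd_cst.
rewrite (_ : (fun w => F w ^+ n.+1) = fun w => F w * F w ^+ n); last first.
  by apply/funext => w; rewrite exprS.
apply: is_derive_eq (cdM dF IH) _.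
by case: n {IH} => [|n] /=; rewrite ?expr0 -?natr1 ?exprS; ring.
Qed.
Lemma cd_near F G z d : (\forall w \near z, F w = G w) -> cd F z d -> cd G z d.
Proof. exact: near_eq_is_derive. Qed.

Lemma cd_continuous F z d : cd F z d -> {for z, continuous F}.
Proof.
by move=> [dF _]; apply: differentiable_continuous; exact/derivable1_diffP.
Qed.

Lemma cd_shift F z c d : cd F (c + z) d -> cd (fun w => F (c + w)) z d.
Proof.
move=> /cdP dF; apply/cdP => e /dF[r r0 rP]; exists r => // h /rP.
by rewrite addrCA.
Qed.

Lemma cd_conj F z d : cd F (cconj z) d -> cd (fun w => cconj (F (cconj w))) z (cconj d).
Proof.
move=> /cdP dF; apply/cdP => e /dF[r r0 rP]; exists r => // h.
rewrite -cnormJ => /rP; rewrite -cnormJ !cconjB !cconjM !cconjK cconjD.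
by rewrite -[X in _ -> cnorm X <= _]/(_ - _ - _) .
Qed.

(** Continuity of the derivative is part of the notion, so that Cauchy's formula follows by
    differentiation under the integral. Stem functions are C^1, hence supply it, and [hol_derive]
    shows that derivation preserves it. *)
Definition hol_at F z := derivable F z (1 : C) /\ {for z, continuous (fun w => 'D_(1 : C) F w)}.
Definition hol (U : set C) F := forall z, U z -> hol_at F z.

Lemma hol_cd U F z : hol U F -> U z -> cd F z ('D_1 F z).
Proof. by move=> hF /hF[dF _]; exact: derivableP. Qed.

Lemma hol_build (U : set C) F (F' : C -> C) : open U -> (forall z, U z -> cd F z (F' z)) ->
  (forall z, U z -> {for z, continuous F'}) -> hol U F.
Proof.
move=> oU dF cF z Uz; split; first by case: (dF z Uz).
have E : \forall w \near z, 'D_1 F w = F' w.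
  have : nbhs z U by apply: open_nbhs_nbhs; split.
  by apply: filterS => w /dF[].
have Ez : 'D_1 F z = F' z by case: (dF z Uz).
by apply: cont_near (cF z Uz); apply: filterS E => w ->.
Qed.

Lemma hol_near F G z : (\forall w \near z, F w = G w) -> hol_at F z -> hol_at G z.
Proof.
move=> FG [dF cF]; split; first exact: near_eq_derivable dF.
have E : \forall w \near z, 'D_(1 : C) F w = 'D_1 G w.
  by have := near_join FG; apply: filterS => w; exact: near_eq_derive.
exact: cont_near cF.
Qed.

Lemma eq_hol U F G : open U -> {in U, F =1 G} -> hol U F -> hol U G.
Proof.
move=> oU FG hF z Uz; apply: hol_near (hF z Uz).
have : nbhs z U by apply: open_nbhs_nbhs; split.
by apply: filterS => w /mem_set/FG.
Qed.

Lemma subset_hol U V F : U `<=` V -> hol V F -> hol U F.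
Proof. by move=> UV hF z /UV/hF. Qed.

Lemma hol_continuous U F z : hol U F -> U z -> {for z, continuous F}.
Proof. by move=> hF Uz; exact: cd_continuous (hol_cd hF Uz). Qed.

Section Closure.
Variable U : set C.
Hypothesis oU : open U.
Let hc := hol_continuous.

Lemma hol_cst (a : C) : hol U (fun=> a).
Proof. by apply: (@hol_build U _ (fun=> 0) oU) => z _; [exact: cd_cst|exact: cont_cst]. Qed.

Lemma hol_id : hol U id.
Proof. by apply: (@hol_build U _ (fun=> 1) oU) => z _; [exact: cd_id|exact: cont_cst]. Qed.

Lemma holD F G : hol U F -> hol U G -> hol U (fun z => F z + G z).
Proof.
move=> hF hG; apply: (@hol_build U _ (fun z => 'D_1 F z + 'D_1 G z) oU) => z Uz.
  by apply: cdD; exact: hol_cd Uz.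
by apply: contD; [case: (hF z Uz)|case: (hG z Uz)].
Qed.

Lemma holN F : hol U F -> hol U (fun z => - F z).
Proof.
move=> hF; apply: (@hol_build U _ (fun z => - 'D_1 F z) oU) => z Uz.
  by apply: cdN; exact: hol_cd Uz.
by apply: contN; case: (hF z Uz).
Qed.

Lemma holM F G : hol U F -> hol U G -> hol U (fun z => F z * G z).
Proof.
move=> hF hG; apply: (@hol_build U _ (fun z => 'D_1 F z * G z + F z * 'D_1 G z) oU) => z Uz.
  by apply: cdM; exact: hol_cd Uz.
apply: contD; apply: contM; [by case: (hF z Uz)|exact: hc Uz|exact: hc Uz|by case: (hG z Uz)].
Qed.

Lemma holX F n : hol U F -> hol U (fun z => F z ^+ n).
Proof.
move=> hF; elim: n => [|n IH]; first exact: hol_cst.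
by under [X in hol U X]eq_fun do rewrite exprS; exact: holM.
Qed.

Lemma holV F : (forall z, U z -> F z != 0) -> hol U F -> hol U (fun z => (F z)^-1).
Proof.
move=> F0 hF; apply: (@hol_build U _ (fun z => - 'D_1 F z / F z ^+ 2) oU) => z Uz.
  by apply: cdV; [exact: F0|exact: hol_cd Uz].
apply: contM; first by apply: contN; case: (hF z Uz).
by apply: contV; [rewrite expf_neq0// F0|exact: hc (holX 2 hF) Uz].
Qed.

Lemma holXz F (n : int) : (forall z, U z -> F z != 0) -> hol U F -> hol U (fun z => F z ^ n).
Proof.
move=> F0 hF; case: n => n; first exact: holX.
by rewrite NegzE; apply: holV; [move=> z Uz; rewrite expf_neq0// F0|exact: holX].
Qed.

Lemma hol_prod (I : Type) (s : seq I) (P : pred I) (F : I -> C -> C) :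
  (forall i, P i -> hol U (F i)) -> hol U (fun z => \prod_(i <- s | P i) F i z).
Proof.
move=> hF; elim: s => [|i s IH].
  by rewrite (_ : (fun z => _) = fun=> 1); [exact: hol_cst|apply/funext => z; rewrite big_nil].
have [Pi|Pi] := boolP (P i).
  rewrite (_ : (fun z => _) = fun z => F i z * \prod_(j <- s | P j) F j z).
    exact: (holM (hF i Pi) IH).
  by apply/funext => z; rewrite big_cons Pi.
rewrite (_ : (fun z => _) = fun z => \prod_(j <- s | P j) F j z)//.
by apply/funext => z; rewrite big_cons (negbTE Pi).
Qed.

End Closure.

Lemma hol_shift U F c : open U -> hol U F ->
  hol [set w | U (c + w)] (fun w => F (c + w)).
Proof.
move=> oU hF; have cs z : {for z, continuous (fun w : C => c + w)}.
  by apply: contD; [exact: cont_cst|exact: cvg_id].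
apply: (@hol_build _ _ (fun w => 'D_1 F (c + w))).
- by apply: open_comp => // z _; exact: cs.
- by move=> z /= Uz; apply: cd_shift; exact: hol_cd Uz.
- move=> z Uz; have [_ cF] := hF _ Uz.
  exact: (@cont_comp R C C (fun w : C => c + w) (fun w : C => 'D_(1 : C) F w) z (cs z) cF).
Qed.

Lemma hol_conj U F : open U -> hol U F ->
  hol [set w | U (cconj w)] (fun w => cconj (F (cconj w))).
Proof.
move=> oU hF; have cJ : continuous (@cconj R) by move=> z; exact: (@cvg_cconj _ _ _ (nbhs_filter z) id).
apply: (@hol_build _ _ (fun w => cconj ('D_1 F (cconj w)))).
- exact: open_comp.
- by move=> z /= Uz; apply: cd_conj; exact: hol_cd Uz.
- move=> z Uz; have [_ cF] := hF _ Uz.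
  exact: (cont_conj (@cont_comp R C C (@cconj R) (fun w : C => 'D_(1 : C) F w) z (cJ z) cF)).
Qed.

Lemma cdisc_bounded F (r : R) : (forall z, cnorm z <= r -> {for z, continuous F}) ->
  exists2 M : R, 0 <= M & forall z, cnorm z <= r -> cnorm (F z) <= M.
Proof.
move=> cF; have [r0|r0] := ltP r 0.
  by exists 0 => // z zr; have := le_lt_trans zr r0; rewrite ltNge cnorm_ge0.
have [||c _ cM] := compact_EVT_max _ (@compact_cdisc R r) (f := fun z => cnorm (F z)).
- by exists (0 : C); rewrite /cdisc /mkset cnorm0.
- apply: continuous_in_subspaceT => z; rewrite inE => zr.
  by apply: (@cvg_cnorm _ _ _ (nbhs_filter z)); exact: cF.
- exists (cnorm (F c)); first exact: cnorm_ge0.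
  by move=> z zr; apply: cM; rewrite inE.
Qed.

End ComplexDerivative.

Lemma le0_geometric (R : realType) (x K t : R) : 0 <= t < 1 ->
  (forall N, x <= K * t ^+ N) -> x <= 0.
Proof.
move=> /andP[t0 t1] xN; have t1' : `|t| < 1 by rewrite ger0_norm.
have /cvgP cg := cvg_geometric K t1'; have lg := cvg_lim (@Rhausdorff R) (cvg_geometric K t1').
rewrite -lg; apply: limr_ge => //; apply: nearW => N; exact: xN.
Qed.

(** * Cauchy's formula and power series *)

Section CauchyFormula.
Context {R : realType}.
Local Notation C := (Cx R).
Implicit Types (z w : C) (F : C -> C) (phi : R -> C).

Lemma cder_cx (t : R) : cder (fun s => cx s 0) t (1 : C).
Proof. by split; rewrite !cpartE; [exact: is_derive_id|exact: is_derive_cst]. Qed.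

Variable r : R.
Hypothesis r0 : 0 < r.

Definition circ (t : R) : C := cx r 0 * expi t.
Definition icirc (t : R) : C := (circ t)^-1.
(** With zeta = [circ] t this is zeta / (zeta - w), the Cauchy kernel for the normalized measure on
    the circle. *)
Definition kap w t : C := (1 - icirc t * w)^-1.

Lemma cnorm_circ t : cnorm (circ t) = r.
Proof. by rewrite cnormM cnorm_real cnorm_expi mulr1 gtr0_norm. Qed.

Lemma circ_neq0 t : circ t != 0.
Proof. by rewrite -cnorm_gt0 cnorm_circ. Qed.

Lemma cnorm_icirc t : cnorm (icirc t) = r^-1.
Proof. by rewrite cnormV cnorm_circ. Qed.

Lemma cder_circ t : cder circ t (cx 0 1 * circ t).
Proof.
rewrite /circ mulrCA; apply: (@cder_comp R (fun z => cx r 0 * z) expi).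
  by have := cdZ (cx r 0) (cd_id (expi t)); rewrite mulr1.
exact: cder_expi.
Qed.

Lemma continuous_circ : continuous circ.
Proof. by move=> t; exact: cder_continuous (cder_circ t). Qed.

Lemma continuous_icirc : continuous icirc.
Proof. by move=> t; apply: contV; [exact: circ_neq0|exact: continuous_circ]. Qed.

Lemma circ_period : circ (pi *+ 2) = circ 0.
Proof. by rewrite /circ expi_period. Qed.

Lemma kap_ge w t : 1 - cnorm w / r <= cnorm (1 - icirc t * w).
Proof.
have := cdist_trans (icirc t * w) 1 0; rewrite !subr0 cnorm1 cnormM cnorm_icirc.
by rewrite mulrC; lra.
Qed.

Lemma ltr_cnorm w : cnorm w < r -> 0 < 1 - cnorm w / r.
Proof. by move=> wr; rewrite subr_gt0 ltr_pdivrMr// mul1r. Qed.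

Lemma kap_neq0 w t : cnorm w < r -> 1 - icirc t * w != 0.
Proof. by move=> wr; rewrite -cnorm_gt0 (lt_le_trans (ltr_cnorm wr))// kap_ge. Qed.

Lemma kap_le w t : cnorm w < r -> cnorm (kap w t) <= (1 - cnorm w / r)^-1.
Proof.
move=> wr; rewrite cnormV lef_pV2 ?posrE ?cnorm_gt0 ?kap_neq0// ?kap_ge//.
exact: ltr_cnorm.
Qed.

Lemma continuous_kap w : cnorm w < r -> continuous (kap w).
Proof.
move=> wr t; apply: (@contV R R (fun t => 1 - icirc t * w)); first exact: kap_neq0.
apply: (@contD R R (fun=> 1) (fun t => - (icirc t * w))); first exact: cont_cst.
apply: (@contN R R (fun t => icirc t * w)).
by apply: (@contM R R icirc (fun=> w)); [exact: continuous_icirc|exact: cont_cst].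
Qed.

Lemma kap_series w t N : cnorm w < r ->
  kap w t = \sum_(n < N) icirc t ^+ n * w ^+ n + w ^+ N * (icirc t ^+ N * kap w t).
Proof.
move=> wr; have k0 := kap_neq0 t wr.
elim: N => [|N IH]; first by rewrite big_ord0 !expr0 !mul1r add0r.
rewrite {1}IH big_ord_recr/= -addrA; congr (_ + _); rewrite /kap !exprS.
by apply: (mulIf k0); rewrite mulrDl -!mulrA mulVf//; ring.
Qed.

(** zeta^(-n) is the t-derivative of the periodic function - zeta^(-n) / (n i). *)
Lemma cint_icirc n : (0 < n)%N -> cint (fun t => icirc t ^+ n) = 0.
Proof.
move=> n0; have nC : (n%:R : C) != 0 by rewrite pnatr_eq0 -lt0n.
have iC : (cx 0 1 : C) != 0 by rewrite -cnorm_gt0 /cnorm/= expr0n add0r expr1n sqrtr1.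
pose c : C := - (n%:R * cx 0 1)^-1.
apply: (@cint_derive_eq0 _ (fun t => c * icirc t ^+ n)).
- move=> t; have D := cdZ c (cdX n (@cdV R id (circ t) 1 (circ_neq0 t) (cd_id _))).
  have := cder_comp D (cder_circ t); congr (cder _ _ _).
  rewrite /c /icirc; case: n n0 nC {c D} => // n _ nC; rewrite [RHS]exprS [_.+1.-1]/=.
  have c0 := circ_neq0 t; field; rewrite c0 iC/= addrC natr1; exact: nC.
- by move=> t; apply: contX; exact: continuous_icirc.
- by rewrite /icirc circ_period.
Qed.

Lemma cont_sum (I : Type) (s : seq I) (f : I -> R -> C) :
  (forall i, continuous (f i)) -> continuous (fun t => \sum_(i <- s) f i t).
Proof.
move=> cf; elim: s => [|i s IH] t.
  rewrite (_ : (fun _ => _) = fun=> 0); first exact: cont_cst.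
  by apply/funext => ?; rewrite big_nil.
rewrite (_ : (fun _ => _) = fun t => f i t + \sum_(i <- s) f i t).
  by apply: contD; [exact: cf|exact: IH].
by apply/funext => ?; rewrite big_cons.
Qed.

Lemma cint_sum (I : Type) (s : seq I) (f : I -> R -> C) : (forall i, continuous (f i)) ->
  cint (fun t => \sum_(i <- s) f i t) = \sum_(i <- s) cint (f i).
Proof.
move=> cf; elim: s => [|i s IH].
  rewrite big_nil -[RHS](cint_cst 0); congr cint.
  by apply/funext => ?; rewrite big_nil.
rewrite big_cons -IH -cintD//; last exact: cont_sum.
by congr cint; apply/funext => ?; rewrite big_cons.
Qed.

Lemma continuousCM phi psi : continuous phi -> continuous psi ->
  continuous (fun t => phi t * psi t : C).
Proof. by move=> c1 c2 t; apply: contM; [exact: c1|exact: c2]. Qed.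

Lemma continuousCX phi n : continuous phi -> continuous (fun t => phi t ^+ n : C).
Proof. by move=> c1 t; apply: contX; exact: c1. Qed.

Lemma cont_mul_icirc phi n : continuous phi -> continuous (fun t => phi t * icirc t ^+ n : C).
Proof. by move=> cp; exact: (@continuousCM phi _ cp (@continuousCX icirc n continuous_icirc)). Qed.

Lemma cont_mul_kap phi n w : continuous phi -> cnorm w < r ->
  continuous (fun t => phi t * icirc t ^+ n * kap w t : C).
Proof. by move=> cp wr; exact: (@continuousCM (fun t => phi t * icirc t ^+ n) (kap w) (@cont_mul_icirc phi n cp) (@continuous_kap w wr)). Qed.

Lemma contZ (a : C) phi : continuous phi -> continuous (fun t => a * phi t : C).
Proof. by move=> cp t; apply: (@contM R R (fun=> a) phi); [exact: cont_cst|exact: cp]. Qed.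

(** [coef] and [tail] are the Taylor coefficients of the Cauchy integral [tail phi 0] and its exact
    remainders, divided by w^n. *)
Definition coef phi n : C := cint (fun t => phi t * icirc t ^+ n).
Definition tail phi n w : C := cint (fun t => phi t * icirc t ^+ n * kap w t).

Lemma tail_series phi N w : continuous phi -> cnorm w < r ->
  tail phi 0 w = \sum_(n < N) coef phi n * w ^+ n + w ^+ N * tail phi N w.
Proof.
move=> cp wr; have cn n := @cont_mul_icirc phi n cp.
have cz n : continuous (fun t => w ^+ n * (phi t * icirc t ^+ n)) by exact: (@contZ (w ^+ n) _ (cn n)).
have ct := @cont_mul_kap phi N w cp wr.
rewrite /tail -(@cintZ R (w ^+ N) _ ct) (eq_bigr (fun n : 'I_N =>
  cint (fun t => w ^+ n * (phi t * icirc t ^+ n)))); last first.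
  by move=> n _; rewrite mulrC (@cintZ R (w ^+ n) _ (cn n)).
rewrite -(@cint_sum _ _ (fun n : 'I_N => _) (fun n : 'I_N => cz n)).
rewrite -(@cintD R _ _ (@cont_sum _ _ _ (fun n : 'I_N => cz n)) (@contZ (w ^+ N) _ ct)).
congr cint; apply/funext => t; rewrite expr0 mulr1 {1}(kap_series t N wr) mulrDr.
by rewrite mulr_sumr; congr (_ + _); [apply: eq_bigr => n _; ring|ring].
Qed.

Lemma tail_le phi n w (M : R) : continuous phi -> (forall t, cnorm (phi t) <= M) ->
  cnorm w < r -> cnorm (tail phi n w) <= 2 * (M * r^-1 ^+ n / (1 - cnorm w / r)).
Proof.
move=> cp pM wr; apply: (@cint_le R _ _ (@cont_mul_kap phi n w cp wr)).
move=> t; rewrite !cnormM cnormX cnorm_icirc; apply: ler_pM; last exact: kap_le.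
- by rewrite mulr_ge0 ?cnorm_ge0// exprn_ge0// invr_ge0 ltW.
- exact: cnorm_ge0.
- by rewrite ler_wpM2r// exprn_ge0// invr_ge0 ltW.
Qed.

(** All coefficients of the constant 1 but the first vanish, and the remainder decreases
    geometrically. *)
Lemma cint_kap w : cnorm w < r -> cint (kap w) = 1.
Proof.
move=> wr; apply/eqP; rewrite -subr_eq0 -cnorm_eq0 eq_le cnorm_ge0 andbT.
have c1 : continuous ((fun=> 1) : R -> C) by move=> t; exact: cont_cst.
have T0 : cint (kap w) = tail ((fun=> 1) : R -> C) 0 w.
  by congr cint; apply/funext => t; rewrite expr0 mulr1 mul1r.
apply: (@le0_geometric _ _ (2 / (1 - cnorm w / r)) (cnorm w / r)).
  by rewrite divr_ge0 ?cnorm_ge0 ?ltW//= -subr_gt0 ltr_cnorm.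
move=> N; have k0 := ltr_cnorm wr.
apply: (@le_trans _ _ (2 / (1 - cnorm w / r) * (cnorm w / r) ^+ N.+1)); last first.
  apply: ler_wpM2l; first by rewrite divr_ge0// ltW.
  apply: ler_wiXn2l => //; first by rewrite divr_ge0 ?cnorm_ge0// ltW.
  by move: k0; rewrite subr_gt0 => /ltW.
rewrite T0.
rewrite (tail_series N.+1 c1 wr) big_ord_recl big1 => [|i _]; last first.
  rewrite /coef (_ : (fun t => _) = fun t => icirc t ^+ (lift ord0 i)); last first.
    by apply/funext => t; rewrite mul1r.
  by rewrite cint_icirc ?mul0r.
rewrite addr0 expr0 mulr1 /coef (_ : (fun t => _) = fun=> 1); last first.
  by apply/funext => t; rewrite expr0 mulr1.
rewrite cint_cst [X in cnorm (X - _)]addrC addrK cnormM cnormX.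
have := @tail_le ((fun=> 1) : R -> C) N.+1 w 1 c1 (fun=> _) wr; rewrite cnorm1 => /(_ (fun=> lexx _)) H.
apply: le_trans (ler_wpM2l _ H) _; first by rewrite exprn_ge0// cnorm_ge0.
by rewrite mul1r expr_div_n exprVn le_eqVlt; apply/orP; left; apply/eqP; ring.
Qed.


(** The circle is contracted to w through the paths p l. The l-derivative of F(p l) times the kernel
    is F'(p l) zeta, which for nonzero l is the t-derivative of F(p l) / (i l). So the mean is
    constant in l: at l = 0 it is F(w), at l = 1 the Cauchy integral. *)
Lemma cauchy_formula F (r' : R) w : r < r' -> hol (cball 0 r') F -> cnorm w < r ->
  F w = tail (F \o circ) 0 w.
Proof.
move=> rr' hF wr.
(* The margin e places 0 and 1 inside an open interval of parameters, on which |p l| <= (1 + 2 e) r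
   = r1, halfway between r and r'. *)
pose e := (r' - r) / (4 * r); pose r1 := (1 + 2 * e) * r.
have e0 : 0 < e by rewrite divr_gt0 ?mulr_gt0// subr_gt0.
have r1r' : r1 < r'.
  have -> : r1 = r + (r' - r) / 2 by rewrite /r1 /e; field; rewrite gt_eqF.
  by have : 0 < r' - r; [rewrite subr_gt0|lra].
have hc z : cnorm z <= r1 -> cball 0 r' z by move=> zr; rewrite /cball/= subr0 (le_lt_trans zr).
have [M M0 dM] : exists2 M : R, 0 <= M & forall z, cnorm z <= r1 -> cnorm ('D_(1 : C) F z) <= M.
  by apply: cdisc_bounded => z /hc Uz; case: (hF z Uz).
pose p (l : R) t : C := w + cx l 0 * (circ t - w).
have pr1 l t : - e < l < 1 + e -> cnorm (p l t) <= r1.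
  move=> /andP[el le1]; rewrite /p (_ : _ + _ = cx (1 - l) 0 * w + cx l 0 * circ t); last first.
    by rewrite (_ : cx (1 - l) 0 = 1 - cx l 0) ?mulrBl ?mulrBr ?mul1r;
      [ring|apply: cx_inj; rewrite !cpartE ?oppr0 ?addr0].
  apply: (le_trans (cnormD _ _)); rewrite (cnormM _ w) (cnormM _ (circ t)) !cnorm_real cnorm_circ.
  have : `|1 - l| * cnorm w <= `|1 - l| * r by rewrite ler_wpM2l// ltW.
  move=> H; apply: (le_trans (lerD H (lexx _))); rewrite -mulrDl ler_wpM2r ?ltW//.
  by case: (ger0P (1 - l)) => ?; case: (ger0P l) => ?; lra.
have cp l : continuous (p l).
  move=> t; apply: (@contD R R (fun=> w) _); first exact: cont_cst.
  apply: (@contM R R (fun=> cx l 0) _); first exact: cont_cst.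
  by apply: (@contD R R circ (fun=> - w)); [exact: continuous_circ|exact: cont_cst].
have cFp l : - e < l < 1 + e -> continuous (F \o p l).
  move=> le t; apply: (cont_comp (cp l t)); apply: (hol_continuous hF); apply: hc.
  exact: pr1.
have cDp l : - e < l < 1 + e -> continuous (fun t => 'D_(1 : C) F (p l t)).
  move=> le t; apply: (@cont_comp R C R (p l) (fun z : C => 'D_(1 : C) F z) t (cp l t)).
  by case: (hF (p l t) (hc _ (pr1 l t le))).
have ck := continuous_kap wr.
have kapE t : (circ t - w) * kap w t = circ t.
  have -> : circ t - w = circ t * (1 - icirc t * w).
    by rewrite mulrBr mulr1 mulrA /icirc divff ?mul1r// circ_neq0.
  by rewrite mulfK// kap_neq0.
have -> : F w = cint (fun t => F (p 0 t) * kap w t).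
  rewrite (_ : (fun t => _) = fun t => F w * kap w t); last first.
    by apply/funext => t; rewrite /p (_ : cx 0 0 = 0)// mul0r addr0.
  by rewrite (@cintZ R (F w) _ ck) cint_kap// mulr1.
have -> : tail (F \o circ) 0 w = cint (fun t => F (p 1 t) * kap w t).
  congr cint; apply/funext => t; rewrite expr0 mulr1 /p (_ : cx 1 0 = 1)// mul1r.
  by rewrite addrC subrK.
apply: (@cint_param_eq R (fun l t => F (p l t) * kap w t)
  (fun l t => 'D_(1 : C) F (p l t) * circ t) (- e) (1 + e) (M * r)).
- by move=> l le; exact: (@continuousCM (F \o p l) (kap w) (cFp l le) ck).
- move=> l le t.
  have dp : cder (fun l => p l t) l (circ t - w).
    have D : cd (fun z => w + z * (circ t - w)) (cx l 0) (circ t - w).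
      apply: is_derive_eq (cdD (cd_cst w _) (cdM (cd_id _) (cd_cst (circ t - w) _))) _.
      by rewrite mul1r mulr0 addr0 add0r.
    by have := @cder_comp R _ (fun s => cx s 0) l _ _ D (cder_cx l); rewrite mulr1.
  have dF := hol_cd hF (hc _ (pr1 l t le)).
  have := @cder_comp R _ (fun l => p l t) l _ _ (cdM dF (cd_cst (kap w t) _)) dp.
  by rewrite mulr0 addr0 -mulrA [X in _ * X]mulrC kapE.
- move=> l le t; rewrite cnormM cnorm_circ; apply: ler_wpM2r; first exact: ltW.
  by apply: dM; exact: pr1.
- move=> l le; have iC : (cx 0 1 : C) != 0.
    by rewrite -cnorm_gt0 /cnorm/= expr0n add0r expr1n sqrtr1.
  have cD := @continuousCM (fun t => 'D_(1 : C) F (p l t)) circ (cDp l le) continuous_circ.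
  (* At l = 0 division by l is impossible, but there F'(p l) is constant and the mean of zeta
     vanishes. *)
  have [l0|l0] := eqVneq l 0.
    apply: (@cint_derive_eq0 _ (fun t => 'D_(1 : C) F w * (cx 0 1)^-1 * circ t)) => //.
    + move=> t; have D := cdZ ('D_(1 : C) F w * (cx 0 1)^-1) (cd_id (circ t)).
      have := cder_comp D (cder_circ t); congr (cder _ _ _).
      by rewrite l0 /p (_ : cx 0 0 = 0)// mul0r addr0; field.
    + by rewrite circ_period.
  have l0' : cx l 0 != 0 by apply: contra_neq l0 => /(congr1 (@cre R)).
  apply: (@cint_derive_eq0 _ (fun t => F (p l t) * (cx 0 1 * cx l 0)^-1)) => //.
  + move=> t; have D : cd (fun z => w + cx l 0 * (z - w)) (circ t) (cx l 0).
      apply: is_derive_eq (cdD (cd_cst w _) (cdZ (cx l 0) (cdD (cd_id _) (cd_cst (- w) _)))) _.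
      by rewrite add0r addr0 mulr1.
    have dp := @cder_comp R _ circ t _ _ D (cder_circ t).
    have dF := hol_cd hF (hc _ (pr1 l t le)).
    have := @cder_comp R _ (fun t => p l t) t _ _ (cdM dF (cd_cst (cx 0 1 * cx l 0)^-1 _)) dp.
    by congr (cder _ _ _); field; rewrite l0' iC.
  + by rewrite /p circ_period.
- by rewrite oppr_lt0 e0 addr_gt0.
- by rewrite (lt_trans _ ltr01) ?oppr_lt0//= ltrDl.
Qed.

End CauchyFormula.

Section CauchyIntegral.
Context {R : realType}.
Local Notation C := (Cx R).
Implicit Types (z w : C) (F : C -> C) (phi : R -> C).

Lemma cnatE n : (n%:R : C) = cx n%:R 0.
Proof. by elim: n => // n IH; rewrite -!natr1 IH; apply: cx_inj; rewrite !cpartE ?addr0. Qed.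

(** The relation between u and v is the resolvent identity of the kernel at w and w + h, with d = h.
    The error is quadratic in d with a constant independent of the angle, as differentiation under
    the integral requires. *)
Lemma resolvent_power (A q : R) (k : nat) : 0 <= A -> 0 <= q ->
  exists2 B : R, 0 <= B & forall u v a d : C, cnorm u <= q -> cnorm v <= q -> cnorm a <= A ->
    v - u = d * a * u * v ->
    cnorm (v ^+ k - u ^+ k - d * (k%:R * a * u ^+ k.+1)) <= B * cnorm d ^+ 2.
Proof.
move=> A0 q0; elim: k => [|k [B B0 IH]].
  by exists 0 => // u v a d *; rewrite !expr0 mulr0n subrr !mul0r mulr0 subrr cnorm0.
exists (q * B + q ^+ k * (A ^+ 2 * q ^+ 3) + k%:R * A ^+ 2 * q ^+ k.+1 * q ^+ 2).
  by rewrite !addr_ge0// ?mulr_ge0// ?exprn_ge0.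
move=> u v a d uq vq aA vu.
have -> : v ^+ k.+1 - u ^+ k.+1 - d * (k.+1%:R * a * u ^+ k.+2) =
    v * (v ^+ k - u ^+ k - d * (k%:R * a * u ^+ k.+1)) + u ^+ k * (d ^+ 2 * a ^+ 2 * u ^+ 2 * v) +
    k%:R * d ^+ 2 * a ^+ 2 * u ^+ k.+1 * (u * v).
  have vE : v = u + d * a * u * v by rewrite -vu addrC subrK.
  rewrite -natr1 (exprS u k.+1) !(exprS _ k).
  have -> : u ^+ k * (d ^+ 2 * a ^+ 2 * u ^+ 2 * v) = u ^+ k * (d * a * u) * (v - u).
    by rewrite vu; ring.
  have -> : k%:R * d ^+ 2 * a ^+ 2 * (u * u ^+ k) * (u * v) =
            k%:R * d * a * (u * u ^+ k) * (v - u) by rewrite vu; ring.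
  have -> : v * (v ^+ k - u ^+ k - d * (k%:R * a * (u * u ^+ k))) =
     v * v ^+ k - u * u ^+ k - (v - u) * u ^+ k - v * (d * (k%:R * a * (u * u ^+ k))) by ring.
  by have -> : (v - u) * u ^+ k = d * a * u * v * u ^+ k; [rewrite vu|ring].
have k0 : cnorm (k%:R : C) = k%:R.
  by rewrite cnatE cnorm_real ger0_norm.
rewrite !mulrDl; apply: (le_trans (cnormD _ _)); apply: lerD.
  apply: (le_trans (cnormD _ _)); apply: lerD; rewrite cnormM.
    rewrite -[leRHS]mulrA; apply: ler_pM; rewrite ?cnorm_ge0//; exact: IH.
  apply: (@le_trans _ _ (cnorm u ^+ k * (cnorm a ^+ 2 * (cnorm u ^+ 2 * cnorm v)) * cnorm d ^+ 2)).
    by rewrite cnormX !cnormM le_eqVlt; apply/orP; left; apply/eqP; ring.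
  apply: ler_wpM2r; first by rewrite exprn_ge0 ?cnorm_ge0.
  rewrite (_ : q ^+ 3 = q ^+ 2 * q); last by ring.
  repeat (apply: ler_pM; rewrite ?mulr_ge0 ?exprn_ge0 ?cnorm_ge0//);
    by rewrite lerXn2r ?nnegrE ?cnorm_ge0.
apply: (@le_trans _ _ (k%:R * cnorm a ^+ 2 * (cnorm u ^+ k.+1 * (cnorm u * cnorm v)) * cnorm d ^+ 2)).
  rewrite !cnormM k0 cnormX le_eqVlt; apply/orP; left; apply/eqP; ring.
apply: ler_wpM2r; first by rewrite exprn_ge0 ?cnorm_ge0.
rewrite -(mulrA (k%:R * A ^+ 2)) expr2.
repeat (apply: ler_pM; rewrite ?mulr_ge0 ?exprn_ge0 ?cnorm_ge0//);
  by rewrite lerXn2r ?nnegrE ?cnorm_ge0.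
Qed.

Variable r : R.
Hypothesis r0 : 0 < r.
Local Notation circ := (circ r).
Local Notation icirc := (icirc r).
Local Notation kap := (kap r).

(** Integrals against powers of the kernel are closed under derivation, phi being multiplied by
    zeta^(-1). *)
Definition cauchyk phi k w : C := cint (fun t => phi t * kap w t ^+ k).

Lemma cont_cauchyk phi k w : continuous phi -> cnorm w < r ->
  continuous (fun t => phi t * kap w t ^+ k : C).
Proof.
move=> cp wr; exact: (@continuousCM _ _ _ cp (@continuousCX _ _ k (continuous_kap r0 wr))).
Qed.

Lemma cd_cauchyk phi k w (M : R) : continuous phi -> (forall t, cnorm (phi t) <= M) ->
  cnorm w < r ->
  cd (cauchyk phi k) w (k%:R * cauchyk (fun t => phi t * icirc t) k.+1 w).
Proof.
move=> cp pM wr; have M0 : 0 <= M by rewrite (le_trans (cnorm_ge0 _) (pM 0)).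
have w0 := cnorm_ge0 w.
pose q : R := (1 - (cnorm w + (r - cnorm w) / 2) / r)^-1.
have qE : 0 < 1 - (cnorm w + (r - cnorm w) / 2) / r.
  by rewrite subr_gt0 ltr_pdivrMr// mul1r; lra.
have kq w' t : cnorm w' <= cnorm w + (r - cnorm w) / 2 -> cnorm (kap w' t) <= q.
  move=> w'r; have w'r' : cnorm w' < r by apply: (le_lt_trans w'r); lra.
  apply: (le_trans (kap_le r0 t w'r')); rewrite lef_pV2 ?posrE//; last first.
    by rewrite subr_gt0 ltr_pdivrMr// mul1r.
  by rewrite lerB// ler_pM2r ?invr_gt0.
have [||B B0 BP] := @resolvent_power r^-1 q k; rewrite ?invr_ge0 ?ltW//.
(* Half the distance to the circle keeps the kernel below [q]; the other bound absorbs 2 M B |h|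
   into e, the 1 guarding against a zero denominator. *)
apply/cdP => e e0; exists (Num.min ((r - cnorm w) / 2) (e / (2 * (M * B) + 1))).
  rewrite lt_min divr_gt0 ?subr_gt0//= divr_gt0// ltr_wpDl// mulr_ge0// mulr_ge0//.
move=> h; rewrite lt_min => /andP[h1 h2].
have hw : cnorm (h + w) <= cnorm w + (r - cnorm w) / 2.
  by rewrite (le_trans (cnormD _ _))// addrC lerD2l ltW.
have hw' : cnorm (h + w) < r by apply: (le_lt_trans hw); lra.
have ca := @continuousCM R phi icirc cp (continuous_icirc r0).
have c1 := @cont_cauchyk _ k _ cp hw'.
have c2 := @contZ R (-1) _ (@cont_cauchyk _ k _ cp wr).
have c3 := @contZ R (- (h * k%:R)) _ (@cont_cauchyk _ k.+1 _ ca wr).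
have c23 : continuous (fun t => -1 * (phi t * kap w t ^+ k) +
    - (h * k%:R) * (phi t * icirc t * kap w t ^+ k.+1) : C).
  by move=> t; exact: (@contD R R _ _ t (c2 t) (c3 t)).
have -> : cauchyk phi k (h + w) - cauchyk phi k w -
    k%:R * cauchyk (fun t => phi t * icirc t) k.+1 w * h =
  cint (fun t => phi t * kap (h + w) t ^+ k + (-1 * (phi t * kap w t ^+ k) +
    - (h * k%:R) * (phi t * icirc t * kap w t ^+ k.+1))).
  rewrite (@cintD R _ _ c1 c23) (@cintD R _ _ c2 c3).
  rewrite (@cintZ R (-1) _ (@cont_cauchyk _ k _ cp wr)).
  rewrite (@cintZ R (- (h * k%:R)) _ (@cont_cauchyk _ k.+1 _ ca wr)).
  rewrite -[X in _ = X + _]/(cauchyk phi k (h + w)).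
  rewrite -[X in _ = _ + (-1 * X + _)]/(cauchyk phi k w).
  rewrite -[X in _ = _ + (_ + - (h * k%:R) * X)]/(cauchyk (fun t => phi t * icirc t) k.+1 w).
  move: (cauchyk phi k (h + w)) (cauchyk phi k w) (cauchyk _ k.+1 w) => x y z; ring.
apply: (@le_trans _ _ (2 * (M * (B * cnorm h ^+ 2)))).
  apply: cint_le; first by move=> t; exact: (@contD R R _ _ t (c1 t) (c23 t)).
  move=> t; rewrite (_ : _ + _ = phi t * (kap (h + w) t ^+ k - kap w t ^+ k -
                          h * (k%:R * icirc t * kap w t ^+ k.+1))); last by ring.
  rewrite cnormM; apply: ler_pM; rewrite ?cnorm_ge0//.
  apply: BP; [|exact: kq| by rewrite cnorm_icirc |].
    by apply: kq; rewrite lerDl; lra.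
  have k1 := kap_neq0 r0 t hw'; have k2 := kap_neq0 r0 t wr.
  by rewrite /kap; field; rewrite k1 k2.
rewrite expr2 !mulrA ler_wpM2r ?cnorm_ge0//.
move: h2; rewrite ltr_pdivlMr ?ltr_wpDl ?mulr_ge0// => h2.
apply: le_trans (ltW h2); rewrite mulrDr mulr1 !mulrA.
have := cnorm_ge0 h; lra.
Qed.

Lemma hol_cauchyk phi k (M : R) : continuous phi -> (forall t, cnorm (phi t) <= M) ->
  hol (cball 0 r) (cauchyk phi k).
Proof.
move=> cp pM; have M0 : 0 <= M by rewrite (le_trans (cnorm_ge0 _) (pM 0)).
have ca := @continuousCM R phi icirc cp (continuous_icirc r0).
have aM t : cnorm (phi t * icirc t) <= M / r.
  by rewrite cnormM cnorm_icirc// ler_wpM2r// invr_ge0 ltW.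
have br w : cball 0 r w -> cnorm w < r by rewrite /cball/= subr0.
apply: (@hol_build R (cball 0 r) _ (fun w => k%:R * cauchyk (fun t => phi t * icirc t) k.+1 w)).
- exact: cball_open.
- by move=> w /br wr; exact: (cd_cauchyk k cp pM wr).
- move=> w /br wr.
  apply: (@contM R C (fun=> k%:R) (cauchyk (fun t => phi t * icirc t) k.+1)); first exact: cont_cst.
  exact: (cd_continuous (cd_cauchyk k.+1 ca aM wr)).
Qed.

Lemma hol_tail phi n (M : R) : continuous phi -> (forall t, cnorm (phi t) <= M) ->
  hol (cball 0 r) (tail r phi n).
Proof.
move=> cp pM; apply: (@hol_cauchyk (fun t => phi t * icirc t ^+ n) 1%N (M * r^-1 ^+ n)).
  exact: (@cont_mul_icirc _ _ r0 phi n cp).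
move=> t; rewrite cnormM cnormX cnorm_icirc// ler_wpM2r// exprn_ge0// invr_ge0 ltW//.
Qed.

Lemma tail0 phi n : tail r phi n 0 = coef r phi n.
Proof.
by congr cint; apply/funext => t; rewrite /kap mulr0 subr0 invr1 mulr1.
Qed.

Lemma circ_bounded F (r' : R) : r < r' -> hol (cball 0 r') F ->
  continuous (F \o circ) /\ exists M : R, forall t, cnorm ((F \o circ) t) <= M.
Proof.
move=> rr' hF; have br z : cnorm z <= r -> cball 0 r' z.
  by move=> zr; rewrite /cball/= subr0 (le_lt_trans zr).
split=> [t|].
  have ct : cnorm (circ t) <= r by rewrite cnorm_circ.
  exact: (@cont_comp R C R circ F t (@continuous_circ R r t) (hol_continuous hF (br _ ct))).
have [M M0 MF] : exists2 M : R, 0 <= M & forall z, cnorm z <= r -> cnorm (F z) <= M.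
  by apply: cdisc_bounded => z /br; exact: hol_continuous.
by exists M => t /=; apply: MF; rewrite cnorm_circ.
Qed.

End CauchyIntegral.

Section LocalExpansion.
Context {R : realType}.
Local Notation C := (Cx R).
Implicit Types (z w : C) (F : C -> C).

Lemma cball_shift z (r : R) : [set w | cball z r (z + w)] = cball 0 r.
Proof. by apply/seteqP; split => w; rewrite /cball/= subr0 addrAC subrr add0r. Qed.

Lemma hol_recenter z (r : R) F : hol (cball z r) F <-> hol (cball 0 r) (fun w => F (z + w)).
Proof.
split=> [hF|hF]; first by rewrite -(cball_shift z); apply: hol_shift => //; exact: cball_open.
have := @hol_shift _ _ _ (- z) (@cball_open R 0 r) hF.
rewrite (_ : [set w | cball 0 r (- z + w)] = cball z r); last first.
  by apply/seteqP; split => w; rewrite /cball/= subr0 addrC.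
by congr (hol _ _); apply/funext => w; rewrite addrA subrr add0r.
Qed.

(** By Cauchy's formula the derivative is locally a [cauchyk] integral of exponent 2, which is again
    holomorphic. *)
Lemma hol_derive (U : set C) F : open U -> hol U F -> hol U ('D_(1 : C) F).
Proof.
move=> oU hF z Uz.
have /nbhs_cx[r' r'0 rU] : nbhs z U by apply: open_nbhs_nbhs; split.
pose r := r' / 2; have r0 : 0 < r by rewrite divr_gt0.
have rr' : r < r' by rewrite ltr_pdivrMr// ltr_pMr// ltr1n.
have hB : hol (cball 0 r') (fun w => F (z + w)).
  exact: ((hol_recenter z r' F).1 (subset_hol rU hF)).
have [cG [M GM]] := circ_bounded r0 rr' hB.
have GE w : cnorm w < r -> F (z + w) = cauchyk r ((fun w => F (z + w)) \o circ r) 1 w.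
  move=> wr; rewrite (cauchy_formula r0 rr' hB wr).
  by congr cint; apply/funext => t; rewrite expr0 mulr1.
have ca := @continuousCM R _ _ cG (continuous_icirc r0).
have aM t : cnorm (((fun w => F (z + w)) \o circ r) t * icirc r t) <= M / r.
  by rewrite cnormM cnorm_icirc// ler_wpM2r// invr_ge0 ltW.
have H := @hol_cauchyk _ _ r0 _ 2 _ ca aM.
set psi := (fun t => _ * icirc r t) in H.
suff : hol (cball z r) ('D_(1 : C) F) by apply; exact: cballxx.
apply/hol_recenter; apply: (@eq_hol _ _ (cauchyk r psi 2)).
- exact: cball_open.
- move=> w /set_mem; rewrite /cball/= subr0 => wr.
  have D := cd_cauchyk r0 1 cG GM wr; rewrite mul1r in D.
  have D' : cd (fun w => F (z + w)) w (cauchyk r psi 2 w).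
    apply: (cd_near _ D); apply/nbhs_cx.
    exists (r - cnorm w); first by rewrite subr_gt0.
    move=> y yw; apply/esym/GE; rewrite /cball/= in yw.
    by have := cdist_trans w y 0; rewrite !subr0; lra.
  apply: (cd_unique D'); apply: cd_shift; apply: (hol_cd hF); apply: rU.
  by rewrite /cball/= addrAC subrr add0r (lt_trans wr).
- exact: H.
Qed.

(** If all Taylor coefficients vanish, the remainder bound forces F = 0. Otherwise let m be the
    first index with a nonzero one: F is (w - z)^m times the remainder of order m, whose value at z
    is that coefficient. *)
Lemma local_factor z (r r' : R) F : 0 < r < r' -> hol (cball z r') F ->
  (forall w, cball z r w -> F w = 0) \/
  exists m h, [/\ hol (cball z r) h, h z != 0 & forall w, cball z r w -> F w = (w - z) ^+ m * h w].
Proof.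
move=> /andP[r0 rr'] hF; have /hol_recenter hB := hF.
have [cG [M GM]] := circ_bounded r0 rr' hB.
set phi := _ \o _ in cG GM.
have M0 : 0 <= M by rewrite (le_trans (cnorm_ge0 _) (GM 0)).
have FE w N : cball z r w -> F w =
    \sum_(n < N) coef r phi n * (w - z) ^+ n + (w - z) ^+ N * tail r phi N (w - z).
  rewrite /cball/= => wr; rewrite -(tail_series r0 _ cG)//.
  by rewrite -(cauchy_formula r0 rr' hB)// addrC subrK.
have [c0|] := pselect (forall n, coef r phi n = 0).
  left=> w wr; have wr' : cnorm (w - z) < r := wr.
  apply/eqP; rewrite -cnorm_eq0 eq_le cnorm_ge0 andbT.
  have t1 := ltr_cnorm r0 wr'.
  apply: (@le0_geometric _ _ (2 * M / (1 - cnorm (w - z) / r)) (cnorm (w - z) / r)).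
    rewrite divr_ge0 ?cnorm_ge0 ?(ltW r0)//=; lra.
  move=> N; rewrite (FE w N wr) big1 => [|n _]; last by rewrite c0 mul0r.
  rewrite add0r cnormM cnormX; have := tail_le r0 N cG GM wr'.
  move=> /(ler_wpM2l (exprn_ge0 N (cnorm_ge0 (w - z)))) H; apply: (le_trans H).
  by rewrite expr_div_n exprVn le_eqVlt; apply/orP; left; apply/eqP; ring.
move=> /existsNP/cid[n0 /eqP n0P]; right.
have ex : exists n, coef r phi n != 0 by exists n0.
case: (ex_minnP ex) => m mP mmin; exists m, (fun w => tail r phi m (w - z)); split.
- apply/hol_recenter; have := hol_tail r0 m cG GM; congr (hol _ _).
  by apply/funext => w; rewrite addrAC subrr add0r.
- by rewrite subrr tail0.
- move=> w /(FE w m) ->; rewrite big1 ?add0r// => n _.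
  case: (eqVneq (coef r phi n) 0) => [->|/mmin]; first by rewrite mul0r.
  by rewrite leqNgt ltn_ord.
Qed.

End LocalExpansion.

(** * Zeros and poles of meromorphic functions *)

Section Meromorphic.
Context {R : realType}.
Local Notation C := (Cx R).
Implicit Types (z w : C) (Phi : C -> C).

(** Applied to [slice_fun], which is 0 at the poles, this excludes zeros and poles alike. *)
Definition good Phi z := (exists2 r : R, 0 < r & hol (cball z r) Phi) /\ Phi z != 0.

(** Nothing is asked at z itself, where Phi may carry a junk value. *)
Definition local_form Phi z (n : int) (h : C -> C) := exists2 r : R, 0 < r &
  hol (cball z r) h /\ forall w, cball z r w -> w != z -> Phi w = (w - z) ^ n * h w.

Definition mero Phi z := exists n h, local_form Phi z n h.
Definition has_ord Phi z n := exists2 h, local_form Phi z n h & h z != 0.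
Definition flat Phi z := exists2 r : R, 0 < r & forall w, cball z r w -> w != z -> Phi w = 0.
Definition isolated Phi z := exists2 r : R, 0 < r &
  forall w, cball z r w -> w != z -> good Phi w.

Lemma cball_sub z w (r s : R) : cnorm (w - z) + s <= r -> cball w s `<=` cball z r.
Proof.
move=> wz y; rewrite /cball/= => yw; have := cdist_trans w y z; lra.
Qed.

Lemma hol_at_neq0 F z : hol_at F z -> F z != 0 -> exists2 r : R, 0 < r &
  forall w, cball z r w -> F w != 0.
Proof.
move=> [dF _] F0; have cF : {for z, continuous F}.
  by apply: differentiable_continuous; exact/derivable1_diffP.
have e0 : 0 < cnorm (F z) by rewrite cnorm_gt0.
have /(@cvg_cxP _ _ _ (nbhs_filter z)) /(_ _ e0) /nbhs_cx[r r0 rP] := cF.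
exists r => // w /rP; apply: contraPneq => ->.
by rewrite sub0r cnormN ltxx.
Qed.

Lemma good_near Phi z : good Phi z -> exists2 r : R, 0 < r &
  forall w, cball z r w -> good Phi w.
Proof.
move=> [[r r0 hP] P0]; have [s s0 sP] := hol_at_neq0 (hP z (cballxx z r0)) P0.
exists (Num.min r s); first by rewrite lt_min r0.
move=> w; rewrite /cball/= lt_min => /andP[wr ws]; split; last exact: sP.
have [d d0 dr] := @cball_in R z r w wr; exists d => //; exact: subset_hol hP.
Qed.

Lemma hol_subz (U : set C) z (n : int) : open U -> (forall w, U w -> w != z) ->
  hol U (fun w => (w - z) ^ n).
Proof.
move=> oU Uz; apply: holXz => //; first by move=> w /Uz; rewrite subr_eq0.
by apply: holD => //; [exact: hol_id|exact: hol_cst].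
Qed.

Lemma mero_dichotomy Phi z : mero Phi z -> flat Phi z \/ exists n, has_ord Phi z n.
Proof.
move=> [n [h [r r0 [hh hP]]]].
have rr : 0 < r / 2 < r by rewrite divr_gt0//= ltr_pdivrMr// ltr_pMr// ltr1n.
have sub : cball z (r / 2) `<=` cball z r by apply: cball_sub; rewrite subrr cnorm0; lra.
have [h0|[m [k [hk k0 kP]]]] := local_factor rr hh.
  left; exists (r / 2); first by case/andP: rr.
  by move=> w wr wz; rewrite hP//; [rewrite h0// mulr0|exact: sub].
right; exists (n + m%:Z), k => //; exists (r / 2); first by case/andP: rr.
split=> // w wr wz; rewrite hP//; last exact: sub.
by rewrite kP// mulrA expfzDr// subr_eq0.
Qed.

Lemma has_ord_isolated Phi z n : has_ord Phi z n -> isolated Phi z.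
Proof.
move=> [h [r r0 [hh hP]] h0].
have [s s0 sP] := hol_at_neq0 (hh z (cballxx z r0)) h0.
exists (Num.min r s); first by rewrite lt_min r0.
move=> w; rewrite /cball/= lt_min => /andP[wr ws] wz.
have wz0 : w - z != 0 by rewrite subr_eq0.
split; last by rewrite hP// mulf_neq0 ?expfz_neq0// sP.
have [d d0 dr] := @cball_in R z r w wr.
have d1 : 0 < Num.min d (cnorm (w - z)) by rewrite lt_min d0 cnorm_gt0.
have nz y : cball w (Num.min d (cnorm (w - z))) y -> y != z.
  by rewrite /cball/= lt_min => /andP[_]; apply: contraTneq => ->; rewrite cdistC ltxx.
exists (Num.min d (cnorm (w - z))) => //.
apply: (@eq_hol _ _ (fun y => (y - z) ^ n * h y)); first exact: cball_open.
  move=> y /set_mem yw; rewrite hP//; last exact: nz.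
  by apply: dr; move: yw; rewrite /cball/= lt_min => /andP[].
apply: holM; first exact: cball_open.
  by apply: hol_subz => //; exact: cball_open.
by apply: subset_hol hh => y; rewrite /cball/= lt_min => /andP[yd _]; exact: dr.
Qed.

Lemma good_isolated Phi z : good Phi z -> isolated Phi z.
Proof. by move=> /good_near[r r0 rP]; exists r => // w wr _; exact: rP. Qed.

Lemma punctured z (r : R) : 0 < r -> exists2 w, cball z r w & w != z.
Proof.
move=> r0; exists (z + cx (r / 2) 0).
  rewrite /cball/= addrAC subrr add0r cnorm_real gtr0_norm ?divr_gt0//.
  by rewrite ltr_pdivrMr// ltr_pMr// ltr1n.
rewrite -subr_eq0 addrAC subrr add0r -cnorm_gt0 cnorm_real normr_gt0.
by rewrite mulf_neq0// ?gt_eqF// invr_gt0.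
Qed.

Lemma isolated_flat Phi z : isolated Phi z -> flat Phi z -> False.
Proof.
move=> [r r0 rP] [s s0 sP].
have [|w] := @punctured z (Num.min r s); first by rewrite lt_min r0.
rewrite /cball/= lt_min => /andP[wr ws] wz.
by have [_] := rP w wr wz; rewrite (sP w ws wz) eqxx.
Qed.

Lemma isolated_near Phi z : isolated Phi z -> \forall w \near z, isolated Phi w.
Proof.
move=> iz; have [r r0 rP] := iz; apply/nbhs_cx; exists r => // w wr.
have [->//|wz] := eqVneq w z; exact/good_isolated/rP.
Qed.

Lemma flat_near Phi z : flat Phi z -> \forall w \near z, flat Phi w.
Proof.
move=> fz; have [r r0 rP] := fz; apply/nbhs_cx; exists r => // w wr.
have [->//|wz] := eqVneq w z; have [d d0 dr] := cball_in wr.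
exists (Num.min d (cnorm (w - z))); first by rewrite lt_min d0 cnorm_gt0 subr_eq0.
move=> y; rewrite /cball/= lt_min => /andP[yd yz] _; apply: rP; first exact: dr.
by apply: contraTneq yz => ->; rewrite cdistC ltxx.
Qed.

(** If n < n', then h - (w - z)^(n' - n) k is nonzero at z, hence near z, and yet it vanishes on a
    punctured ball. *)
Lemma has_ord_unique Phi z n n' : has_ord Phi z n -> has_ord Phi z n' -> n = n'.
Proof.
wlog lnn : n n' / n <= n' => [W o1 o2|].
  by have [le|/ltW le] := leP n n'; [exact: W|apply/esym; exact: W].
move=> [h [r r0 [hh hP]] h0] [k [s s0 [hk kP]] k0].
apply/eqP; rewrite eq_le lnn/= leNgt; apply/negP => lt.
have [p pE] : exists p : nat, n' - n = p.+1%:Z.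
  by exists `|n' - n|%N.-1; rewrite prednK ?absz_gt0 ?subr_eq0 ?gt_eqF// gez0_abs// subr_ge0.
pose d w := h w - (w - z) ^+ p.+1 * k w.
have d0 : d z != 0 by rewrite /d subrr exprS !mul0r subr0.
pose t := Num.min r s; have t0 : 0 < t by rewrite lt_min r0.
have hd : hol (cball z t) d.
  have hk' : hol (cball z t) k.
    by apply: subset_hol hk => w; rewrite /cball/= lt_min => /andP[].
  have hh' : hol (cball z t) h.
    by apply: subset_hol hh => w; rewrite /cball/= lt_min => /andP[].
  have oB := @cball_open R z t.
  apply: (holD oB hh'); apply: (holN oB); apply: (holM oB _ hk'); apply: (holX oB).
  by apply: (holD oB (hol_id oB)); exact: hol_cst.
have [u u0 uP] := hol_at_neq0 (hd z (cballxx z t0)) d0.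
have [|w] := @punctured z (Num.min t u); first by rewrite lt_min t0.
rewrite /cball/= !lt_min -andbA => /and3P[wr ws wu] wz.
have /negP := uP w wu; apply; rewrite /d subr_eq0; apply/eqP.
have wz0 : w - z != 0 by rewrite subr_eq0.
have E : (w - z) ^ n * h w = (w - z) ^ n' * k w by rewrite -hP// -kP.
apply: (@mulfI _ ((w - z) ^ n)); first by rewrite expfz_neq0.
by rewrite E [in RHS]mulrA exprnP -expfzDr// -pE [n + _]addrC subrK.
Qed.

(** An identity theorem: along the segment from 0 to z, [isolated] and [flat] are open, exclusive
    and exhaustive, and [isolated] holds at 0. *)
Lemma mero_isolated Phi (R0 : R) : (forall z, cball 0 R0 z -> mero Phi z) ->
  0 < R0 -> good Phi 0 -> forall z, cball 0 R0 z -> isolated Phi z.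
Proof.
move=> mP R00 g0 z zR.
have D w : cball 0 R0 w -> isolated Phi w \/ flat Phi w.
  by move=> /mP/mero_dichotomy[|[n /has_ord_isolated]]; [right|left].
pose p (t : R) : C := cx t 0 * z.
have cp : continuous p.
  move=> t; apply: (@contM R R (fun t => cx t 0) (fun=> z)); last exact: cont_cst.
  exact: (cder_continuous (cder_cx t)).
have pR t : 0 <= t <= 1 -> cball 0 R0 (p t).
  move=> /andP[t0 t1]; move: zR; rewrite /cball/= !subr0 cnormM cnorm_real ger0_norm//.
  by apply: le_lt_trans; rewrite ler_piMl ?cnorm_ge0.
have K := @segment_connected R 0 1.
pose A : set R := [set t | isolated Phi (p t)].
pose B : set R := [set t | flat Phi (p t)].
have oA : open A.
  rewrite openE => t /isolated_near; exact: (cp t).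
have oB : open B.
  rewrite openE => t /flat_near; exact: (cp t).
have p1 : p 1 = z by rewrite /p (_ : cx 1 0 = 1)// mul1r.
have : `[0, 1]%classic `&` A = `[0, 1]%classic.
  apply: K.
  - exists 0; split; first by rewrite /= in_itv/= lexx ler01.
    by rewrite /A/= /p (_ : cx 0 0 = 0)// mul0r; exact: good_isolated.
  - by exists A.
  - exists (~` B); first exact: open_closedC.
    apply/seteqP; split => t [tI tA]; split => //.
      by move=> tB; exact: isolated_flat tA tB.
    by have := tI; rewrite /= in_itv/= => /pR/D[].
move=> E; have : (`[0, 1]%classic `&` A) 1 by rewrite E /= in_itv/= lexx ler01.
by move=> [_]; rewrite /A/= p1.
Qed.

(** Each point of the disc has a ball in which it is the only possible bad point; by compactness
    finitely many of them cover. *)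
Lemma finite_bad Phi (r : R) : (forall z, cdisc r z -> isolated Phi z) ->
  exists2 s : seq C, uniq s & forall z, (z \in s) <-> cnorm z <= r /\ ~ good Phi z.
Proof.
move=> iso; have := @compact_cdisc R r; rewrite compact_cover.
have rad z : exists d : R, cdisc r z -> 0 < d /\ forall w, cball z d w -> w != z -> good Phi w.
  have [/iso[d d0 dP]|nz] := pselect (cdisc r z); first by exists d.
  by exists 0 => /nz.
have [d dP] := choice rad.
move=> /(_ _ (cdisc r) (fun z => cball z (d z))) [|z zr|D DK DP].
- by move=> z _; exact: cball_open.
- by exists z => //=; apply: cballxx; case: (dP z zr).
have fB : finite_set [set z | cnorm z <= r /\ ~ good Phi z].
  apply: (sub_finite_set _ (finite_fset D)).
  move=> z [zr bz]; have [c /= cD zc] := DP z zr.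
  have [cK] := dP c (set_mem (DK c cD)) .
  have [->//|zc'] := eqVneq z c; by move=> /(_ z zc zc')/bz.
have /finite_seqP[s sE] := fB; exists (undup s); first exact: undup_uniq.
move=> z; rewrite mem_undup; have := congr1 (fun X => X z) sE => /= ->.
by split.
Qed.

Lemma separated_from (I : eqType) (s : seq I) (P : pred I) (f : I -> R) (a : R) :
  (forall i, i \in s -> P i -> a < f i) ->
  exists2 b, a < b & forall i, i \in s -> P i -> b <= f i.
Proof.
elim: s => [|i s IH] H; first by exists (a + 1); rewrite ?ltrDl.
have [|b ab bP] := IH; first by move=> j js; apply: H; rewrite inE js orbT.
have [Pi|Pi] := boolP (P i).
  exists (Num.min b (f i)); first by rewrite lt_min ab H// mem_head.
  move=> j; rewrite inE => /orP[/eqP->|js] Pj; first by rewrite ge_min lexx orbT.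
  by rewrite ge_min bP.
exists b => // j; rewrite inE => /orP[/eqP->|js] Pj; last exact: bP.
by rewrite Pj in Pi.
Qed.

(** The list includes bad points of modulus exactly rho, and still G is zero-free on a larger disc:
    finiteness on the disc of radius R1 leaves an annulus beyond rho without bad points. *)
Theorem zero_free_factor Phi (rho R0 : R) : 0 < rho < R0 ->
  (forall z, cball 0 R0 z -> mero Phi z) -> good Phi 0 ->
  exists (s : seq C) (m : C -> int) (G : C -> C) (R2 : R),
  [/\ uniq s, forall z, (z \in s) <-> cnorm z <= rho /\ ~ good Phi z,
      forall z, z \in s -> has_ord Phi z (m z),
      rho < R2 /\ hol (cball 0 R2) G &
      forall w, cball 0 R2 w -> G w != 0 /\
        (w \notin s -> good Phi w /\ Phi w = (\prod_(z <- s) (w - z) ^ m z) * G w)].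
Proof.
move=> /andP[rho0 rR] mP g0; have R00 := lt_trans rho0 rR.
have iso := mero_isolated mP R00 g0.
pose R1 := (rho + R0) / 2; have rR1 : rho < R1 by rewrite /R1; lra.
have R1R0 : R1 < R0 by rewrite /R1; lra.
have [z|s1 us1 s1P] := @finite_bad Phi R1.
  by move=> zr; apply: iso; rewrite /cball/= subr0 (le_lt_trans zr).
pose s := [seq z <- s1 | cnorm z <= rho].
have sP z : (z \in s) <-> cnorm z <= rho /\ ~ good Phi z.
  rewrite mem_filter; split=> [/andP[zr /s1P[_ bz]]//|[zr bz]].
  by rewrite zr/=; apply/s1P; split => //; rewrite (le_trans zr)// ltW.
have us : uniq s by rewrite filter_uniq.
have [z _|R2' rR2' R2P] := @separated_from C s1 (fun z => ~~ (cnorm z <= rho)) cnorm rho.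
  by rewrite -ltNge.
pose R2 := Num.min R1 R2'.
have goodP w : cball 0 R2 w -> w \notin s -> good Phi w.
  rewrite /cball/= subr0 lt_min => /andP[wR1 wR2] ws; apply: contrapT => bw.
  have [wr|wr] := leP (cnorm w) rho; first by move/negP: ws; apply; apply/sP.
  have w1 : w \in s1 by apply/s1P; split => //; exact: ltW.
  by have := R2P w w1; rewrite -ltNge wr => /(_ isT); rewrite leNgt wR2.
have ordP z : exists nh : int * (C -> C), z \in s -> local_form Phi z nh.1 nh.2 /\ nh.2 z != 0.
  have [/sP[zr _]|//] := boolP (z \in s); last by exists (0, id).
  have zR0 : cball 0 R0 z by rewrite /cball/= subr0 (le_lt_trans zr).
  have [fl|[n [h lf h0]]] := mero_dichotomy (mP z zR0); last by exists (n, h).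
  by have := isolated_flat (iso z zR0) fl.
have [nh nhP] := choice ordP.
pose m z := (nh z).1; pose h z := (nh z).2.
pose Q (P : pred C) w := \prod_(z <- s | P z) (w - z) ^ (- m z).
(* At a point w of s the product of Phi with its own factor is replaced by the local function [h],
   which removes the singularity of the quotient. *)
pose G w := if w \in s then h w w * Q (predC1 w) w else Phi w * Q xpredT w.
exists s, m, G, R2; split => //.
- by move=> z /nhP[lf h0]; exists (h z).
- split; first by rewrite lt_min rR1.
  move=> w wR.
  have [|dd dd0 ddP] := @separated_from C s (predC1 w) (fun z => cnorm (z - w)) 0.
    by move=> z _ /= zw; rewrite cnorm_gt0 subr_eq0.
  have nz (P : pred C) y z : (forall z, P z -> z != w) -> cball w dd y -> z \in s -> P z -> y - z != 0.
    move=> Pw yw zs Pz; rewrite subr_eq0; apply: contraTneq yw => ->.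
    by rewrite /cball/= -leNgt ddP//=; exact: Pw.
  have hQ (P : pred C) (r : R) : 0 < r -> r <= dd -> (forall z, P z -> z != w) -> hol (cball w r) (Q P).
    move=> r0 rdd Pw; rewrite /Q.
    rewrite (_ : (fun _ => _) = fun y => \prod_(z <- s | (z \in s) && P z) (y - z) ^ (- m z)); last first.
      by apply/funext => y; rewrite big_seq_cond.
    apply: hol_prod; first exact: cball_open.
    move=> z /andP[zs Pz]; apply: hol_subz; first exact: cball_open.
    move=> y yw; rewrite -subr_eq0; apply: (nz P) => //.
    exact: (lt_le_trans yw).
  have [ws|ws] := boolP (w \in s).
    have [[r r0 [hh hP]] h0] := nhP w ws.
    pose e := Num.min r dd; have e0 : 0 < e by rewrite lt_min r0.
    have H : hol (cball w e) (fun y => h w y * Q (predC1 w) y).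
      apply: holM; first exact: cball_open.
        by apply: subset_hol hh => y; rewrite /cball/= lt_min => /andP[].
      by apply: hQ => //; rewrite ge_min lexx orbT.
    apply: hol_near (H w (cballxx w e0)); apply/nbhs_cx; exists e => // y.
    rewrite {1}/cball/= lt_min => /andP[yr yd].
    have [->|yw] := eqVneq y w; first by rewrite /G ws.
    have ys : y \notin s.
      by apply: contraTN yd => ys; rewrite -leNgt ddP.
    rewrite /G (negbTE ys) hP// /Q (bigD1_seq w)//= mulrACA.
    rewrite -expfzDr ?subr_eq0// subrr expr0z mul1r//.
  have gw := goodP w wR ws; have [[r r0 hh] P0] := gw.
  pose e := Num.min r dd; have e0 : 0 < e by rewrite lt_min r0.
  have H : hol (cball w e) (fun y => Phi y * Q (mem s) y).
    apply: holM; first exact: cball_open.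
      by apply: subset_hol hh => y; rewrite /cball/= lt_min => /andP[].
    apply: hQ => //; first by rewrite ge_min lexx orbT.
    by move=> z zs; apply: contraNneq ws => <-.
  apply: hol_near (H w (cballxx w e0)); apply/nbhs_cx; exists e => // y.
  rewrite {1}/cball/= lt_min => /andP[yr yd].
  have ys : y \notin s.
    have [->//|yw] := eqVneq y w.
    apply: contraTN yd => ys; rewrite -leNgt ddP//=.
  by rewrite /G (negbTE ys) /Q; congr (_ * _); rewrite [RHS]big_seq.
- move=> w wR.
  have Q0 (P : pred C) : (forall z, z \in s -> P z -> z != w) -> Q P w != 0.
    move=> Pw; rewrite /Q prodf_seq_neq0; apply/allP => z zs; apply/implyP => Pz.
    by rewrite expfz_neq0// subr_eq0 eq_sym Pw.
  split.
    rewrite /G; case: ifPn => ws; last first.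
      rewrite mulf_neq0//; first by case: (goodP w wR ws).
      by apply: Q0 => z zs _; apply: contraNneq ws => <-.
    by rewrite mulf_neq0//; [case: (nhP w ws)|exact: Q0].
  move=> ws; split; first exact: goodP.
  rewrite /G (negbTE ws) mulrCA /Q -big_split big1_seq ?mulr1//= => z zs.
  rewrite -expfzDr ?subrr ?expr0z// subr_eq0.
  by apply: contraNneq ws => ->.
Qed.

End Meromorphic.

(** * The logarithm of the modulus of a zero-free function *)

Section LogModulus.
Context {R : realType}.
Local Notation C := (Cx R).
Implicit Types (z w : C) (G : C -> C).

(** The real part of the logarithmic derivative, obtained from one half of ln (Re^2 + Im^2) without
    a complex logarithm. *)
Lemma is_derive_ln_cnorm (g : R -> C) t d : cder g t d -> g t != 0 ->
  is_derive t (1 : R) (fun s => ln (cnorm (g s))) (cre (d / g t)).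
Proof.
move=> [d1 d2] g0; have N0 : 0 < cnorm (g t) ^+ 2 by rewrite exprn_gt0 ?cnorm_gt0.
have E : (fun s => ln (cnorm (g s))) = (fun s => 2^-1 * ln (cre (g s) * cre (g s) + cim (g s) * cim (g s))).
  apply/funext => s; rewrite -!expr2 -cnorm_sqr; have [->|gs] := eqVneq (g s) 0.
    by rewrite cnorm0 expr0n/= ln0// mulr0.
  by rewrite lnXn ?cnorm_gt0// -[ln _ *+ 2]mulr_natl mulrA mulVf ?mul1r.
rewrite E; pose q s := cre (g s) * cre (g s) + cim (g s) * cim (g s).
have dq : is_derive t (1 : R) q
    (2 * (cre (g t) * cre d + cim (g t) * cim d)).
  apply: is_derive_eq (is_deriveD (is_deriveM d1 d1) (is_deriveM d2 d2)) _.
  by rewrite /GRing.scale/=; ring.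
have q0 : 0 < q t by rewrite /q -!expr2 -cnorm_sqr.
have dl := @is_derive1_comp R (@ln R) q t _ _ (is_derive1_ln q0) dq.
apply: is_derive_eq (is_deriveZ 2^-1 dl) _.
have -> : d / g t = d * cconj (g t) * cx (cnorm (g t) ^+ 2)^-1 0.
  rewrite -mulrA; congr (_ * _); apply: (mulIf g0); rewrite mulVf//.
  apply: cx_inj; rewrite !cpartE cnorm_sqr; field; rewrite gt_eqF//.
rewrite !cpartE cnorm_sqr /GRing.scale/= /q -!expr2; field.
by rewrite gt_eqF// -cnorm_sqr.
Qed.

Lemma cd_sum_powers (c : nat -> C) N z :
  cd (fun w => \sum_(n < N) c n * w ^+ n.+1 / n.+1%:R) z (\sum_(n < N) c n * z ^+ n).
Proof.
elim: N => [|N IH].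
  rewrite big_ord0 (_ : (fun _ => _) = fun=> 0); first exact: cd_cst.
  by apply/funext => w; rewrite big_ord0.
rewrite big_ord_recr/= (_ : (fun _ => _) = fun w =>
    \sum_(n < N) c n * w ^+ n.+1 / n.+1%:R + c N / N.+1%:R * w ^+ N.+1); last first.
  by apply/funext => w; rewrite big_ord_recr/= mulrAC.
apply: is_derive_eq (cdD IH (cdZ (c N / N.+1%:R) (cdX N.+1 (cd_id z)))) _.
congr (_ + _); rewrite /= mulr1.
have nC : (N.+1%:R : C) != 0 by rewrite pnatr_eq0.
by rewrite mulrA divfK.
Qed.

Lemma cre_divn z n : cre (z / n%:R) = cre z / n%:R.
Proof.
have -> : (n%:R : C)^-1 = cx n%:R^-1 0.
  rewrite cnatE; case: n => [|n].
    by rewrite -[cx _ _]/(0 : C) !invr0.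
  have n0 : (cx n.+1%:R 0 : C) != 0 by rewrite -cnatE pnatr_eq0.
  apply: (mulIf n0); rewrite mulVf//; apply: cx_inj; rewrite !cpartE ?mulr0 ?mul0r ?addr0//.
  by rewrite subr0 mulVf// pnatr_eq0.
by rewrite !cpartE mulr0 subr0.
Qed.

(** The c n are the Taylor coefficients of G' / G. Their primitive, with terms w^(n+1) / (n+1), is
    compared with ln |G| by the mean value theorem on the segment from 0 to w. That c 1 is a
    derivative at 0 is recorded for the Laplacian. *)
Lemma ln_cnorm_series G (r R2 : R) : 0 < r < R2 -> hol (cball 0 R2) G ->
  (forall w, cball 0 R2 w -> G w != 0) ->
  exists (c : nat -> C) (M : R), [/\ 0 <= M,
   cd (fun w => 'D_(1 : C) G w / G w) 0 (c 1%N) &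
   forall N w, cnorm w < r ->
   `| ln (cnorm (G w)) - ln (cnorm (G 0)) -
      \sum_(n < N) cre (c n * w ^+ n.+1) / n.+1%:R | <=
    M * cnorm w / (1 - cnorm w / r) * (cnorm w / r) ^+ N].
Proof.
move=> /andP[r0 rR] hG G0.
pose H w := 'D_(1 : C) G w / G w.
have oB := @cball_open R 0 R2.
have hH : hol (cball 0 R2) H.
  by apply: (holM oB); [exact: hol_derive|exact: (holV oB G0 hG)].
have [cG [M GM]] := circ_bounded r0 rR hH.
set phi := _ \o _ in cG GM.
have M0 : 0 <= M by rewrite (le_trans (cnorm_ge0 _) (GM 0)).
have HE N w : cnorm w < r -> H w =
    \sum_(n < N) coef r phi n * w ^+ n + w ^+ N * tail r phi N w.
  by move=> wr; rewrite -(tail_series r0 _ cG)// -(cauchy_formula r0 rR hH).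
exists (coef r phi), (2 * M); split; first by rewrite mulr_ge0.
  have c0 : cball 0 r (0 : C) by exact: cballxx.
  have hT := hol_tail r0 2 cG GM.
  have D := cdD (cd_cst (coef r phi 0) 0) (cdD (cdZ (coef r phi 1) (cd_id (0 : C)))
    (cdM (cdX 2 (cd_id (0 : C))) (hol_cd hT c0))).
  rewrite mulr1 expr1 expr2 !(mulr0, mul0r) !addr0 add0r in D.
  apply: (cd_near _ D); apply/nbhs_cx; exists r => // w; rewrite /cball/= subr0 => wr.
  rewrite -/(H w) (HE 2%N w wr) !big_ord_recl big_ord0/= /bump/= expr0 expr1; ring.
move=> N w wr; have wr' := ltr_cnorm r0 wr.
pose p (t : R) : C := cx t 0 * w.
have pr (t : R) : 0 <= t <= 1 -> cnorm (p t) <= cnorm w.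
  by move=> /andP[t0 t1]; rewrite cnormM cnorm_real ger0_norm// ler_piMl ?cnorm_ge0.
have dp t : cder p t w.
  have D := cdM (cd_id (cx t 0)) (cd_cst w _); rewrite mul1r mulr0 addr0 in D.
  by have := @cder_comp R _ (fun s => cx s 0) t _ _ D (cder_cx t); rewrite mulr1.
pose P z := \sum_(n < N) coef r phi n * z ^+ n.+1 / n.+1%:R.
pose f t := ln (cnorm (G (p t))) - cre (P (p t)).
have df (t : R) : 0 <= t <= 1 -> is_derive t (1 : R) f (cre (p t ^+ N * tail r phi N (p t) * w)).
  move=> t01; have ptr : cnorm (p t) < r by apply: (le_lt_trans (pr _ t01)).
  have pR : cball 0 R2 (p t) by rewrite /cball/= subr0 (lt_trans ptr).
  have d1 := is_derive_ln_cnorm (@cder_comp R _ p t _ _ (hol_cd hG pR) (dp t)) (G0 _ pR).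
  have [d2 _] := @cder_comp R _ p t _ _ (@cd_sum_powers (coef r phi) N (p t)) (dp t).
  apply: is_derive_eq (is_deriveB d1 d2) _.
  rewrite -creN -creD; congr cre.
  have := HE N _ ptr; rewrite /H => HEt.
  by rewrite /= mulrAC HEt; ring.
have [||t tI] := @MVT_segment R f (fun t => cre (p t ^+ N * tail r phi N (p t) * w)) 0 1 ler01.
- by move=> t; rewrite in_itv/= => /andP[/ltW t0 /ltW t1]; apply: df; rewrite t0 t1.
- apply: derivable_within_continuous => t; rewrite in_itv/= => /df[].
  by [].
rewrite subr0 mulr1 /f => fE.
have p1 : p 1 = w by rewrite /p (_ : cx 1 0 = 1)// mul1r.
have p0 : p 0 = 0 by rewrite /p (_ : cx 0 0 = 0)// mul0r.
have P0 : P 0 = 0 by rewrite /P big1// => n _; rewrite exprS mul0r mulr0 mul0r.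
have cP : cre (P w) = \sum_(n < N) cre (coef r phi n * w ^+ n.+1) / n.+1%:R.
  rewrite /P (big_morph _ creD cre0); apply: eq_bigr => n _; exact: cre_divn.
move: fE; rewrite p1 p0 P0 cre0 subr0 cP => E.
rewrite -addrAC E (le_trans (cre_le _))//.
have tI' : 0 <= t <= 1 by move: tI; rewrite in_itv.
have ptr : cnorm (p t) < r by apply: (le_lt_trans (pr _ tI')).
rewrite !cnormM cnormX.
have T := tail_le r0 N cG GM ptr.
have A1 : (1 - cnorm (p t) / r)^-1 <= (1 - cnorm w / r)^-1.
  rewrite lef_pV2 ?posrE//; last exact: ltr_cnorm.
  by rewrite lerB// ler_pM2r ?invr_gt0// pr.
have A2 : cnorm (p t) ^+ N <= cnorm w ^+ N by rewrite lerXn2r ?nnegrE ?cnorm_ge0// pr.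
apply: (@le_trans _ _ (cnorm w ^+ N * (2 * (M * r^-1 ^+ N / (1 - cnorm w / r))) * cnorm w)).
  apply: ler_wpM2r; first exact: cnorm_ge0.
  apply: ler_pM => //; rewrite ?exprn_ge0 ?cnorm_ge0//; apply: (le_trans T).
  by rewrite ler_wpM2l// ler_wpM2l// mulr_ge0// exprn_ge0// invr_ge0 ltW.
by rewrite expr_div_n exprVn le_eqVlt; apply/orP; left; apply/eqP; ring.
Qed.

End LogModulus.

Section HarmonicMean.
Context {R : realType}.
Local Notation C := (Cx R).
Implicit Types (z w : C) (G : C -> C) (y : quat R).

Definition qimn y : R := Num.sqrt (qim1 y ^+ 2 + qim2 y ^+ 2 + qim3 y ^+ 2).
(** The point Re y + i |Im y| of the closed upper half plane that represents the sphere through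
    y. *)
Definition zq y : C := cx (qre y) (qimn y).

Lemma qimn_ge0 y : 0 <= qimn y. Proof. exact: sqrtr_ge0. Qed.

Lemma qimn_sqr y : qimn y ^+ 2 = qim1 y ^+ 2 + qim2 y ^+ 2 + qim3 y ^+ 2.
Proof. by rewrite sqr_sqrtr// !addr_ge0// sqr_ge0. Qed.

Lemma cnorm_zq y : cnorm (zq y) = `|y|.
Proof.
apply/eqP; rewrite -(@eqrXn2 _ 2) ?cnorm_ge0// cnorm_sqr !cpartE qimn_sqr.
by rewrite -[`|y|]/(qnorm y) qnorm_sqr !addrA.
Qed.

Lemma qimnZ (s : R) y : qimn (s *: y) = `|s| * qimn y.
Proof. by rewrite /qimn /= !exprMn -!mulrDr sqrtrM ?sqr_ge0// sqrtr_sqr. Qed.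

Lemma zqZ (s : R) y : zq (s *: y) = if 0 <= s then cx s 0 * zq y else cx s 0 * cconj (zq y).
Proof.
apply: cx_inj; rewrite /zq qimnZ; case: ifPn => s0; rewrite !cpartE /=.
- by rewrite mul0r subr0.
- by rewrite mul0r subr0.
- by rewrite ger0_norm// mul0r addr0.
- by rewrite ltr0_norm ?ltNge// mul0r addr0 mulNr mulrN.
Qed.

(** Since w times its conjugate is rho^2, the real parts of the powers of w obey the three-term
    recurrence of the T_n. *)
Lemma cre_expr (rho : R) w n : 0 < rho -> cnorm w = rho ->
  cre (w ^+ n) = rho ^+ n * (chebT n).[cre w / rho].
Proof.
move=> rho0 wr; have wJ : w * cconj w = cx (rho ^+ 2) 0.
  by apply: cx_inj; rewrite !cpartE -?wr ?cnorm_sqr; ring.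
suff [] : cre (w ^+ n) = rho ^+ n * (chebT n).[cre w / rho] /\
  cre (w ^+ n.+1) = rho ^+ n.+1 * (chebT n.+1).[cre w / rho] by [].
elim: n => [|n [IH1 IH2]].
  rewrite expr0 !expr1 chebTS chebT0 chebV0 mulr1 mulr0 subr0 hornerC hornerX !cpartE expr0 mulr1.
  by split=> //; field; rewrite gt_eqF.
split=> //; have -> : w ^+ n.+2 = w ^+ n.+1 * (w + cconj w) - w ^+ n * (w * cconj w).
  by rewrite !exprS; ring.
rewrite creD creN wJ !creM !cimD !creD !cpartE IH1 IH2 chebT_rec !hornerE /= !exprS.
by field; rewrite gt_eqF.
Qed.

Lemma half_sum_le (a b k : R) : `|a| <= k -> `|b| <= k -> `|2^-1 * a + 2^-1 * b| <= k.
Proof.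
move=> ak bk; have h2 : 0 <= 2^-1 :> R by [].
apply: (le_trans (ler_normD _ _)); rewrite !normrM (ger0_norm h2); lra.
Qed.

(** G is not known to commute with conjugation, so ln |G| is averaged over the two conjugate points
    that represent y. *)
Definition logmean G y : R :=
  2^-1 * (ln (cnorm (G (zq y))) + ln (cnorm (G (cconj (zq y))))).

Lemma logmean0 G : logmean G 0 = ln (cnorm (G 0)).
Proof.
have z0 : zq 0 = 0 by apply: cx_inj; rewrite // !cpartE /qimn /= expr0n/= !addr0 sqrtr0.
by rewrite /logmean z0 cconj0; field.
Qed.

Lemma cre_mulJ (c w : C) : cre (c * w) + cre (c * cconj w) = 2 * cre c * cre w.
Proof. by rewrite !cpartE; ring. Qed.

Lemma cheb_series_measurable (rho : R) (h : quat R -> R) (a : nat -> R) (K t : R) : 0 <= t < 1 ->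
  (forall N y, qsphere rho y ->
    `|h y - a 0%N - \sum_(k < N) a k.+1 * (chebT k.+1).[qdot y 1 / rho]| <= K * t ^+ N) ->
  measurable_fun (qsphere rho) h.
Proof.
move=> /andP[t0 t1] hK.
apply: (@measurable_fun_cvg _ _ _ (qsphere rho)
  (fun N y => a 0%N + \sum_(k < N) a k.+1 * (chebT k.+1).[qdot y 1 / rho])).
- move=> N; apply: measurable_funD => //.
  apply: measurable_sum => k; apply: measurable_funM => //.
  apply: (measurableT_comp (f := fun x : R => (chebT k.+1).[x])).
    by apply: continuous_measurable_fun; exact: continuous_horner.
  by apply: measurable_funM => //; apply: measurable_funTS; exact: measurable_qdot.
- move=> y Sy; apply/cvgrPdist_le => e e0.
  have t1' : `|t| < 1 by rewrite ger0_norm.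
  have /cvgrPdist_le/(_ _ e0) := cvg_geometric K t1'; apply: filterS => N.
  rewrite sub0r normrN => H; apply: le_trans H; rewrite opprD addrA.
  by apply: (le_trans (hK N y Sy)); exact: ler_norm.
Qed.

(** Averaging over conjugates turns Re (c_n w^(n+1)) into Re(c_n) Re(w^(n+1)). The degree 2
    contributions, - rho^2 Re(c 1) / 4 to the mean and -2 Re(c 1) to the Laplacian, cancel in the
    last identity. *)
Lemma logmean_has_mean (rho R2 : R) G : 0 < rho < R2 -> hol (cball 0 R2) G ->
  (forall w, cball 0 R2 w -> G w != 0) ->
  exists A k, [/\ has_mean rho (logmean G) A, has_lap (logmean G) k &
     A - rho ^+ 2 / 8 * k = ln (cnorm (G 0))].
Proof.
(* A radius strictly between rho and R2 provides the rate of convergence rho / r < 1. *)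
move=> /andP[rho0 rR] hG G0; pose r := (rho + R2) / 2.
have rr : 0 < r < R2 by rewrite /r; apply/andP; split; lra.
have rhor : rho < r by rewrite /r; lra.
have r0 : 0 < r by case/andP: rr.
have [c [M [M0 D S]]] := ln_cnorm_series rr hG G0.
pose a n := if n is n'.+1 then cre (c n') * rho ^+ n'.+1 / n'.+1%:R else ln (cnorm (G 0)).
pose K := M * rho / (1 - rho / r).
have t01 : 0 <= rho / r < 1.
  by rewrite divr_ge0 ?ltW//= ltr_pdivrMr// mul1r.
have bound N y : qsphere rho y ->
    `|logmean G y - a 0%N - \sum_(k < N) a k.+1 * (chebT k.+1).[qdot y 1 / rho]| <= K * (rho / r) ^+ N.
  rewrite /qsphere/= => yr; have zr : cnorm (zq y) = rho by rewrite cnorm_zq.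
  have zr' : cnorm (cconj (zq y)) = rho by rewrite cnormJ.
  pose S1 := \sum_(n < N) cre (c n * zq y ^+ n.+1) / n.+1%:R.
  pose S2 := \sum_(n < N) cre (c n * cconj (zq y) ^+ n.+1) / n.+1%:R.
  have := S N (zq y); rewrite zr => /(_ rhor) H1.
  have := S N (cconj (zq y)); rewrite zr' => /(_ rhor) H2.
  rewrite -/S1 in H1; rewrite -/S2 in H2.
  have -> : \sum_(k < N) a k.+1 * (chebT k.+1).[qdot y 1 / rho] = 2^-1 * (S1 + S2).
    rewrite /S1 /S2 -big_split mulr_sumr; apply: eq_bigr => k _.
    rewrite -[RHS]/(2^-1 * (cre (c k * zq y ^+ k.+1) / k.+1%:R + cre (c k * cconj (zq y) ^+ k.+1) / k.+1%:R)).
    rewrite -mulrDl -cconjX cre_mulJ (cre_expr _ rho0 zr).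
    have -> : qdot y 1 = qre y by rewrite /qdot/=; ring.
    rewrite -[cre (zq y)]/(qre y) -[a k.+1]/(cre (c k) * rho ^+ k.+1 / k.+1%:R).
    move: (chebT k.+1).[_] (rho ^+ k.+1) (k.+1%:R^-1) (cre (c k)) => T x d b; by field.
  have -> : logmean G y - a 0%N - 2^-1 * (S1 + S2) =
    2^-1 * (ln (cnorm (G (zq y))) - ln (cnorm (G 0)) - S1) +
    2^-1 * (ln (cnorm (G (cconj (zq y)))) - ln (cnorm (G 0)) - S2) by rewrite /logmean /a; field.
  exact: (half_sum_le H1 H2).
have n1 : `|1 : quat R| = 1 by exact: quat_norm1.
exists (a 0%N - a 2%N / 2), (- (2 * cre (c 1%N))); split.
- apply: (has_mean_cheb_series rho0 n1 _ t01 bound).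
  exact: (cheb_series_measurable t01 bound).
- pose H w := 'D_(1 : C) G w / G w.
  (* The square of [zq] e is 1 for the real axis and -1 for the other three, hence 1 - 3 = -2. *)
  pose kk e := cre (c 1%N) * cre (zq e ^+ 2).
  exists kk; last first.
    rewrite /axes !big_cons big_nil /kk /zq /qimn /= !(expr0n, expr1n, addr0, add0r) /=.
    by rewrite !sqrtr1 sqrtr0; ring.
  move=> e _.
  pose p (u : C) (s : R) : C := cx s 0 * u.
  have dp u t : cder (p u) t u.
    have D' := cdM (cd_id (cx t 0)) (cd_cst u _); rewrite mul1r mulr0 addr0 in D'.
    by have := @cder_comp R _ (fun s => cx s 0) t _ _ D' (cder_cx t); rewrite mulr1.
  have p0 u : p u 0 = 0 by rewrite /p (_ : cx 0 0 = 0)// mul0r.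
  have near u : \forall s \near (0 : R), cball 0 R2 (p u s).
    have : nbhs (p u 0) (cball (0 : C) R2).
      by rewrite p0; apply: nbhs_cball; rewrite (lt_trans rho0).
    exact: (cder_continuous (dp u 0)).
  have vE s : logmean G (s *: e) = 2^-1 * (ln (cnorm (G (p (zq e) s))) + ln (cnorm (G (p (cconj (zq e)) s)))).
    have sJ : cconj (cx s 0) = cx s 0 by apply: cx_inj; rewrite !cpartE ?oppr0.
    rewrite /logmean zqZ; case: ifP => _; rewrite cconjM sJ ?cconjK// /p.
    by rewrite [in RHS]addrC.
  exists (fun s => 2^-1 * (cre (H (p (zq e) s) * zq e) + cre (H (p (cconj (zq e)) s) * cconj (zq e)))).
    apply: filterS2 (near (zq e)) (near (cconj (zq e))) => s s1 s2.
    rewrite (_ : (fun s => logmean G (s *: e)) = fun s => 2^-1 * (ln (cnorm (G (p (zq e) s))) +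
       ln (cnorm (G (p (cconj (zq e)) s))))); last by apply/funext => ?; exact: vE.
    have d1 := is_derive_ln_cnorm (@cder_comp R _ _ s _ _ (hol_cd hG s1) (dp _ s)) (G0 _ s1).
    have d2 := is_derive_ln_cnorm (@cder_comp R _ _ s _ _ (hol_cd hG s2) (dp _ s)) (G0 _ s2).
    apply: is_derive_eq (is_deriveZ 2^-1 (is_deriveD d1 d2)) _.
    by rewrite /GRing.scale/= /H; congr (_ * (cre _ + cre _)); rewrite mulrAC.
  have D' u : cd (fun w => H w * u) (p u 0) (c 1%N * u).
    have := cdM D (cd_cst u (0 : C)); rewrite mulr0 addr0 -{1}(p0 u).
    by apply.
  have [e1 _] := @cder_comp R _ _ 0 _ _ (D' (zq e)) (dp (zq e) 0).
  have [e2 _] := @cder_comp R _ _ 0 _ _ (D' (cconj (zq e))) (dp (cconj (zq e)) 0).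
  apply: is_derive_eq (is_deriveZ 2^-1 (is_deriveD e1 e2)) _.
  by rewrite /kk expr2 /GRing.scale/= !cpartE; field.
- by rewrite /a; field.
Qed.

End HarmonicMean.

(** * Slice functions *)

Section Slices.
Context {R : realType}.
Local Notation C := (Cx R).
Implicit Types (z w : C) (x J : quat R).

(** For an imaginary unit J, the field isomorphism of C onto the slice of J that sends i to J. *)
Definition emb J w : quat R := (cre w)%:A + cim w *: J.
Definition quat_i : quat R := Quat 0 1 0 0.
Definition quat_j : quat R := Quat 0 0 1 0.

Lemma unit_i : imaginary_units quat_i.
Proof. by rewrite /imaginary_units /= /quat_i; congr Quat => /=; ring. Qed.
Lemma unit_j : imaginary_units quat_j.
Proof. by rewrite /imaginary_units /= /quat_j; congr Quat => /=; ring. Qed.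

Lemma imaginary_unitP J : imaginary_units J <->
  qre J = 0 /\ qim1 J ^+ 2 + qim2 J ^+ 2 + qim3 J ^+ 2 = 1.
Proof.
case: J => a b c d; rewrite /imaginary_units /=; split.
  move=> [E1 E2 E3 E4].
  have a0 : a = 0.
    apply/eqP/negPn/negP => a0.
    have Z y : a * y + y * a = 0 -> y = 0.
      move=> H; have : 2 * a * y = 0 by rewrite -{}H; ring.
      by move/eqP; rewrite !mulf_eq0 pnatr_eq0 (negbTE a0) => /eqP.
    have b0 : b = 0 by apply: Z; rewrite -[RHS]oppr0 -E2; ring.
    have c0 : c = 0 by apply: Z; rewrite -[RHS]oppr0 -E3; ring.
    have d0 : d = 0 by apply: Z; rewrite -[RHS]oppr0 -E4; ring.
    have := sqr_ge0 a; rewrite expr2; move: E1; rewrite b0 c0 d0; lra.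
  by split => //; rewrite !expr2; move: E1; rewrite a0; lra.
move=> [-> H]; rewrite -[LHS]/(Quat _ _ _ _) -[RHS]/(Quat _ _ _ _).
congr Quat; rewrite /=; [|ring..].
by move: H; rewrite !expr2; lra.
Qed.

Lemma embE J w : imaginary_units J -> [/\ qre (emb J w) = cre w,
   qim1 (emb J w) = cim w * qim1 J, qim2 (emb J w) = cim w * qim2 J &
   qim3 (emb J w) = cim w * qim3 J].
Proof.
by move=> /imaginary_unitP[J0 _]; rewrite /emb /= J0; split; ring.
Qed.

Lemma zq_emb J w : imaginary_units J -> zq (emb J w) = cx (cre w) `|cim w|.
Proof.
move=> uJ; have [E0 E1 E2 E3] := embE w uJ; rewrite /zq E0; congr cx.
rewrite /qimn E1 E2 E3 !exprMn -!mulrDr; case/imaginary_unitP : uJ => _ ->.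
by rewrite mulr1 sqrtr_sqr.
Qed.

Lemma norm_emb J w : imaginary_units J -> `|emb J w| = cnorm w.
Proof.
move=> uJ; rewrite -cnorm_zq zq_emb//; apply/eqP; rewrite -(@eqrXn2 _ 2) ?cnorm_ge0//.
by rewrite !cnorm_sqr !cpartE real_normK ?num_real.
Qed.

Lemma embM J w z : imaginary_units J -> emb J (w * z) = emb J w * emb J z.
Proof.
move=> uJ; rewrite /emb mulrDl !mulrDr -!scalerAl -!scalerAr !mul1r mulr1 uJ !scalerA !cpartE.
rewrite scalerBl scalerDl scalerN -!addrA; congr (_ + _).
by rewrite addrC -addrA.
Qed.

Lemma embD J w z : emb J (w + z) = emb J w + emb J z.
Proof. by rewrite /emb !cpartE !scalerDl addrACA. Qed.
Lemma embN J w : emb J (- w) = - emb J w.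
Proof. by rewrite /emb !cpartE !scaleNr opprD. Qed.
Lemma embB J w z : emb J (w - z) = emb J w - emb J z.
Proof. by rewrite embD embN. Qed.
Lemma emb1 J : emb J 1 = 1. Proof. by rewrite /emb !cpartE scale1r scale0r addr0. Qed.
Lemma emb0 J : emb J 0 = 0. Proof. by rewrite /emb !cpartE !scale0r addr0. Qed.
Lemma emb_real J (a : R) : emb J (cx a 0) = a%:A.
Proof. by rewrite /emb !cpartE scale0r addr0. Qed.
Lemma emb_cconj J w : emb J (cconj w) = emb (- J) w.
Proof. by rewrite /emb !cpartE scaleNr scalerN. Qed.
Lemma unitN J : imaginary_units J -> imaginary_units (- J).
Proof. by rewrite /imaginary_units /= mulrNN. Qed.

Lemma embX J w n : imaginary_units J -> emb J (w ^+ n) = emb J w ^+ n.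
Proof. by move=> uJ; elim: n => [|n IH]; rewrite ?expr0 ?emb1// !exprS embM// IH. Qed.

Lemma embV J w : imaginary_units J -> emb J w^-1 = (emb J w)^-1.
Proof.
move=> uJ; have [->|w0] := eqVneq w 0; first by rewrite invr0 emb0 invr0.
have e0 : emb J w \is a GRing.unit.
  by rewrite quat_unitE -normr_eq0 norm_emb// cnorm_eq0.
by apply: (mulrI e0); rewrite -embM// divff// divrr// emb1.
Qed.

Lemma embXz J w (n : int) : imaginary_units J -> emb J (w ^ n) = emb J w ^ n.
Proof. by move=> uJ; case: n => n; rewrite ?NegzE -?exprnP -?exprnN ?embV// embX. Qed.

Lemma zqP x : exists2 J, imaginary_units J & x = emb J (zq x).
Proof.
have [n0|n0] := eqVneq (qimn x) 0.
  exists quat_i; first exact: unit_i.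
  rewrite /emb /zq !cpartE n0 scale0r addr0.
  have := qimn_sqr x; rewrite n0 expr0n /= => /esym/eqP.
  rewrite !paddr_eq0 ?addr_ge0 ?sqr_ge0// !sqrf_eq0 -andbA => /and3P[/eqP a1 /eqP a2 /eqP a3].
  by case: x a1 a2 a3 {n0} => a b c d /= -> -> ->; congr Quat => /=; ring.
exists ((qimn x)^-1 *: Quat 0 (qim1 x) (qim2 x) (qim3 x)).
  apply/imaginary_unitP; rewrite /= mulr0; split => //.
  by rewrite !exprMn -!mulrDr -qimn_sqr -exprMn mulVf// expr1n.
rewrite /emb /zq !cpartE scalerA divff// scale1r.
by case: x {n0} => a b c d; congr Quat => /=; ring.
Qed.

Lemma slice_planeP J x : slice_plane J x <-> exists w, x = emb J w.
Proof.
split=> [[a [b ->]]|[w ->]]; first by exists (cx a b).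
by exists (cre w), (cim w).
Qed.

Lemma slice_plane_ij x : slice_plane quat_i x -> slice_plane quat_j x -> x = (qre x)%:A.
Proof.
move=> /slice_planeP[w wE] /slice_planeP[z zE].
have [_ _ i2 i3] := embE w unit_i; have [_ j1 _ _] := embE z unit_j.
rewrite -wE mulr0 in i2; rewrite -wE mulr0 in i3; rewrite -zE mulr0 in j1.
case: x {wE zE} i2 i3 j1 => a b c d /= -> -> ->.
by congr Quat => /=; ring.
Qed.

Definition r2 w : R * R := (cre w, cim w).
Definition c2 (p : R * R) : C := cx p.1 p.2.

Lemma r2K : cancel r2 c2. Proof. by move=> w; rewrite /c2 /= -cxE. Qed.
Lemma continuous_r2 : continuous r2.
Proof.
move=> w; have h1 : cre x @[x --> w] --> cre w by exact: (@cvg_cre _ _ _ (nbhs_filter w) id).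
have h2 : cim x @[x --> w] --> cim w by exact: (@cvg_cim _ _ _ (nbhs_filter w) id).
exact: (cvg_pair h1 h2).
Qed.

Lemma continuous_c2 : continuous c2.
Proof. by move=> t; apply: cvg_cx; [exact: cvg_fst|exact: cvg_snd]. Qed.

Definition cset (D : set (R * R)) : set C := [set w | D (r2 w)].

Lemma open_cset D : open D -> open (cset D).
Proof. by move=> oD; apply: open_comp => // w _; exact: continuous_r2. Qed.

End Slices.

Section Stems.
Context {R : realType}.
Local Notation C := (Cx R).
Implicit Types (z w : C) (x J : quat R) (F : R * R -> hcomplex R).

Lemma cvg_qre (T : Type) (FF : set_system T) {FFF : Filter FF} (f : T -> quat R) (l : quat R) :
  f @ FF --> l -> (@qre R \o f) @ FF --> qre l.
Proof.
move=> /cvgrPdist_lt fl; apply/cvgrPdist_lt => e e0; apply: filterS (fl _ e0) => y.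
apply: le_lt_trans; rewrite -[qre l - qre (f y)]/(qre (l - f y)).
rewrite -(@ler_pXn2r _ 2) ?nnegrE// real_normK ?num_real// -[`|l - f y|]/(qnorm (l - f y)).
by rewrite qnorm_sqr -!addrA lerDl !addr_ge0// sqr_ge0.
Qed.

Lemma mvt_approx (f df : R -> R) (a k e d h : R) : `|h| < d ->
  (forall y, `|y - a| < d -> is_derive y (1 : R) f (df y)) ->
  (forall y, `|y - a| < d -> `|df y - k| <= e) ->
  `|f (h + a) - f a - k * h| <= e * `|h|.
Proof.
move=> hd dF dk.
have B y : Num.min a (h + a) <= y <= Num.max a (h + a) -> `|y - a| < d.
  rewrite ge_min le_max => /andP[/orP H1 /orP H2].
  by apply: le_lt_trans hd; case: (ger0P (y - a)); case: (ger0P h); case: H1 => H1; case: H2 => H2; lra.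
have cF (u v : R) : Num.min a (h + a) <= u -> v <= Num.max a (h + a) ->
    {within `[u, v], continuous f}.
  move=> ua va; apply: derivable_within_continuous => y; rewrite in_itv/= => /andP[uy yv].
  by have [] := dF y (B y _); rewrite ?(le_trans ua uy) ?(le_trans yv va).
have [h0|h0] := leP 0 h.
  have ah : a <= h + a by rewrite lerDr.
  have mE : Num.min a (h + a) = a by apply/min_idPl.
  have ME : Num.max a (h + a) = h + a by apply/max_idPr.
  have [||c ci E] := @MVT_segment R f df a (h + a) ah.
  - by move=> y; rewrite in_itv/= => /andP[/ltW ya /ltW yh]; apply: dF; apply: B; rewrite mE ME ya.
  - by apply: cF; rewrite ?mE ?ME.
  rewrite E addrK -mulrBl normrM ler_wpM2r//; apply: dk; apply: B.
  by move: ci; rewrite in_itv/= mE ME.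
have ah : h + a <= a by rewrite gerDr ltW.
have mE : Num.min a (h + a) = h + a by apply/min_idPr.
have ME : Num.max a (h + a) = a by apply/max_idPl.
have [||c ci E] := @MVT_segment R f df (h + a) a ah.
- by move=> y; rewrite in_itv/= => /andP[/ltW ya /ltW yh]; apply: dF; apply: B; rewrite mE ME ya.
- by apply: cF; rewrite ?mE ?ME.
have -> : f (h + a) - f a - k * h = (df c - k) * h.
  rewrite -[f (h + a) - f a]opprB E; ring.
rewrite normrM ler_wpM2r//; apply: dk; apply: B.
by move: ci; rewrite in_itv/= mE ME.
Qed.

(** Total differentiability from continuous partial derivatives: the increment is split along two
    sides of a rectangle, with the mean value theorem on each. *)
Lemma C1_approx (D : set (R * R)) (u ua ub : R * R -> R) (a b : R) : open D -> D (a, b) ->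
  (forall p, D p -> is_derive p.1 (1 : R) (fun t => u (t, p.2)) (ua p)) ->
  (forall p, D p -> is_derive p.2 (1 : R) (fun t => u (p.1, t)) (ub p)) ->
  {for (a, b), continuous ua} -> {for (a, b), continuous ub} ->
  forall e : R, 0 < e -> exists2 d : R, 0 < d & forall h k, `|h| < d -> `|k| < d ->
    `|u (h + a, k + b) - u (a, b) - ua (a, b) * h - ub (a, b) * k| <= e * (`|h| + `|k|).
Proof.
move=> oD Dz da db ca cb e e0.
have : \forall p \near (a, b), [/\ D p, `|ua p - ua (a, b)| <= e & `|ub p - ub (a, b)| <= e].
  have nD : nbhs (a, b) D by apply: open_nbhs_nbhs; split.
  have /cvgrPdist_le/(_ e e0) na := ca; have /cvgrPdist_le/(_ e e0) nb := cb.
  apply: filterS3 nD na nb => p Dp; rewrite distrC => h1; rewrite distrC => h2.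
  by split.
move=> [[A B] /= [nA nB] AB].
have [d1 d10 d1P] : exists2 d : R, 0 < d & forall y, `|y - a| < d -> A y.
  have /nbhs_ballP[d d0 dP] := nA; exists d => // y ya; apply: dP.
  by rewrite /ball/= distrC.
have [d2 d20 d2P] : exists2 d : R, 0 < d & forall y, `|y - b| < d -> B y.
  have /nbhs_ballP[d d0 dP] := nB; exists d => // y ya; apply: dP.
  by rewrite /ball/= distrC.
exists (Num.min d1 d2); first by rewrite lt_min d10.
move=> h k; rewrite !lt_min => /andP[h1 _] /andP[_ k2].
have kb : B (k + b) by apply: d2P; rewrite addrK.
have P (y z : R) : `|y - a| < d1 -> `|z - b| < d2 ->
    [/\ D (y, z), `|ua (y, z) - ua (a, b)| <= e & `|ub (y, z) - ub (a, b)| <= e].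
  by move=> ya zb; apply: (AB (y, z)); split; [exact: d1P|exact: d2P].
have kb' : `|k + b - b| < d2 by rewrite addrK.
have a' : `|a - a| < d1 by rewrite subrr normr0.
have H1 : `|u (h + a, k + b) - u (a, k + b) - ua (a, b) * h| <= e * `|h|.
  apply: (@mvt_approx (fun t => u (t, k + b)) (fun t => ua (t, k + b)) _ _ _ d1) => // y ya.
    by have [Dp _ _] := P y (k + b) ya kb'; exact: (da _ Dp).
  by have [_ ? _] := P y (k + b) ya kb'.
have H2 : `|u (a, k + b) - u (a, b) - ub (a, b) * k| <= e * `|k|.
  apply: (@mvt_approx (fun t => u (a, t)) (fun t => ub (a, t)) _ _ _ d2) => // y ya.
    by have [Dp _ _] := P a y a' ya; exact: (db _ Dp).
  by have [_ _ ?] := P a y a' ya.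
rewrite mulrDr; apply: le_trans (lerD H1 H2); apply: le_trans (ler_normD _ _).
by rewrite le_eqVlt; apply/orP; left; apply/eqP; congr `|_|; ring.
Qed.

Lemma C1_cd (D : set (R * R)) (u v ua ub va vb : R * R -> R) z : open D -> D (r2 z) ->
  (forall p, D p -> is_derive p.1 (1 : R) (fun t => u (t, p.2)) (ua p)) ->
  (forall p, D p -> is_derive p.2 (1 : R) (fun t => u (p.1, t)) (ub p)) ->
  (forall p, D p -> is_derive p.1 (1 : R) (fun t => v (t, p.2)) (va p)) ->
  (forall p, D p -> is_derive p.2 (1 : R) (fun t => v (p.1, t)) (vb p)) ->
  {for r2 z, continuous ua} -> {for r2 z, continuous ub} ->
  {for r2 z, continuous va} -> {for r2 z, continuous vb} ->
  ua (r2 z) = vb (r2 z) -> ub (r2 z) = - va (r2 z) ->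
  cd (fun w => cx (u (r2 w)) (v (r2 w))) z (cx (ua (r2 z)) (va (r2 z))).
Proof.
move=> oD Dz du1 du2 dv1 dv2 cu1 cu2 cv1 cv2 CR1 CR2; apply/cdP => e e0.
have e4 : 0 < e / 4 by rewrite divr_gt0.
have [d1 d10 P1] := C1_approx oD Dz du1 du2 cu1 cu2 e4.
have [d2 d20 P2] := C1_approx oD Dz dv1 dv2 cv1 cv2 e4.
exists (Num.min d1 d2); first by rewrite lt_min d10.
move=> h; rewrite lt_min => /andP[h1 h2].
have H1 := P1 _ _ (le_lt_trans (cre_le h) h1) (le_lt_trans (cim_le h) h1).
have H2 := P2 _ _ (le_lt_trans (cre_le h) h2) (le_lt_trans (cim_le h) h2).
apply: (le_trans (cnorm_le _)).
have -> : r2 (h + z) = (cre h + cre z, cim h + cim z) by rewrite /r2 !cpartE.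
have Ere (x y k l : C) : cre (x - y - k * l) = cre x - cre y - (cre k * cre l - cim k * cim l).
  by rewrite !cpartE.
have Eim (x y k l : C) : cim (x - y - k * l) = cim x - cim y - (cre k * cim l + cim k * cre l).
  by rewrite !cpartE.
rewrite Ere Eim !cre_cx !cim_cx.
have N : `|cre h| + `|cim h| <= 2 * cnorm h by have := cre_le h; have := cim_le h; lra.
have G1 := le_trans H1 (ler_wpM2l (ltW e4) N); have G2 := le_trans H2 (ler_wpM2l (ltW e4) N).
have -> : e * cnorm h = e / 4 * (2 * cnorm h) + e / 4 * (2 * cnorm h) by field.
apply: lerD.
  apply: le_trans G1; rewrite le_eqVlt; apply/orP; left; apply/eqP; congr `|_|.
  rewrite -/(r2 z) CR2; move: (u _) (u _) (ua _) (va _) => *; ring.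
apply: le_trans G2; rewrite le_eqVlt; apply/orP; left; apply/eqP; congr `|_|.
rewrite -/(r2 z) -CR1; move: (v _) (v _) (ua _) (va _) => *; ring.
Qed.

(** For a slice preserving function the stem has real components and this is the stem itself as a
    complex function. In general it is a real part of the stem, which still satisfies the
    Cauchy-Riemann equations. *)
Definition stem_part F w : C := cx (qre (F (r2 w)).1) (qre (F (r2 w)).2).

Lemma derivable_parts F p v : derivable F p v ->
  h^-1 * (qre (F (h *: v + p)).1 - qre (F p).1) @[h --> (0 : R)^'] --> qre ('D_v F p).1 /\
  h^-1 * (qre (F (h *: v + p)).2 - qre (F p).2) @[h --> (0 : R)^'] --> qre ('D_v F p).2.
Proof.
move=> dF; have H : h^-1 *: (F (h *: v + p) - F p) @[h --> (0 : R)^'] --> 'D_v F p by exact: dF.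
have E1 : (fun h : R => h^-1 * (qre (F (h *: v + p)).1 - qre (F p).1)) =
  @qre R \o (fst \o (fun h : R => h^-1 *: (F (h *: v + p) - F p))) by [].
have E2 : (fun h : R => h^-1 * (qre (F (h *: v + p)).2 - qre (F p).2)) =
  @qre R \o (snd \o (fun h : R => h^-1 *: (F (h *: v + p) - F p))) by [].
split; [rewrite E1|rewrite E2]; apply: cvg_qre; apply: (cvg_comp _ _ H).
  exact: cvg_fst.
exact: cvg_snd.
Qed.

Lemma stem_part_hol (D : set (R * R)) F : open D -> is_C1 D F ->
  (forall p, D p -> d_alpha F p + hmul hi (d_beta F p) = 0) -> hol (cset D) (stem_part F).
Proof.
move=> oD c1F CR.
have CR' p : D p -> (d_alpha F p).1 = (d_beta F p).2 /\ (d_alpha F p).2 = - (d_beta F p).1.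
  move=> /CR; rewrite /hmul /hi /= !mul0r !mul1r sub0r add0r => /eqP.
  by rewrite addr_eq0 => /eqP ->; rewrite /= opprK.
have P1 p : D p ->
   is_derive p.1 (1 : R) (fun t => qre (F (t, p.2)).1) (qre (d_alpha F p).1) /\
   is_derive p.1 (1 : R) (fun t => qre (F (t, p.2)).2) (qre (d_alpha F p).2).
  move=> /c1F[/derivable_parts[d1 d2] _ _ _].
  have E (h : R) : (h + p.1, p.2) = h *: ((1, 0) : R * R) + p.
    by case: p {d1 d2} => a b; congr pair; rewrite /= /GRing.scale/= ?mulr1// mulr0 add0r.
  by split; apply/is_derive_quotP; rewrite -surjective_pairing; under eq_fun do rewrite E.
have P2 p : D p ->
   is_derive p.2 (1 : R) (fun t => qre (F (p.1, t)).1) (qre (d_beta F p).1) /\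
   is_derive p.2 (1 : R) (fun t => qre (F (p.1, t)).2) (qre (d_beta F p).2).
  move=> /c1F[_ /derivable_parts[d1 d2] _ _].
  have E (h : R) : (p.1, h + p.2) = h *: ((0, 1) : R * R) + p.
    by case: p {d1 d2} => a b; congr pair; rewrite /= /GRing.scale/= ?mulr1// mulr0 add0r.
  by split; apply/is_derive_quotP; rewrite -surjective_pairing; under eq_fun do rewrite E.
have cq1 (G : R * R -> hcomplex R) p : {for p, continuous G} ->
    {for p, continuous (fun q => qre (G q).1)}.
  move=> cG; apply: (@cvg_qre _ _ (nbhs_filter p) (fst \o G)); apply: (cvg_comp _ _ cG).
  exact: cvg_fst.
have cq2 (G : R * R -> hcomplex R) p : {for p, continuous G} ->
    {for p, continuous (fun q => qre (G q).2)}.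
  move=> cG; apply: (@cvg_qre _ _ (nbhs_filter p) (snd \o G)); apply: (cvg_comp _ _ cG).
  exact: cvg_snd.
apply: (@hol_build R (cset D) _
  (fun w => cx (qre (d_alpha F (r2 w)).1) (qre (d_alpha F (r2 w)).2))).
- exact: open_cset.
- move=> z Dz; have [_ _ ca cb] := c1F _ Dz; have [E1 E2] := CR' _ Dz.
  apply: (@C1_cd D (fun p => qre (F p).1) (fun p => qre (F p).2)
    (fun p => qre (d_alpha F p).1) (fun p => qre (d_beta F p).1)
    (fun p => qre (d_alpha F p).2) (fun p => qre (d_beta F p).2)) => //.
  + by move=> p /P1[].
  + by move=> p /P2[].
  + by move=> p /P1[].
  + by move=> p /P2[].
  + exact: (cq1 (d_alpha F) _ ca).
  + exact: (cq1 (d_beta F) _ cb).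
  + exact: (cq2 (d_alpha F) _ ca).
  + exact: (cq2 (d_beta F) _ cb).
  + by rewrite E1.
  + by rewrite E2 /= opprK.
- move=> z Dz; have [_ _ ca _] := c1F _ Dz.
  have h1 : (qre (d_alpha F (r2 w)).1) @[w --> z] --> qre (d_alpha F (r2 z)).1.
    exact: (@continuous_comp _ _ _ _ (fun p => qre (d_alpha F p).1) z (@continuous_r2 R z) (cq1 _ _ ca)).
  have h2 : (qre (d_alpha F (r2 w)).2) @[w --> z] --> qre (d_alpha F (r2 z)).2.
    exact: (@continuous_comp _ _ _ _ (fun p => qre (d_alpha F p).2) z (@continuous_r2 R z) (cq2 _ _ ca)).
  exact: (cvg_cx h1 h2).
Qed.

End Stems.

Section SlicePreserving.
Context {R : realType}.
Local Notation C := (Cx R).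
Implicit Types (z w : C) (x J : quat R) (F : R * R -> hcomplex R).

(** Off the real axis a quaternion determines J and w only up to a simultaneous change to -J and the
    conjugate of w, which the symmetry of D absorbs. *)
Lemma circularization_emb (D : set (R * R)) J w : conj_symmetric D -> imaginary_units J ->
  circularization D (emb J w) <-> D (r2 w).
Proof.
move=> sD uJ; split=> [[a [b [J' [Dab uJ' E]]]]|Dw]; last by exists (cre w), (cim w), J.
have := zq_emb w uJ; rewrite E -[_ + _]/(emb J' (cx a b)) zq_emb// => -[].
rewrite /r2 => <- bw; have [cw|cw] := leP 0 (cim w).
  move: bw; rewrite (ger0_norm cw) => <-.
  by case: (ger0P b) => // _; exact: sD.
have -> : cim w = - `|b| by rewrite bw ltr0_norm// opprK.
by case: (ger0P b) => _; [exact: sD|rewrite opprK].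
Qed.

Lemma sphere_of_emb J J' z w : imaginary_units J -> imaginary_units J' ->
  sphere_of (emb J z) (emb J' w) <-> w = z \/ w = cconj z.
Proof.
move=> uJ uJ'; split=> [[a [b [I [I' [uI uI' E1 E2]]]]]|].
  have := zq_emb z uJ; rewrite E1 -[_ + _]/(emb I (cx a b)) zq_emb// => -[].
  have := zq_emb w uJ'; rewrite E2 -[_ + _]/(emb I' (cx a b)) zq_emb// => -[].
  move=> aw bw az bz; have H : `|cim w| = `|cim z| by rewrite -bw.
  have [H'|H'] : cim w = cim z \/ cim w = - cim z.
    by move: H; case: (ger0P (cim w)); case: (ger0P (cim z)) => _ _; [left|right|right|left]; lra.
    by left; apply: cx_inj => //; rewrite -aw.
  by right; apply: cx_inj; rewrite cpartE// -aw.
case=> ->; first by exists (cre z), (cim z), J, J'.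
exists (cre z), (cim z), J, (- J'); split => //; first exact: unitN.
by rewrite emb_cconj.
Qed.

(** The hypothesis at J and at -J places both components in the slice of J; lying in those of
    [quat_i] and [quat_j], they are real. *)
Lemma real_stem (F1 F2 : quat R) :
  (forall J, imaginary_units J -> slice_plane J (F1 + J * F2)) ->
  F1 = (qre F1)%:A /\ F2 = (qre F2)%:A.
Proof.
move=> H; have P J : imaginary_units J -> slice_plane J F1 /\ slice_plane J F2.
  move=> uJ; have /slice_planeP[w wE] := H J uJ.
  have /slice_planeP[z zE] := H (- J) (unitN uJ).
  have F1E : F1 = emb J (cx 2^-1 0 * (w + cconj z)).
    have <- : emb J (cx 2^-1 0) * (emb J w + emb J (cconj z)) = emb J (cx 2^-1 0 * (w + cconj z)).
      by rewrite embM// embD.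
    rewrite emb_cconj -wE -zE emb_real mulNr addrACA subrr addr0 -scalerAl mul1r.
    by rewrite scalerDr -scalerDl (_ : 2^-1 + 2^-1 = 1) ?scale1r//; field.
  split; first by apply/slice_planeP; rewrite F1E; eexists.
  apply/slice_planeP; exists (cx 0 (-1) * (w - cx 2^-1 0 * (w + cconj z))).
  rewrite embM// embB -wE -F1E addrAC subrr add0r.
  have -> : emb J (cx 0 (-1)) = - J by rewrite /emb !cpartE scale0r add0r scaleN1r.
  by rewrite mulrA mulNr uJ opprK mul1r.
have [i1 i2] := P _ (@unit_i R); have [j1 j2] := P _ (@unit_j R).
by split; exact: slice_plane_ij.
Qed.

Lemma qconj_emb J z : imaginary_units J -> qconj (emb J z) = emb J (cconj z).
Proof.
move=> /imaginary_unitP[J0 _]; rewrite /qconj /emb /=; case: J J0 => a b c d /= ->.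
by rewrite !cpartE; congr Quat => /=; ring.
Qed.

(** The factor has real coefficients, so in every slice it is the polynomial with roots z and its
    conjugate, whichever slice its centre comes from. *)
Lemma sph_factor_emb J J' z w : imaginary_units J -> imaginary_units J' ->
  sph_factor (emb J z) (emb J' w) = emb J' ((w - z) * (w - cconj z)).
Proof.
move=> uJ uJ'; rewrite /sph_factor qconj_emb// -embD -embM//.
have -> : z + cconj z = cx (2 * cre z) 0 by apply: cx_inj; rewrite !cpartE; ring.
have -> : z * cconj z = cx (cnorm z ^+ 2) 0.
  by apply: cx_inj; rewrite !cpartE ?cnorm_sqr; ring.
rewrite !emb_real -2!(emb_real J') -embX// -embM// -embB -embD; congr emb.
by apply: cx_inj; rewrite expr2 !cpartE ?cnorm_sqr; ring.
Qed.

(* A slice preserving [f] acts on every slice through this single function, up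
   to the junk value 0 at the poles. *)
Definition slice_fun (f : quat R -> hquat R) w : C :=
  if f (emb quat_i w) is Some q then cx (qre q) (qim1 q) else 0.

Lemma slice_funE (f : quat R -> hquat R) w v :
  f (emb quat_i w) = Some (emb quat_i v) -> slice_fun f w = v.
Proof.
rewrite /slice_fun => ->; have [-> -> _ _] := embE v unit_i.
by rewrite mulr1 -cxE.
Qed.

Section FromSlice.
Variables (D : set (R * R)) (f : quat R -> hquat R).
Hypothesis oD : open D.
Hypothesis sD : conj_symmetric D.
Hypothesis semif : semiregular D f.
Hypothesis spf : slice_preserving (circularization D) f.
Local Notation Phi := (slice_fun f).

(** The factor [u] is 1 at regular points and a power of a linear or spherical factor elsewhere.
    Dividing by it transfers slice preservation from f to g, so the stem of g is real at w. *)
Lemma stem_values (E : set (R * R)) F g w v (u : C) : induces E F g -> D (r2 w) -> E (r2 w) ->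
  (forall J, imaginary_units J -> f (emb J w) = Some (emb J u * g (emb J w))) ->
  u != 0 -> v = u * stem_part F w ->
  (forall J, imaginary_units J -> f (emb J w) = Some (emb J v)) /\ Phi w = v.
Proof.
move=> iF Dw Ew fE u0 ->.
have gE J : imaginary_units J -> g (emb J w) = (F (r2 w)).1 + J * (F (r2 w)).2.
  by move=> uJ; exact: (iF _ _ _ Ew uJ).
have [E1 E2] : (F (r2 w)).1 = (qre (F (r2 w)).1)%:A /\ (F (r2 w)).2 = (qre (F (r2 w)).2)%:A.
  apply: real_stem => J uJ; rewrite -gE//; apply/slice_planeP.
  have sJ : slice_plane J (emb J w) by apply/slice_planeP; exists w.
  have cD : circularization D (emb J w) by apply/circularization_emb.
  have /slice_planeP[y yE] := spf uJ cD sJ (fE J uJ).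
  exists (u^-1 * y); rewrite embM// -yE embV// mulrA mulVr ?mul1r//.
  by rewrite quat_unitE -normr_eq0 norm_emb// cnorm_eq0.
have fE' J : imaginary_units J -> f (emb J w) = Some (emb J (u * stem_part F w)).
  move=> uJ; rewrite fE// embM// gE// E1 E2; congr (Some (_ * _)).
  by rewrite /emb /stem_part !cpartE /= -scalerAr mulr1.
by split => //; apply: slice_funE; exact: fE' (@unit_i R).
Qed.

Lemma regular_values (E : set (R * R)) g w : circular_nbhd (emb quat_i w) E -> slice_regular E g ->
  (forall x, circularization E x -> f x = Some (g x)) -> D (r2 w) ->
  hol_at Phi w /\ forall J, imaginary_units J -> f (emb J w) = Some (emb J (Phi w)).
Proof.
move=> [oE sE cE] [F [_ c1F CR iF]] fE Dw.
have Ew : E (r2 w) by apply/(circularization_emb w sE (@unit_i R)).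
have V y : D (r2 y) -> E (r2 y) ->
    (forall J, imaginary_units J -> f (emb J y) = Some (emb J (stem_part F y))) /\
    Phi y = stem_part F y.
  move=> Dy Ey; apply: (@stem_values E F g y _ 1) => //.
  - by move=> J uJ; rewrite emb1 mul1r; apply: fE; apply/circularization_emb.
  - by rewrite mul1r.
split.
  have oDE : open (cset D `&` cset E) by apply: openI; exact: open_cset.
  have h : hol (cset D `&` cset E) (stem_part F).
    by apply: subset_hol (stem_part_hol oE c1F CR) => y [].
  have := @eq_hol _ _ _ Phi oDE _ h; apply => //.
  by move=> y /set_mem[Dy Ey]; rewrite (V y Dy Ey).2.
by have [V1 V2] := V w Dw Ew; rewrite V2.
Qed.

(** Removable points fall under the first alternative, since f takes there the value of its
    extension. *)
Lemma slice_trichotomy w : D (r2 w) ->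
  (hol_at Phi w /\ forall J, imaginary_units J -> f (emb J w) = Some (emb J (Phi w))) \/
  (pole f (emb quat_i w) /\ f (emb quat_i w) = None).
Proof.
move=> Dw; have [D' [oD' sD' D'D [g sg fg] H]] := semif.
have [D'w|D'w] := pselect (D' (r2 w)).
  left; apply: (@regular_values D' g) => //.
  by split => //; apply/circularization_emb => //; exact: unit_i.
have cD : circularization D (emb quat_i w) by apply/circularization_emb => //; exact: unit_i.
have [|[P fN]|[E [g' [cE sg' fg']]]] := H (emb quat_i w) cD.
- by move=> /(circularization_emb w sD' (@unit_i R)).
- by right.
- by left; exact: (regular_values cE sg' fg').
Qed.

Lemma slice_mero w0 : D (r2 w0) -> mero Phi w0.
Proof.
have H1 w : D (r2 w) -> (exists2 E, circular_nbhd (emb quat_i w) E & exists2 g, slice_regular E g &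
    (forall x, circularization E x -> f x = Some (g x))) -> mero Phi w.
  move=> Dw [E cE [g sg fg]]; exists 0, Phi.
  have [oE sE ciE] := cE; have Ew : E (r2 w) by apply/(circularization_emb w sE (@unit_i R)).
  have oDE : open (cset D `&` cset E) by apply: openI; exact: open_cset.
  have /nbhs_cx[r r0 rP] : nbhs w (cset D `&` cset E) by apply: open_nbhs_nbhs; split.
  exists r => //; split; last by move=> y _ _; rewrite expr0z mul1r.
  move=> y /rP[Dy Ey]; apply: (@regular_values E g y _ sg fg Dy).1.
  by split => //; apply/circularization_emb => //; exact: unit_i.
move=> Dw; have [D' [oD' sD' D'D [g sg fg] H]] := semif.
have [D'w|D'w] := pselect (D' (r2 w0)).
  apply: H1 => //; exists D'; last by exists g.
  by split => //; apply/circularization_emb => //; exact: unit_i.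
have cD : circularization D (emb quat_i w0) by apply/circularization_emb => //; exact: unit_i.
have [|[[[E [g' [n [cE sg' fg']]]] _] _]|[E [g' [cE sg' fg']]]] := H (emb quat_i w0) cD.
- by move=> /(circularization_emb w0 sD' (@unit_i R)).
- have [oE sE ciE] := cE.
  have Ew : E (r2 w0) by apply/(circularization_emb w0 sE (@unit_i R)).
  have [F [_ c1F CR iF]] := sg'.
  have oDE : open (cset D `&` cset E) by apply: openI; exact: open_cset.
  have /nbhs_cx[r r0 rP] : nbhs w0 (cset D `&` cset E) by apply: open_nbhs_nbhs; split.
  have V w : cball w0 r w -> w != w0 -> w != cconj w0 ->
      Phi w = ((w - w0) * (w - cconj w0)) ^- n * stem_part F w.
    move=> /rP[Dw' Ew'] n1 n2.
    apply: (@stem_values E F g' w _ (((w - w0) * (w - cconj w0)) ^- n) iF Dw' Ew' _ _ _).2 => //.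
    + move=> J uJ; rewrite fg'; last 2 first.
      * exact/circularization_emb.
      * move=> /(sphere_of_emb w0 w (@unit_i R) uJ) [E1|E1].
          by rewrite E1 eqxx in n1.
        by rewrite E1 eqxx in n2.
      congr (Some (_ * _)); rewrite sph_factor_emb//; last exact: unit_i.
      by rewrite embV// embX.
    + by rewrite invr_neq0// expf_neq0// mulf_neq0// subr_eq0.
  have hF : hol (cball w0 r) (stem_part F).
    by apply: subset_hol (stem_part_hol oE c1F CR) => y /rP[].
  (* At a real point the two roots of the spherical factor coincide and the exponent doubles;
     elsewhere the conjugate root stays away and its factor joins the holomorphic part. *)
  have [wr|wr] := eqVneq (cim w0) 0.
    have cw : cconj w0 = w0 by apply: cx_inj; rewrite !cpartE// wr oppr0.
    exists (- n%:Z *+ 2), (stem_part F), r => //; split => // w wb n1.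
    rewrite V ?cw//; congr (_ * _).
    by rewrite -expr2 -exprM mulnC exprM mulr2n expfzDr ?subr_eq0// -exprnN -expr2 exprVn -exprM mulnC exprM.
  exists (- n%:Z), (fun w => (w - cconj w0) ^- n * stem_part F w).
  have c0 : 0 < `|cim w0| by rewrite normr_gt0.
  have nc w : cball w0 (Num.min r `|cim w0|) w -> w != cconj w0.
    rewrite /cball/= lt_min => /andP[_ H2]; apply: contraTneq H2 => ->.
    rewrite -leNgt (le_trans _ (cim_le _))// !cpartE.
    by rewrite -opprD normrN -mulr2n normrMn mulr2n lerDl.
  exists (Num.min r `|cim w0|); first by rewrite lt_min r0.
  have sub : cball w0 (Num.min r `|cim w0|) `<=` cball w0 r.
    by move=> w; rewrite /cball/= lt_min => /andP[].
  split; last first.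
    move=> w wb n1; rewrite V ?nc//; last exact: sub.
    by rewrite exprMn invfM mulrA -exprnN.
  apply: holM; [exact: cball_open| |exact: subset_hol hF].
  apply: holV; [exact: cball_open| |].
    by move=> w /nc n1; rewrite expf_neq0// subr_eq0.
  apply: holX; first exact: cball_open.
  have oB := @cball_open R w0 (Num.min r `|cim w0|).
  exact: (holD oB (hol_id oB) (hol_cst oB (- cconj w0))).
- by apply: H1 => //; exists E => //; exists g'.
Qed.

(** [slice_fun] is 0 at the poles, so a nonzero value certifies a regular point. *)
Lemma good_values w : D (r2 w) -> Phi w != 0 ->
  hol_at Phi w /\ forall J, imaginary_units J -> f (emb J w) = Some (emb J (Phi w)).
Proof.
move=> Dw P0; have [//|[_ fN]] := slice_trichotomy Dw.
by move: P0; rewrite /slice_fun fN eqxx.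
Qed.

Lemma good_conj w : D (r2 w) -> Phi w != 0 -> Phi (cconj w) = cconj (Phi w).
Proof.
move=> Dw P0; have [_ fE] := good_values Dw P0; apply: slice_funE.
by rewrite !emb_cconj fE//; exact: unitN (@unit_i R).
Qed.

Lemma log_abs_good J w : imaginary_units J -> D (r2 w) -> Phi w != 0 ->
  log_abs f (emb J w) = (ln (cnorm (Phi w)))%:E.
Proof.
move=> uJ Dw P0; have [_ E] := good_values Dw P0.
by rewrite /log_abs E// norm_emb// lne_EFin// cnorm_gt0.
Qed.

Lemma good_origin : D (0, 0) -> f 0 <> Some 0 -> f 0 <> None -> Phi 0 != 0.
Proof.
move=> D0 f0 fN; have r20 : r2 0 = (0, 0) :> R * R by [].
have [[_ fE]|[_]] := @slice_trichotomy 0 D0; last by rewrite emb0.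
have := fE _ (@unit_i R); rewrite emb0 => E; apply: contra_notN f0 => /eqP P0.
by rewrite E P0 emb0.
Qed.

End FromSlice.
End SlicePreserving.

(** * The formula as a sum over the zeros and poles in one slice *)

Section SliceFormula.
Context {R : realType}.
Local Notation C := (Cx R).
Implicit Types (z w : C) (x y J : quat R).

(** Balls of half the admissible radius cover the disc. With b a lower bound of the radii of a
    finite subcover, a point less than b outside the disc is within b of its radial projection,
    hence in a doubled ball. *)
Lemma cdisc_margin (U : set C) (rho : R) : 0 < rho -> open U -> cdisc rho `<=` U ->
  exists2 R0, rho < R0 & cball 0 R0 `<=` U.
Proof.
move=> rho0 oU rU; have := @compact_cdisc R rho; rewrite compact_cover.
have rad z : exists d : R, 0 < d /\ (cdisc rho z -> cball z (2 * d) `<=` U).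
  have [zr|nz] := pselect (cdisc rho z); last by exists 1.
  have /nbhs_cx[d d0 dP] : nbhs z U by apply: open_nbhs_nbhs; split => //; exact: rU.
  exists (d / 2); split; first by rewrite divr_gt0.
  by rewrite mulrC divfK ?pnatr_eq0.
have [d dP] := choice rad.
move=> /(_ _ (cdisc rho) (fun z => cball z (d z))) [|z zr|E EK EP].
- by move=> z _; exact: cball_open.
- by exists z => //=; apply: cballxx; case: (dP z).
have [z _ _|b b0 bP] := @separated_from R C (finmap.enum_fset E) predT d 0; first by case: (dP z).
exists (rho + b); first by rewrite ltrDl.
move=> w; rewrite /cball/= subr0 => wb.
have [wr|wr] := leP (cnorm w) rho; first exact: rU.
have w0 : 0 < cnorm w by exact: lt_trans wr.
pose w' : C := cx (rho / cnorm w) 0 * w.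
have w'r : cnorm w' = rho.
  by rewrite cnormM cnorm_real ger0_norm ?divr_ge0 ?ltW// divfK ?gt_eqF.
have ww' : cnorm (w - w') < b.
  have -> : w - w' = cx (1 - rho / cnorm w) 0 * w.
    by rewrite /w' (_ : cx (1 - _) 0 = 1 - cx (rho / cnorm w) 0) ?mulrBl ?mul1r//;
      apply: cx_inj; rewrite !cpartE ?oppr0 ?addr0.
  rewrite cnormM cnorm_real ger0_norm; last by rewrite subr_ge0 ler_pdivrMr// mul1r ltW.
  by rewrite mulrBl mul1r divfK ?gt_eqF//; lra.
have w'K : cdisc rho w' by rewrite /cdisc /mkset w'r.
have [z /= zE zw'] := EP w' w'K.
have [_] := dP z; move=> /(_ (set_mem (EK z zE))); apply.
rewrite /cball/= in zw' *; have := cdist_trans w' w z; have := bP z zE isT; lra.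
Qed.

Lemma sphere_term_boundary (rho : R) (q : quat R) : 0 < rho -> `|q| = rho -> sphere_term rho q = 0.
Proof.
move=> rho0 qr; rewrite /sphere_term qr divff ?expf_neq0 ?gt_eqF// ln1.
by rewrite subrr !mul0r mulr0 mul0r addr0.
Qed.

Section Formula.
Variables (rho : R) (D : set (R * R)) (f : quat R -> hquat R).
Hypothesis rho0 : 0 < rho.
Hypothesis oD : open D.
Hypothesis sD : conj_symmetric D.
Hypothesis semif : semiregular D f.
Hypothesis spf : slice_preserving (circularization D) f.
Hypothesis BD : [set x : quat R | `|x| <= rho] `<=` circularization D.
Hypothesis f0 : f 0 <> Some 0.
Hypothesis fN : f 0 <> None.
Local Notation Phi := (slice_fun f).
Local Notation mu := (surface_measure rho).
Local Notation S := (qsphere rho).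
Local Notation e := (emb (quat_i : quat R)).
Let ui := @unit_i R.

Lemma slice_formula : exists (s : seq C) (m : C -> int), [/\ uniq s,
  forall z, (z \in s) <-> cnorm z <= rho /\ ~ good Phi z,
  forall z, z \in s -> has_ord Phi z (m z) &
  log_abs f 0 = (((fine (mu S))^-1)%:E * (\int[mu]_(y in S) log_abs f y)
        - (rho ^+ 2 / 8 * laplacian (fun x => fine (log_abs f x)) 0)%:E
        - (\sum_(z <- s) 2^-1 * (m z)%:~R * sphere_term rho (e z))%:E)%E].
Proof.
have discD : cdisc rho `<=` cset D.
  move=> z zr; apply/(circularization_emb z sD ui); apply: BD.
  by rewrite /= norm_emb.
have [R0 rR0 R0D] := cdisc_margin rho0 (open_cset oD) discD.
have D0 : D (r2 (0 : C)) by apply: discD; rewrite /cdisc /mkset cnorm0 ltW.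
have mP z : cball 0 R0 z -> mero Phi z by move=> /R0D; exact: slice_mero.
have P0 := good_origin oD sD semif spf D0 f0 fN.
have gP w : D (r2 w) -> Phi w != 0 -> good Phi w.
  move=> Dw Pw; split => //; have /nbhs_cx[r r0 rP] : nbhs w [set y | D (r2 y) /\ Phi y != 0].
    have nD : nbhs w (cset D) by apply: open_nbhs_nbhs; split => //; exact: open_cset.
    have [hw _] := good_values oD sD semif spf Dw Pw.
    have [r r0 rP] := hol_at_neq0 hw Pw.
    by apply: filterS2 nD (nbhs_cball w r0) => y Dy /rP.
  by exists r => // y /rP[Dy Py]; case: (good_values oD sD semif spf Dy Py).
have rr : 0 < rho < R0 by rewrite rho0.
have [s [m [G [R2 [us sP mP' [rR2 hG] GP]]]]] := zero_free_factor rr mP (gP _ D0 P0).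
exists s, m; split => //.
have G0 w : cball 0 R2 w -> G w != 0 by move=> /GP[].
have rrho : 0 < rho < R2 by rewrite rho0.
have [A [k [mA lk Ak]]] := logmean_has_mean rrho hG G0.
have s0 : 0 \notin s by apply/negP => /sP[_]; apply; exact: gP.
have e0 z : z \in s -> e z != 0.
  by move=> zs; rewrite -normr_eq0 norm_emb// cnorm_eq0; apply: contraNneq s0 => <-.
have er z : z \in s -> `|e z| <= rho by move=> /sP[zr _]; rewrite norm_emb.
have H z := fun zs : z \in s => has_mean_log_sph rho0 (e0 z zs) (er z zs).
(* The guard z \in s keeps membership at hand under the sum, where [H] asks for it. *)
pose L y := \sum_(z <- s | z \in s) 2^-1 * (m z)%:~R * ln `|sph_factor (e z) y| + logmean G y.
have LE w J : imaginary_units J -> D (r2 w) -> D (r2 (cconj w)) -> cball 0 R2 w -> w \notin s -> cconj w \notin s ->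
    log_abs f (emb J w) = (L (emb J w))%:E.
  move=> uJ Dw DJw wR ws Jws; have JwR : cball 0 R2 (cconj w).
    by move: wR; rewrite /cball/= !subr0 cnormJ.
  have [Gw /(_ ws) [[_ Pw] PE]] := GP w wR; have [GJw /(_ Jws) [[_ PJw] PJE]] := GP _ JwR.
  rewrite (log_abs_good oD sD semif spf uJ Dw Pw); congr _%:E.
  have lnP (y : C) : y \notin s -> G y != 0 -> Phi y = (\prod_(z <- s) (y - z) ^ m z) * G y ->
      ln (cnorm (Phi y)) = \sum_(z <- s | z \in s) (m z)%:~R * ln (cnorm (y - z)) + ln (cnorm (G y)).
    move=> ys Gy ->; rewrite cnormM lnM ?posrE ?cnorm_gt0//; last first.
      rewrite prodf_seq_neq0; apply/allP => z zs; rewrite expfz_neq0// subr_eq0.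
      by apply: contraNneq ys => ->.
    congr (_ + _); rewrite -big_seq.
    elim: s ys {us sP mP' GP s0 e0 er H L Jws ws PE PJE} => [|a s' IH]; first by rewrite !big_nil cnorm1 ln1.
    rewrite inE negb_or => /andP[ya ys']; rewrite !big_cons cnormM cnormXz.
    have c1 : 0 < cnorm (y - a) by rewrite cnorm_gt0 subr_eq0.
    rewrite lnM ?posrE ?exprz_gt0 ?lnXz//; first by rewrite IH.
    rewrite cnorm_gt0 prodf_seq_neq0; apply/allP => z zs; rewrite expfz_neq0// subr_eq0.
    by apply: contraNneq ys' => ->.
  have PP : ln (cnorm (Phi w)) = 2^-1 * (ln (cnorm (Phi w)) + ln (cnorm (Phi (cconj w)))).
    by rewrite (good_conj oD sD semif spf Dw Pw) cnormJ; field.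
  rewrite PP (lnP w)// (lnP (cconj w))// addrACA mulrDr /L.
  congr (_ + _).
    rewrite -big_split/= mulr_sumr; apply: eq_bigr => z zs.
    rewrite sph_factor_emb// norm_emb// cnormM.
    have wz : cnorm (w - cconj z) = cnorm (cconj w - z) by rewrite -cnormJ cconjB cconjK.
    have c1 : 0 < cnorm (w - z) by rewrite cnorm_gt0 subr_eq0; apply: contraNneq ws => ->.
    have c3 : 0 < cnorm (w - cconj z).
      by rewrite wz cnorm_gt0 subr_eq0; apply: contraNneq Jws => ->.
    rewrite lnM// -wz; ring.
  rewrite /logmean zq_emb//; have [c0|c0] := leP 0 (cim w).
    by rewrite ger0_norm// -cxE.
  have wJ : cx (cre w) (- cim w) = cconj w by apply: cx_inj; rewrite !cpartE.
  by rewrite ltr0_norm// wJ cconjK [in RHS]addrC.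
pose Z : set (quat R) := \bigcup_(z in [set` s]) [set y | sph_factor (e z) y = 0].
have mz z : measurable [set y : quat R | sph_factor (e z) y = 0].
  have := measurable_sph_sqr (e z) measurableT (measurable_set1 0).
  rewrite setTI; congr measurable; apply/seteqP; split => y /=.
    by move/eqP; rewrite sqrf_eq0 normr_eq0 => /eqP.
  by move=> ->; rewrite normr0 expr0n.
have fs : finite_set [set` s] by exact: finite_seq.
have mZ : measurable Z by apply: fin_bigcup_measurable.
have Z0 : mu (S `&` Z) = 0%E.
  rewrite setI_bigcupr; apply/eqP; rewrite -measure_le0.
  have mSq z : measurable (S `&` [set y | sph_factor (e z) y = 0]).
    by apply: measurableI; [exact: measurable_qsphere|exact: mz].
  have := @content_sub_fsum _ _ _ mu _ [set` s] _ (fun z => S `&` [set y | sph_factor (e z) y = 0]) fs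
    (fun z _ => mSq z) (fin_bigcup_measurable fs (fun z _ => mSq z)) (@subset_refl _ _).
  by rewrite fsbig1 // => z zs; exact: (H z zs).2.
have zqR x : exists J w, [/\ imaginary_units J, x = emb J w & cnorm w = `|x|].
  by have [J uJ xE] := zqP x; exists J, (zq x); split => //; rewrite cnorm_zq.
have [] := @mean_formula R rho rho0 f L
   (\sum_(z <- s | z \in s) 2^-1 * (m z)%:~R * (2 * ln rho + (2 * qre (e z) ^+ 2 - `|e z| ^+ 2) / (2 * rho ^+ 2)) + A)
   (\sum_(z <- s | z \in s) 2^-1 * (m z)%:~R * ((8 * qre (e z) ^+ 2 - 4 * `|e z| ^+ 2) / `|e z| ^+ 4) + k) Z.
- apply: has_meanD; last exact: mA.
  apply: has_mean_sum => // z zs; apply: has_meanZ; exact: (H z zs).1.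
- apply: has_lapD; last exact: lk.
  by apply: has_lap_sum => z zs; apply: has_lapZ; apply: has_lap_log_sph; exact: e0.
- exact: mZ.
- exact: Z0.
- move=> y Sy Zy; have [J [w [uJ yE wy]]] := zqR y; rewrite yE; rewrite /qsphere/= in Sy.
  have wr : cnorm w = rho by rewrite wy.
  apply: LE => //.
  + by apply: discD; rewrite /cdisc/= wr.
  + by apply: discD; rewrite /cdisc/= cnormJ wr.
  + by rewrite /cball/= subr0 wr.
  + apply/negP => ws; apply: Zy; exists w => //=.
    by rewrite yE sph_factor_emb// subrr mul0r emb0.
  + apply/negP => ws; apply: Zy; exists (cconj w) => //=.
    by rewrite yE sph_factor_emb// cconjK subrr mulr0 emb0.
(* The points of s keep a positive distance from 0, so the model [L] is valid near 0. *)
- have [z zs _|b b0 bP] := @separated_from R C s predT (@cnorm R) 0.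
    by rewrite cnorm_gt0; apply: contraNneq s0 => <-.
  have mb : 0 < Num.min b rho by rewrite lt_min b0.
  apply: filterS (nbhs0_lt mb) => x; rewrite lt_min => /andP[xb xr].
  have [J [w [uJ yE wy]]] := zqR x; rewrite yE.
  have ns (y : C) : cnorm y = `|x| -> y \notin s.
    by move=> yx; apply/negP => ys; have := bP y ys isT; rewrite yx leNgt xb.
  apply: LE => //.
  + by apply: discD; rewrite /cdisc/= wy ltW.
  + by apply: discD; rewrite /cdisc/= cnormJ wy ltW.
  + by rewrite /cball/= subr0 wy (lt_trans xr).
  + exact: ns.
  + by apply: ns; rewrite cnormJ.
move=> -> -> ->; rewrite -!EFinB; congr _%:E.
rewrite /L logmean0 -Ak [in RHS]big_seq.
rewrite (_ : \sum_(z <- s | z \in s) 2^-1 * (m z)%:~R * ln `|sph_factor (e z) 0| =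
  \sum_(z <- s | z \in s) 2^-1 * (m z)%:~R * (2 * ln rho + (2 * qre (e z) ^+ 2 - `|e z| ^+ 2) / (2 * rho ^+ 2)) -
  rho ^+ 2 / 8 * (\sum_(z <- s | z \in s) 2^-1 * (m z)%:~R * ((8 * qre (e z) ^+ 2 - 4 * `|e z| ^+ 2) / `|e z| ^+ 4)) -
  \sum_(z <- s | z \in s) 2^-1 * (m z)%:~R * sphere_term rho (e z)).
  by rewrite mulrDr; ring.
rewrite mulr_sumr -!sumrB; apply: eq_bigr => z zs.
have N0 : 0 < `|e z| ^+ 2 by rewrite exprn_gt0// normr_gt0 e0.
have -> : `|sph_factor (e z) 0| = `|e z| ^+ 2.
  by rewrite -(emb0 quat_i) sph_factor_emb// norm_emb// !sub0r mulrNN cnormM cnormJ norm_emb.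
rewrite /sphere_term (_ : `|e z| ^+ 4 = (`|e z| ^+ 2) ^+ 2); last by rewrite -exprM.
have -> : qre (e z + qconj (e z)) = 2 * qre (e z) by rewrite /=; ring.
have -> : ln (rho ^+ 2 / `|e z| ^+ 2) = 2 * ln rho - ln (`|e z| ^+ 2).
  rewrite ln_div ?posrE//; last by rewrite exprn_gt0.
  by rewrite lnXn// -[ln rho *+ 2]mulr_natl.
move: (`|e z| ^+ 2) (qre _) N0 => N a N0; move: (ln N) (ln rho) => l1 l2; field.
by rewrite !gt_eqF.
Qed.

End Formula.
End SliceFormula.

(** * Slice regular functions from symmetric holomorphic ones *)

Section BuildSlice.
Context {R : realType}.
Local Notation C := (Cx R).
Implicit Types (z w : C) (x J : quat R).

Definition hx w : hcomplex R := ((cre w)%:A, (cim w)%:A).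

Lemma hxZ (a : R) w : hx (cx a 0 * w) = a *: hx w.
Proof. by rewrite /hx !cpartE !mul0r subr0 addr0 -!scalerA. Qed.
Lemma hxB w z : hx (w - z) = hx w - hx z.
Proof. by rewrite /hx !cpartE !scalerBl. Qed.

Lemma cvg_scaler1 (T : Type) (F : set_system T) {FF : Filter F} (f : T -> R) (a : R) :
  f @ F --> a -> (fun t => (f t)%:A : quat R) @ F --> (a%:A : quat R).
Proof.
move=> /cvgrPdist_lt fa; apply/cvgrPdist_lt => e e0; apply: filterS (fa _ e0) => t.
by rewrite -scalerBl normrZ quat_norm1 mulr1.
Qed.

Lemma cvg_hx (T : Type) (F : set_system T) {FF : Filter F} (f : T -> C) (l : C) :
  f @ F --> l -> (hx \o f) @ F --> hx l.
Proof.
move=> fl; have h1 := @cvg_scaler1 _ _ FF _ _ (@cvg_cre R _ _ FF _ _ fl).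
have h2 := @cvg_scaler1 _ _ FF _ _ (@cvg_cim R _ _ FF _ _ fl).
exact: (cvg_pair h1 h2).
Qed.

Lemma c2_shift (h : R) (v p : R * R) : c2 (h *: v + p) = c2 p + cx h 0 * c2 v.
Proof.
case: v p => a b [c d]; apply: cx_inj; rewrite !cpartE /c2 /= /GRing.scale/= ?mul0r ?subr0 ?addr0.
  by rewrite addrC.
by rewrite addrC.
Qed.

Lemma hx_derive (K : C -> C) (p v : R * R) d : cd K (c2 p) d ->
  derivable (fun q => hx (K (c2 q))) p v /\ 'D_v (fun q => hx (K (c2 q))) p = hx (d * c2 v).
Proof.
move=> dK; have dp : cder (fun s => c2 p + cx s 0 * c2 v) 0 (c2 v).
  have D : cd (fun z => c2 p + z * c2 v) (cx 0 0) (c2 v).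
    apply: is_derive_eq (cdD (cd_cst (c2 p) _) (cdM (cd_id _) (cd_cst (c2 v) _))) _.
    by rewrite mul1r mulr0 addr0 add0r.
  by have := @cder_comp R _ (fun s => cx s 0) 0 _ _ D (cder_cx 0); rewrite mulr1.
have E0 : c2 p + cx 0 0 * c2 v = c2 p by rewrite (_ : cx 0 0 = 0)// mul0r addr0.
have dK' : cd K (c2 p + cx 0 0 * c2 v) d by rewrite E0.
have /cder_quotP H := @cder_comp R K _ 0 _ _ dK' dp.
have L : h^-1 *: (hx (K (c2 (h *: v + p))) - hx (K (c2 p))) @[h --> (0 : R)^'] --> hx (d * c2 v).
  pose G (h : R) := cx h^-1 0 * (K (c2 p + cx (h + 0) 0 * c2 v) - K (c2 p + cx 0 0 * c2 v)).
  rewrite (_ : (fun h : R => _) = hx \o G); first exact: cvg_hx H.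
  by apply/funext => h; rewrite /= /G hxZ hxB addr0 E0 c2_shift.
split; first by apply/cvg_ex; eexists; exact: L.
by apply: cvg_lim.
Qed.

Lemma zq_dir : exists dir : quat R -> quat R,
  forall x, imaginary_units (dir x) /\ x = emb (dir x) (zq x).
Proof.
have H x : exists J, imaginary_units J /\ x = emb J (zq x).
  by have [J uJ xE] := zqP x; exists J.
by have [dir dirP] := choice H; exists dir.
Qed.

(** A converse of [stem_part_hol]: a holomorphic function commuting with conjugation is a stem with
    real components. The unit [dir x] is arbitrary for real x, but there K is real and the choice
    has no effect. *)
Lemma build_slice (U : set C) (K : C -> C) : open U -> (forall w, U w -> U (cconj w)) ->
  hol U K -> (forall w, U w -> K (cconj w) = cconj (K w)) ->
  exists2 g, slice_regular (c2 @^-1` U) g &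
    forall J w, imaginary_units J -> U w -> g (emb J w) = emb J (K w).
Proof.
move=> oU sU hK sK; have [dir dirP] := zq_dir.
pose g x := emb (dir x) (K (zq x)).
have gE J w : imaginary_units J -> U w -> g (emb J w) = emb J (K w).
  move=> uJ Uw; rewrite /g; move: (dirP (emb J w)) => [].
  set J' := dir _; rewrite zq_emb// => uJ' E.
  have [w0|w0] := eqVneq (cim w) 0.
    have wE : cconj w = w by apply: cx_inj; rewrite !cpartE// w0 oppr0.
    have -> : cx (cre w) `|cim w| = w by rewrite w0 normr0 -w0 -cxE.
    have K0 : cim (K w) = 0.
      have /(congr1 (@cim R)) := sK w Uw; rewrite wE cpartE; lra.
    by rewrite [K w]cxE K0 !emb_real.
  have E' : cim w *: J = `|cim w| *: J'.
    by move: E; rewrite /emb !cpartE => /addrI.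
  have [c0|c0] := leP 0 (cim w).
    rewrite ger0_norm// in E' *; rewrite -cxE.
    by congr emb; apply: (scalerI w0).
  rewrite ltr0_norm// in E' *.
  have -> : cx (cre w) (- cim w) = cconj w by apply: cx_inj; rewrite !cpartE.
  have -> : J' = - J.
    by apply: (@scalerI _ _ (- cim w)); rewrite ?oppr_eq0// -E' scaleNr scalerN opprK.
  by rewrite sK// -emb_cconj cconjK.
have oE : open (c2 @^-1` U) by apply: open_comp => // p _; exact: continuous_c2.
pose F (q : R * R) := hx (K (c2 q)).
have dF p : U (c2 p) -> forall v, derivable F p v /\ 'D_v F p = hx ('D_(1 : C) K (c2 p) * c2 v).
  by move=> Up v; apply: hx_derive; exact: hol_cd hK Up.
have cF p v : U (c2 p) -> {for p, continuous ('D_v F)}.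
  move=> Up; have np : nbhs p (c2 @^-1` U) by apply: open_nbhs_nbhs; split.
  have cc : {for p, continuous (fun q => 'D_(1 : C) K (c2 q) * c2 v)}.
    apply: (@contM R _ (fun q => 'D_(1 : C) K (c2 q)) (fun=> c2 v)); last exact: cont_cst.
    have [_ cD] := hK _ Up.
    exact: (@cont_comp R C _ c2 (fun z : C => 'D_(1 : C) K z) p (@continuous_c2 R p) cD).
  have H : hx ('D_(1 : C) K (c2 q) * c2 v) @[q --> p] --> 'D_v F p.
    by rewrite (dF p Up v).2; exact: (@cvg_hx _ _ (nbhs_filter p) _ _ cc).
  suff : 'D_v F q @[q --> p] --> 'D_v F p by [].
  apply: cvg_trans H => A; rewrite /nbhs/= => FA.
  by apply: filterS2 np FA => q Uq; rewrite /= (dF q Uq v).2.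
exists g => //; exists F; split.
- move=> a b Uab; rewrite /F /hx /hconj /= (_ : c2 (a, - b) = cconj (c2 (a, b))); last first.
    by apply: cx_inj; rewrite !cpartE.
  by rewrite sK// !cpartE scaleNr.
- move=> p Up; split; [exact: (dF p Up _).1|exact: (dF p Up _).1|exact: cF|exact: cF].
- move=> p Up; rewrite /d_alpha /d_beta !(dF p Up _).2.
  have -> : c2 (1, 0) = 1 :> C by [].
  rewrite mulr1 /hmul /hi /hx /c2 /= !cpartE !mul0r !mul1r !mulr0 !mulr1 sub0r add0r.
  rewrite addr0 add0r scaleNr.
  have pairN (x y : quat R) : ((x, y) : hcomplex R) + (- x, - y) = 0.
    by congr pair; rewrite subrr.
  exact: pairN.
- move=> a b J Uab uJ; have := gE J (cx a b) uJ Uab.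
  by rewrite /emb /F /hx !cpartE /= -scalerAr mulr1.
Qed.

End BuildSlice.

(** * Orders and multiplicities *)

Section Orders.
Context {R : realType}.
Local Notation C := (Cx R).
Implicit Types (z w : C) (x J : quat R).

(** The open discs of radius |Im z| about z and its conjugate lie on opposite sides of the real
    axis. *)
Lemma conj_far z w : cim z != 0 -> cball z `|cim z| w -> ~ cball z `|cim z| (cconj w).
Proof.
rewrite /cball/= => z0 h1 h2; have := cim_le (w - z); have := cim_le (cconj w - z).
rewrite !cpartE; move: z0 h1 h2.
case: (ltrgt0P (cim z)) => // c0 _ h1 h2; rewrite !ler_norml => /andP[a1 a2] /andP[a3 a4]; lra.
Qed.

Variables (D : set (R * R)) (f : quat R -> hquat R).
Hypothesis oD : open D.
Hypothesis sD : conj_symmetric D.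
Hypothesis semif : semiregular D f.
Hypothesis spf : slice_preserving (circularization D) f.
Local Notation Phi := (slice_fun f).
Local Notation e := (emb (quat_i : quat R)).
Let ui := @unit_i R.

(* The base [P] of the powers in [has_order] acts on each slice as [p], which
   has a simple zero at [z]. *)
Variables (P : quat R -> quat R) (p q : C -> C) (z : C).
Hypothesis Dz : D (r2 z).
Hypothesis PE : forall J w, imaginary_units J -> P (emb J w) = emb J (p w).
Hypothesis pE : forall w, p w = (w - z) * q w.
Hypothesis pJ : forall w, p (cconj w) = cconj (p w).
Hypothesis hq : hol setT q.
Hypothesis qz : q z != 0.

(** One radius for all local conditions: inside U and D, away from the zeros of q and, for nonreal
    z, on one side of the real axis. *)
Lemma order_radius (U : set C) : open U -> U z -> exists2 r : R, 0 < r &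
  [/\ cball z r `<=` U, cball z r `<=` cset D, forall w, cball z r w -> q w != 0,
      forall w, cball z r w -> w != z -> w != cconj z & cim z != 0 -> r <= `|cim z|].
Proof.
move=> oU Uz; have [r1 r10 r1P] := hol_at_neq0 (hq I) qz.
have /nbhs_cx[r2 r20 r2P] : nbhs z (U `&` cset D).
  by apply: open_nbhs_nbhs; split => //; apply: openI => //; exact: open_cset.
pose r3 := if cim z == 0 then 1 else `|cim z|.
have r30 : 0 < r3 by rewrite /r3; case: eqVneq => // ?; rewrite normr_gt0.
exists (Num.min r1 (Num.min r2 r3)); first by rewrite !lt_min r10 r20.
have S w : cball z (Num.min r1 (Num.min r2 r3)) w -> [/\ cball z r1 w, cball z r2 w & cball z r3 w].
  by rewrite /cball/= !lt_min => /and3P.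
split=> [w /S[_ /r2P[]]//|w /S[_ /r2P[]]//|w /S[/r1P]//|w /S[_ _]|].
- rewrite /r3; case: eqVneq => [z0 _|z0 wz _].
    by rewrite (_ : cconj z = z)//; apply: cx_inj; rewrite !cpartE// z0 oppr0.
  apply/eqP => wE; apply: (conj_far z0 wz); rewrite wE cconjK.
  by apply: cballxx; rewrite normr_gt0.
- by rewrite /r3 => /negbTE ->; rewrite !ge_min lexx !orbT.
Qed.

(** As p = (w - z) q with q free of zeros near z, powers of p and of w - z differ by a zero-free
    holomorphic factor. *)
Lemma has_order_has_ord n : has_order P f (e z) n -> has_ord Phi z n.
Proof.
move=> [E [g [[oE sE cE] [F [_ c1F CR iF]] spg g0 fE]]].
have Ez : E (r2 z) by apply/(circularization_emb z sE ui).
have [r r0 [rE rD rq rz _]] := order_radius (open_cset oE) Ez.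
have hF : hol (cball z r) (stem_part F).
  by apply: subset_hol (stem_part_hol oE c1F CR) => y /rE.
have oB := @cball_open R z r.
exists (fun w => q w ^ n * stem_part F w).
  exists r; [exact: r0|split].
    exact: (holM oB (@holXz R _ oB q n rq (subset_hol (@subsetT _ _) hq)) hF).
  move=> w wr wz; have p0 : p w != 0 by rewrite pE mulf_neq0 ?rq// subr_eq0.
  rewrite mulrA -expfzMl -pE.
  apply: (@stem_values _ D f sD spf E F g w _ (p w ^ n) iF (rD _ wr) (rE _ wr) _ _ _).2 => //.
  - move=> J uJ; rewrite fE ?PE// ?embXz//; first exact/circularization_emb/rE.
    by move=> /(sphere_of_emb z w ui uJ)[/eqP|/eqP]; apply/negP => //; exact: rz.
  - by rewrite expfz_neq0.
rewrite mulf_neq0 ?expfz_neq0//.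
have gE J : imaginary_units J -> g (emb J z) = (F (r2 z)).1 + J * (F (r2 z)).2.
  by move=> uJ; exact: (iF _ _ _ Ez uJ).
have [E1 E2] : (F (r2 z)).1 = (qre (F (r2 z)).1)%:A /\ (F (r2 z)).2 = (qre (F (r2 z)).2)%:A.
  apply: real_stem => J uJ; rewrite -gE//; apply: (spg J uJ (emb J z)) => //.
    exact/circularization_emb.
  by apply/slice_planeP; exists z.
have := g0 (e z) cE; apply: contraNneq => F0.
have -> : g (e z) = emb quat_i (stem_part F z).
  by rewrite gE// E1 E2 /emb /stem_part !cpartE /= -scalerAr mulr1.
by rewrite F0 emb0.
Qed.

(** The quotient k = h / q^n is only known near z. It is reflected to a neighbourhood of the
    conjugate point, and the symmetric function [K] so obtained induces the slice regular factor. *)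
Lemma has_ord_has_order n : has_ord Phi z n -> has_order P f (e z) n.
Proof.
move=> [h [r1 r10 [hh hP]] h0].
have [r2' r20 r2P] := hol_at_neq0 (hh z (cballxx z r10)) h0.
have [r r0 [rU rD rq rz rc]] := order_radius (openI (@cball_open R z r1) (@cball_open R z r2'))
  (conj (cballxx z r10) (cballxx z r20)).
have oB := @cball_open R z r.
pose k w := (q w ^ n)^-1 * h w.
have qn w : cball z r w -> q w ^ n != 0 by move=> /rq ?; rewrite expfz_neq0.
have k0 w : cball z r w -> k w != 0.
  by move=> wr; rewrite mulf_neq0 ?invr_eq0 ?qn//; apply: r2P; case: (rU _ wr).
have hk : hol (cball z r) k.
  apply: (holM oB); first exact: (holV oB qn (@holXz R _ oB q n rq (subset_hol (@subsetT _ _) hq))).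
  by apply: subset_hol hh => w /rU[].
have Pk w : cball z r w -> w != z -> Phi w = p w ^ n * k w.
  move=> wr wz; rewrite hP//; last by case: (rU _ wr).
  by rewrite pE expfzMl /k -mulrA mulVKf// qn.
have p0 w : cball z r w -> w != z -> p w != 0.
  by move=> wr wz; rewrite pE mulf_neq0 ?rq// subr_eq0.
have P0 w : cball z r w -> w != z -> Phi w != 0.
  by move=> wr wz; rewrite Pk// mulf_neq0 ?k0// expfz_neq0// p0.
have pnJ w : p (cconj w) ^ n = cconj (p w ^ n) by rewrite pJ cconjXz.
have zJ : cim z = 0 -> cconj z = z.
  by move=> z0; apply: cx_inj; rewrite !cpartE// z0 oppr0.
have ballJ w : cim z = 0 -> cball z r w -> cball z r (cconj w).
  by move=> z0; rewrite /cball/= -{2}(zJ z0) -cconjB cnormJ.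
have dis w : cim z != 0 -> cball z r w -> ~ cball z r (cconj w).
  move=> z0 wr wr'; have sub y : cball z r y -> cball z `|cim z| y.
    by move=> yr; apply: (lt_le_trans yr); exact: rc.
  by apply: (conj_far z0 (sub _ wr)); exact: sub.
have cJ w : {for w, continuous (@cconj R)}.
  exact: (@cvg_cconj _ _ _ (nbhs_filter w) id).
have oBJ : open [set w | cball z r (cconj w)] by apply: open_comp => // w _; exact: cJ.
have hkJ := hol_conj oB hk.
(* For real z the ball is its own reflection, so k must commute with conjugation for [K] to be
   consistent. At z itself Phi gives no information, but a nonzero difference there would persist
   nearby. *)
have kJ w : cim z = 0 -> cball z r w -> k (cconj w) = cconj (k w).
  move=> z0 wr; have H y : cball z r y -> y != z -> k (cconj y) = cconj (k y).
    move=> yr yz; have Jyr := ballJ y z0 yr.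
    have Jyz : cconj y != z by apply: contraNneq yz => yJ; rewrite -(zJ z0) -yJ cconjK.
    have := good_conj oD sD semif spf (rD _ yr) (P0 _ yr yz).
    rewrite !Pk// pnJ cconjM; apply: mulfI.
    by rewrite -pnJ expfz_neq0// p0.
  have [->|wz] := eqVneq w z; last exact: H.
  pose d y := k y - cconj (k (cconj y)).
  have hd : hol (cball z r) d.
    apply: (holD oB hk); apply: (holN oB); apply: subset_hol hkJ => y yr /=.
    exact: ballJ.
  have [d0|d0] := eqVneq (d z) 0.
    by move/eqP: d0; rewrite /d zJ// subr_eq0 => /eqP.
  have [t t0 tP] := hol_at_neq0 (hd z (cballxx z r0)) d0.
  have [|y] := @punctured R z (Num.min r t); first by rewrite lt_min r0.
  rewrite /cball/= lt_min => /andP[yr yt] yz.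
  by have := tP y yt; rewrite /d H// cconjK subrr eqxx.
pose K w := if cnorm (w - z) < r then k w else cconj (k (cconj w)).
pose U := cball z r `|` [set w | cball z r (cconj w)].
have K1 w : cball z r w -> K w = k w by rewrite /K /cball/= => ->.
have K2 w : cball z r (cconj w) -> K w = cconj (k (cconj w)).
  rewrite /K; case: ifP => // wr; rewrite -/(cball z r w) in wr => wJr.
  have [z0|z0] := eqVneq (cim z) 0; first by rewrite kJ ?cconjK.
  by case: (dis w z0 wr).
have oU : open U by apply: openU.
have sU w : U w -> U (cconj w) by case=> wr; [right; rewrite /= cconjK|left].
have hK : hol U K.
  move=> w [wr|wr].
    apply: hol_near (hk w wr); have : nbhs w (cball z r) by apply: open_nbhs_nbhs; split.
    by apply: filterS => y /K1.
  apply: hol_near (hkJ w wr); have : nbhs w [set w | cball z r (cconj w)].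
    by apply: open_nbhs_nbhs; split.
  by apply: filterS => y /K2.
have sK w : U w -> K (cconj w) = cconj (K w).
  by case=> wr; [rewrite (K1 w)// K2 cconjK|rewrite (K2 w)// K1// cconjK].
have K0 w : U w -> K w != 0.
  case=> wr; first by rewrite K1// k0.
  by rewrite K2// -cnorm_eq0 cnormJ cnorm_eq0 k0.
have [g sg gE] := build_slice oU sU hK sK.
have Uz : U z by left; exact: cballxx.
have sE : conj_symmetric (c2 @^-1` U).
  move=> a b /= Uab; rewrite (_ : c2 (a, - b) = cconj (c2 (a, b))); first exact: sU.
  by apply: cx_inj; rewrite !cpartE.
have EU J w : imaginary_units J -> circularization (c2 @^-1` U) (emb J w) -> U w.
  by move=> uJ /(circularization_emb w sE uJ) /=; rewrite r2K.
exists (c2 @^-1` U), g; split => //.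
- split => //; first by apply: open_comp => // y _; exact: continuous_c2.
  by apply/(circularization_emb z sE ui); rewrite /= r2K.
- move=> J uJ x y cx /slice_planeP[w xE] [<-]; rewrite xE in cx *.
  by apply/slice_planeP; exists (K w); rewrite gE//; exact: EU cx.
- move=> x; have [J uJ ->] := zqP x; move: (zq x) => w cx.
  rewrite gE//; last exact: EU cx.
  by rewrite -normr_eq0 norm_emb// cnorm_eq0 K0//; exact: EU cx.
- move=> x; have [J uJ ->] := zqP x; move: (zq x) => w cx ns.
  have Uw := EU _ _ uJ cx.
  have wz : w != z by apply/eqP => wz; apply: ns; apply/sphere_of_emb => //; left.
  have wzJ : cconj w != z.
    by apply/eqP => wz'; apply: ns; apply/sphere_of_emb => //; right; rewrite -wz' cconjK.
  rewrite gE// PE// -embXz// -embM//.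
  case: Uw => wr.
    have [_ ->//] := good_values oD sD semif spf (rD _ wr) (P0 _ wr wz).
    by rewrite K1// Pk.
  have PJ : Phi w = p w ^ n * K w.
    rewrite -{1}[w]cconjK (good_conj oD sD semif spf (rD _ wr) (P0 _ wr wzJ)).
    by rewrite Pk// cconjM -pnJ cconjK K2.
  have Dw : D (r2 w).
    have := rD _ wr; rewrite /cset/= /r2 !cpartE => /sD; rewrite opprK//.
  have Pw : Phi w != 0.
    rewrite -[w]cconjK (good_conj oD sD semif spf (rD _ wr) (P0 _ wr wzJ)).
    by rewrite -cnorm_eq0 cnormJ cnorm_eq0 P0.
  have [_ ->//] := good_values oD sD semif spf Dw Pw.
  by rewrite PJ.
Qed.

End Orders.

Local Open Scope card_scope.

(** * Sums over families repeated with multiplicity *)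

Section FiberSums.
Context {R : realType}.

Lemma fsbig_const (K : choiceType) (A : set K) (n : nat) (F : K -> R) (c : R) :
  A #= `I_n -> (forall k, A k -> F k = c) -> \sum_(k \in A) F k = c *+ n.
Proof.
move=> An Fc; have fA : finite_set A by exists n.
have /finite_fsetP[X AX] := fA; move: An; rewrite AX => /card_eq_fsetP nX.
rewrite -fsbig_seq ?finmap.fset_uniq// (eq_big_seq (fun=> c)); last first.
  by move=> k kX; apply: Fc; rewrite AX.
by rewrite big_const_seq count_predT iter_addr_0 -nX.
Qed.

(** Finiteness of A comes out of the same induction on the list of values, each fibre being
    finite. *)
Lemma fiber_sum (K : choiceType) (T : eqType) (A : set K) (pi : K -> T) (ts : seq T)
    (mult : T -> nat) (F : K -> R) (G : T -> R) :
  uniq ts -> (forall k, A k -> pi k \in ts) ->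
  (forall t, t \in ts -> [set k | A k /\ pi k = t] #= `I_(mult t)) ->
  (forall k, A k -> F k = G (pi k)) ->
  \sum_(k \in A) F k = \sum_(t <- ts) G t *+ mult t.
Proof.
move=> uts Ats fib FG.
suff [] : finite_set A /\ \sum_(k \in A) F k = \sum_(t <- ts) G t *+ mult t by [].
elim: ts A uts Ats fib FG => [|t ts IH] A /= uts Ats fib FG.
  have -> : A = set0 by apply/seteqP; split => // k /Ats.
  by rewrite fsbig_set0 big_nil.
have /andP[tts uts'] := uts.
pose B := [set k | A k /\ pi k = t]; pose A' := [set k | A k /\ pi k != t].
have AE : A = B `|` A'.
  apply/seteqP; split => k; last by case=> [[]|[]].
  by move=> Ak; have [e|e] := eqVneq (pi k) t; [left|right].
have fB : finite_set B by exists (mult t); exact: fib (mem_head _ _).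
have [|||fA' SA'] := IH A' uts'.
- by move=> k [/Ats]; rewrite inE => /orP[/eqP ->|//]; rewrite eqxx.
- move=> u uts2; have := fib u; rewrite inE uts2 orbT => /(_ isT); congr (_ #= _).
  apply/seteqP; split => k /=; last by case=> -[].
  by move=> [Ak pk]; split => //; split => //; rewrite pk; apply: contraNneq tts => <-.
- by move=> k [Ak _]; exact: FG.
split; first by rewrite AE finite_setU.
rewrite AE fsbigU0//; last by move=> k [[_ e] [_]]; rewrite e eqxx.
rewrite big_cons SA'; congr (_ + _); apply: fsbig_const; first exact: fib (mem_head _ _).
by move=> k [Ak <-]; exact: FG.
Qed.

(** At most one of the two multiplicities is nonzero, so their difference is the signed order. *)
Lemma mult_diff (c : R) (n : int) : c *+ zero_mult n - c *+ pole_mult n = n%:~R * c.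
Proof.
rewrite /zero_mult /pole_mult; case: n => n.
  have -> : Num.max (Posz n) 0 = n by apply/max_idPl.
  have -> : Num.min (Posz n) 0 = 0 by apply/min_idPr.
  by rewrite absz_nat absz0 mulr0n subr0 -mulr_natl.
have -> : Num.max (Negz n) 0 = 0 by apply/max_idPr.
have -> : Num.min (Negz n) 0 = Negz n by apply/min_idPl.
by rewrite absz0 mulr0n sub0r NegzE abszN absz_nat mulrNz mulNr -mulr_natl.
Qed.

End FiberSums.

Section Multiplicities.
Context {R : realType}.
Local Notation C := (Cx R).
Implicit Types (z w : C) (x J : quat R).
Variables (rho : R) (D : set (R * R)) (f : quat R -> hquat R).
Hypothesis rho0 : 0 < rho.
Hypothesis oD : open D.
Hypothesis sD : conj_symmetric D.
Hypothesis semif : semiregular D f.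
Hypothesis spf : slice_preserving (circularization D) f.
Hypothesis BD : [set x : quat R | `|x| <= rho] `<=` circularization D.
Local Notation Phi := (slice_fun f).
Local Notation e := (emb (quat_i : quat R)).
Let ui := @unit_i R.

(** [real_order] selects some admissible order: [has_ord_has_order] provides one, and
    [has_ord_unique] identifies the selected one with n. *)
Lemma real_orderE (t : R) n : D (t, 0) -> has_ord Phi (cx t 0) n -> real_order f t = n.
Proof.
move=> Dt on; pose P x := x - t%:A; pose p w : C := w - cx t 0.
have PE J w : imaginary_units J -> P (emb J w) = emb J (p w).
  by move=> uJ; rewrite /P /p embB emb_real.
have pE w : p w = (w - cx t 0) * (fun=> 1) w by rewrite mulr1.
have pJ w : p (cconj w) = cconj (p w).
  by rewrite /p cconjB; congr (_ - _); apply: cx_inj; rewrite !cpartE ?oppr0.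
have q1 : ((fun=> 1) : C -> C) (cx t 0) != 0 by rewrite oner_eq0.
have hq := hol_cst (@openT C) (1 : C).
have E : e (cx t 0) = t%:A by rewrite emb_real.
have Dt' : D (r2 (cx t 0)) by exact: Dt.
have := has_ord_has_order oD sD semif spf Dt' PE pE pJ hq q1 on; rewrite E => on'.
apply: (has_ord_unique (Phi := Phi) (z := cx t 0)) => //.
apply: (has_order_has_ord oD sD spf Dt' PE pE hq q1).
rewrite E /real_order; exact: (xgetPex 0 (ex_intro _ n on')).
Qed.

Lemma sphere_orderE z n : D (r2 z) -> cim z != 0 -> has_ord Phi z n -> sphere_order f (e z) = n.
Proof.
move=> Dz z0 on; pose p w : C := (w - z) * (w - cconj z); pose q w : C := w - cconj z.
have PE J w : imaginary_units J -> sph_factor (e z) (emb J w) = emb J (p w).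
  by move=> uJ; rewrite sph_factor_emb.
have pE w : p w = (w - z) * q w by [].
have pJ w : p (cconj w) = cconj (p w).
  by rewrite /p cconjM !cconjB cconjK mulrC.
have q1 : q z != 0.
  rewrite subr_eq0; apply: contra_neq z0 => /(congr1 (@cim R)); rewrite cpartE; lra.
have hq : hol setT q by apply: (holD openT (hol_id openT)); exact: hol_cst openT _.
have on' := has_ord_has_order oD sD semif spf Dz PE pE pJ hq q1 on.
apply: (has_ord_unique (Phi := Phi) (z := z)) => //.
apply: (has_order_has_ord oD sD spf Dz PE pE hq q1).
rewrite /sphere_order; exact: (xgetPex 0 (ex_intro _ n on')).
Qed.

Lemma has_ord_conj z n : D (r2 z) -> has_ord Phi z n -> has_ord Phi (cconj z) n.
Proof.
move=> Dz [h [r r0 [hh hP]] h0]; have [s s0 sP] := hol_at_neq0 (hh z (cballxx z r0)) h0.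
have /nbhs_cx[t t0 tD] : nbhs z (cset D) by apply: open_nbhs_nbhs; split => //; exact: open_cset.
pose u := Num.min r (Num.min s t).
have S w : cball z u w -> [/\ cball z r w, cball z s w & cball z t w].
  by rewrite /cball/= !lt_min => /and3P.
have bJ w : cball (cconj z) u w -> cball z u (cconj w).
  by rewrite /cball/= -[cconj w - z]cconjK cnormJ cconjB cconjK.
exists (fun w => cconj (h (cconj w))); last by rewrite cconjK -cnorm_eq0 cnormJ cnorm_eq0.
exists u; first by rewrite !lt_min r0 s0.
split.
  by apply: subset_hol (hol_conj (@cball_open R z r) hh) => w /bJ/S[].
move=> w /bJ/S[wr ws wt] wz; have wz' : cconj w != z.
  by apply: contraNneq wz => <-; rewrite cconjK.
have P0 : Phi (cconj w) != 0.
  by rewrite hP// mulf_neq0 ?sP// expfz_neq0// subr_eq0.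
rewrite -{1}[w]cconjK (good_conj oD sD semif spf (tD _ wt) P0) hP//.
by rewrite cconjM cconjXz cconjB cconjK.
Qed.

Variables (s : seq C) (m : C -> int).
Hypothesis us : uniq s.
Hypothesis sP : forall z, (z \in s) <-> cnorm z <= rho /\ ~ good Phi z.
Hypothesis mP : forall z, z \in s -> has_ord Phi z (m z).

(** The order at every point of the closed disc: points outside s are good, hence of order 0. *)
Let M z := if z \in s then m z else 0.

Let discD z : cnorm z <= rho -> D (r2 z).
Proof.
by move=> zr; apply/(circularization_emb z sD ui); apply: BD; rewrite /= norm_emb.
Qed.

Let MP z : cnorm z <= rho -> has_ord Phi z (M z).
Proof.
move=> zr; rewrite /M; case: ifPn => [|zs]; first exact: mP.
have [[r r0 hr] P0] : good Phi z by apply: contrapT => nz; move/negP: zs; apply; apply/sP.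
exists Phi => //; exists r => //; split => // w _ _; by rewrite expr0z mul1r.
Qed.

Lemma conj_mem z : z \in s -> cconj z \in s /\ m (cconj z) = m z.
Proof.
move=> zs; have [zr nz] := (sP z).1 zs.
have Jr : cnorm (cconj z) <= rho by rewrite cnormJ.
have Jm : cconj z \in s.
  apply/sP; split => // -[_ P0]; apply: nz; have DJ := discD Jr.
  have Pz : Phi z != 0.
    rewrite -[z]cconjK (good_conj oD sD semif spf DJ P0) -cnorm_eq0 cnormJ cnorm_eq0//.
  split=> //; have [hz _] := good_values oD sD semif spf (discD zr) Pz.
  have [u u0 uP] := hol_at_neq0 hz Pz.
  have /nbhs_cx[t t0 tD] : nbhs z (cset D).
    by apply: open_nbhs_nbhs; split; [exact: open_cset|exact: discD].
  exists (Num.min u t); first by rewrite lt_min u0.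
  move=> w; rewrite /cball/= lt_min => /andP[wu wt].
  by case: (good_values oD sD semif spf (tD _ wt) (uP _ wu)).
split=> //; apply: has_ord_unique (mP Jm) _; apply: has_ord_conj; [exact: discD|exact: mP].
Qed.

Let circD z : cnorm z <= rho -> circularization D (e z).
Proof. by move=> zr; apply/circularization_emb => //; exact: discD. Qed.

(** [mu] stands for [zero_mult] or [pole_mult]; by [mu 0 = 0] every listed point of the open ball
    belongs to s. *)
Lemma real_sum (mu : int -> nat) (K : choiceType) (r : K -> R) : mu 0 = 0%N ->
  lists_reals (circularization D) (fun t => mu (real_order f t)) r ->
  \sum_(k \in [set k | (`|r k| < rho)%R]) real_term rho (r k) =
  \sum_(z <- s | (cim z == 0) && (cnorm z < rho)) real_term rho (cre z) *+ mu (m z).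
Proof.
move=> mu0 [rU rfib].
have oE (t : R) : `|t| < rho -> real_order f t = M (cx t 0).
  move=> tr; have tr' : cnorm (cx t 0) <= rho by rewrite cnorm_real ltW.
  by apply: real_orderE; [exact: (discD tr')|exact: MP].
have rE z : cim z = 0 -> z = cx (cre z) 0 by move=> z0; rewrite {1}[z]cxE z0.
pose P z := (cim z == 0) && (cnorm z < rho).
rewrite (@fiber_sum _ _ _ _ r [seq cre z | z <- s & P z] (fun t => mu (M (cx t 0))) _ (real_term rho)).
- rewrite big_map big_filter big_seq_cond [RHS]big_seq_cond; apply: eq_bigr => z /andP[zs /andP[/eqP z0 _]].
  by rewrite -rE// /M zs.
- rewrite map_inj_in_uniq ?filter_uniq// => z w; rewrite !mem_filter.
  move=> /andP[/andP[/eqP z0 _] _] /andP[/andP[/eqP w0 _] _] zw.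
  by rewrite (rE z z0) (rE w w0) zw.
- move=> k /= kr; have tr : cnorm (cx (r k) 0) < rho by rewrite cnorm_real.
  apply/mapP; exists (cx (r k) 0) => //; rewrite mem_filter /P cim_cx eqxx tr /=.
  apply: contraT => ns; have := rfib (r k) (rU k).
  rewrite oE// /M (negbTE ns) mu0 II0 card_eq0 => /eqP/seteqP[/(_ k erefl)//].
- move=> t /mapP[z]; rewrite mem_filter => /andP[/andP[/eqP z0 zr] zs] tE.
  have zE := rE z z0; have tr : `|t| < rho by rewrite tE -cnorm_real -zE.
  have := rfib t; rewrite oE// -(emb_real quat_i) => /(_ _) H.
  have -> : [set k | [set k | `|r k| < rho] k /\ r k = t] = [set k | r k = t].
    by apply/seteqP; split => k /=; [case|move=> ->].
  by apply: H; apply: circD; rewrite cnorm_real ltW.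
- by [].
Qed.

(** Whatever representatives the family uses, [zq] moves each to the open upper half plane, so the
    points of s with positive imaginary part index the spheres. *)
Lemma sphere_sum (mu : int -> nat) (K : choiceType) (a : K -> quat R) : mu 0 = 0%N ->
  lists_spheres (circularization D) (fun q => mu (sphere_order f q)) a ->
  \sum_(k \in [set k | (`|a k| < rho)%R]) sphere_term rho (a k) =
  \sum_(z <- s | (0 < cim z) && (cnorm z < rho)) sphere_term rho (e z) *+ mu (m z).
Proof.
move=> mu0 [aU afib].
have oE z : cim z != 0 -> cnorm z < rho -> sphere_order f (e z) = M z.
  by move=> z0 /ltW zr; apply: sphere_orderE => //; [exact: discD|exact: MP].
have nr z : cim z != 0 -> ~ real_quat (e z).
  move=> z0 [t E]; have [_ E1 _ _] := embE z ui; move: E1; rewrite E /= mulr0 mulr1.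
  by move=> /esym/eqP; apply/negP.
have zq0 k : 0 < cim (zq (a k)).
  rewrite cim_cx lt_neqAle qimn_ge0 andbT eq_sym; apply/eqP => n0.
  have [J uJ E] := zqP (a k); apply: (aU k).2; exists (qre (a k)).
  by rewrite {1}E /zq n0 emb_real.
have fibE z : 0 < cim z -> cnorm z < rho ->
    [set k | [set k | `|a k| < rho] k /\ zq (a k) = z] = [set k | sphere_of (e z) (a k)].
  move=> z0 zr; apply/seteqP; split => k /=.
    move=> [_ E]; have [J uJ ->] := zqP (a k); rewrite E.
    by apply/sphere_of_emb => //; left.
  have [J uJ E] := zqP (a k); rewrite {1}E => /(sphere_of_emb z _ ui uJ)[zE|zE].
    by split => //; rewrite -cnorm_zq zE.
  by have := zq0 k; rewrite zE cpartE oppr_gt0 ltNge (ltW z0).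
pose P z := (0 < cim z) && (cnorm z < rho).
rewrite (@fiber_sum _ _ _ _ (fun k => zq (a k)) [seq z <- s | P z] (fun z => mu (M z)) _
   (fun z => sphere_term rho (e z))).
- rewrite big_filter big_seq_cond [RHS]big_seq_cond; apply: eq_bigr => z /andP[zs _].
  by rewrite /M zs.
- exact: filter_uniq.
- move=> k /= kr; have kz := zq0 k; have kr' : cnorm (zq (a k)) < rho by rewrite cnorm_zq.
  rewrite mem_filter /P kz kr' /=; apply: contraT => ns.
  have kz' : cim (zq (a k)) != 0 by rewrite gt_eqF.
  have := afib (e (zq (a k))) (circD (ltW kr')) (nr _ kz').
  rewrite -fibE// oE// /M (negbTE ns) mu0 II0 card_eq0 => /eqP/seteqP[/(_ k (conj kr erefl))//].
- move=> z; rewrite mem_filter => /andP[/andP[z0 zr] zs].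
  have z0' : cim z != 0 by rewrite gt_eqF.
  by rewrite fibE// -oE//; apply: afib; [apply: circD; exact: ltW|exact: nr].
- move=> k _; have [J uJ E] := zqP (a k).
  have N : `|e (zq (a k))| = `|a k| by rewrite norm_emb// cnorm_zq.
  have Q : qre (e (zq (a k)) + qconj (e (zq (a k)))) = qre (a k + qconj (a k)).
    by rewrite /= !(mulr1, mulr0, addr0).
  by rewrite /sphere_term N Q.
Qed.

Lemma sum_split : \sum_(z <- s) 2^-1 * (m z)%:~R * sphere_term rho (e z) =
  \sum_(z <- s | (cim z == 0) && (cnorm z < rho)) (m z)%:~R * real_term rho (cre z) +
  \sum_(z <- s | (0 < cim z) && (cnorm z < rho)) (m z)%:~R * sphere_term rho (e z).
Proof.
pose t z := 2^-1 * (m z)%:~R * sphere_term rho (e z).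
have tJ z : z \in s -> t (cconj z) = t z.
  move=> zs; have [_ mz] := conj_mem zs; rewrite /t mz; congr (_ * _).
  rewrite /sphere_term !norm_emb// cnormJ !qconj_emb// -!embD cconjK [cconj z + z]addrC.
  by [].
have ps : perm_eq s (map (@cconj R) s).
  apply: uniq_perm => //; first by rewrite map_inj_uniq//; exact: (can_inj (@cconjK R)).
  move=> z; apply/idP/mapP => [zs|[w ws ->]]; last by case: (conj_mem ws).
  by exists (cconj z); rewrite ?cconjK//; case: (conj_mem zs).
(* The spherical term vanishes on the boundary, hence the strict inequality in the sums of the
   formula. *)
have bnd z : z \in s -> ~~ (cnorm z < rho) -> t z = 0.
  move=> /sP[zr _]; rewrite -leNgt => rz.
  have e' : `|e z| = rho by rewrite norm_emb//; apply/eqP; rewrite eq_le zr.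
  by rewrite /t (sphere_term_boundary rho0 e') mulr0.
(* Conjugation permutes s and preserves orders, so the lower half plane contributes as much as the
   upper one. *)
have neg : \sum_(z <- s | (cim z < 0) && (cnorm z < rho)) t z =
    \sum_(z <- s | (0 < cim z) && (cnorm z < rho)) t z.
  rewrite (perm_big _ ps) big_map big_seq_cond [RHS]big_seq_cond; apply: eq_big => z.
    by rewrite cimJ oppr_lt0 cnormJ.
  by move=> /andP[zs _]; exact: tJ.
rewrite -/t (bigID (fun z => cnorm z < rho))/= [X in _ + X]big1_seq ?addr0; last first.
  by move=> z /andP[zr zs]; exact: bnd.
rewrite (bigID (fun z => cim z == 0))/=; congr (_ + _).
  rewrite [LHS](eq_bigl (fun z => (cim z == 0) && (cnorm z < rho))); last by move=> z; rewrite andbC.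
  rewrite big_seq_cond [RHS]big_seq_cond; apply: eq_bigr => z /andP[zs /andP[/eqP z0 zr]].
  have zE : z = cx (cre z) 0 by rewrite {1}[z]cxE z0.
  rewrite /t /real_term /sphere_term norm_emb// qconj_emb// -embD.
  have -> : cnorm z = `|cre z| by rewrite {1}zE cnorm_real.
  have [-> _ _ _] := embE (z + cconj z) ui; rewrite !cpartE.
  (* At 0 both terms are 0 by the conventions for ln 0 and for division by 0. *)
  move: (cre z) ((m z)%:~R) => c M'; have [->|c0] := eqVneq c 0.
    by rewrite normr0 !expr0n /= invr0 !mulr0 invr0 !mulr0 ln0// !mul0r !addr0 !mulr0.
  have c2 : `|c| ^+ 2 = c ^+ 2 by rewrite real_normK ?num_real.
  have c4 : `|c| ^+ 4 = c ^+ 4 by rewrite [LHS](exprM _ 2 2) c2 -exprM.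
  have -> : ln (rho ^+ 2 / `|c| ^+ 2) = 2 * ln (rho / `|c|).
    rewrite -expr_div_n lnXn ?divr_gt0 ?normr_gt0//.
    by rewrite -[ln (rho / `|c|) *+ 2]mulr_natl.
  rewrite c4 c2; move: (ln _) => l; field.
  by rewrite c0 gt_eqF.
rewrite (bigID (fun z => 0 < cim z))/=.
rewrite [X in X + _](eq_bigl (fun z => (0 < cim z) && (cnorm z < rho))); last first.
  move=> z; case: (ltrgt0P (cim z)); rewrite ?andbT ?andbF//.
rewrite [X in _ + X](eq_bigl (fun z => (cim z < 0) && (cnorm z < rho))); last first.
  by move=> z; case: (ltrgt0P (cim z)); rewrite ?andbT ?andbF.
rewrite neg -big_split/=; apply: eq_bigr => z _; rewrite /t.
by field.
Qed.

End Multiplicities.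

Theorem corollary3p6 (R : realType) (Omega : set (quat R)) (f : quat R -> hquat R)
    (rho : R) :
  open Omega -> connected Omega -> 0 < rho ->
  [set x : quat R | `|x| <= rho] `<=` Omega ->
  f 0 <> Some 0 -> f 0 <> None ->
  (forall (D : set (R * R)) (Kr Kp Ka Kb : choiceType)
     (r : Kr -> R) (p : Kp -> R) (a : Ka -> quat R) (b : Kb -> quat R),
     open D -> conj_symmetric D -> Omega = circularization D ->
     semiregular D f -> slice_preserving Omega f ->
     lists_reals Omega (fun t => zero_mult (real_order f t)) r ->
     lists_reals Omega (fun t => pole_mult (real_order f t)) p ->
     lists_spheres Omega (fun q => zero_mult (sphere_order f q)) a ->
     lists_spheres Omega (fun q => pole_mult (sphere_order f q)) b ->
     log_abs f 0 =
       (((fine (surface_measure rho (qsphere rho)))^-1)%:E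
          * (\int[surface_measure rho]_(y in qsphere rho) log_abs f y)
        - (rho ^+ 2 / 8 * laplacian (fun x => fine (log_abs f x)) 0)%:E
        + (\sum_(h \in [set h | (`|p h| < rho)%R]) real_term rho (p h))%:E
        - (\sum_(k \in [set k | (`|r k| < rho)%R]) real_term rho (r k))%:E
        + (\sum_(j \in [set j | (`|b j| < rho)%R]) sphere_term rho (b j))%:E
        - (\sum_(i \in [set i | (`|a i| < rho)%R]) sphere_term rho (a i))%:E)%E) /\
  (forall (N : nat) (a0 : quat R) (a q : 'I_N -> quat R) (M : 'I_N -> int),
     is_PQL Omega f a0 a q M ->
     (forall k, q k != 0) -> (forall k, `|q k| <= rho) ->
     log_abs f 0 =
       (((fine (surface_measure rho (qsphere rho)))^-1)%:E
          * (\int[surface_measure rho]_(y in qsphere rho) log_abs f y)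
        - (rho ^+ 2 / 8 * laplacian (fun x => fine (log_abs f x)) 0)%:E
        - (\sum_(k < N | (`|q k| < rho)%R) (M k)%:~R * real_term rho `|q k|)%:E)%E).
Proof.
move=> oO _ rho0 BO f0 fN; split; last first.
  by move=> N a0 a q M fPQL q0 qr; exact: (PQL_formula rho0 oO BO fPQL q0 qr).
move=> D Kr Kp Ka Kb r p a b oD sD OE semif spf lr lp la lb; subst Omega.
have [s [m [us sP mP ->]]] := slice_formula rho0 oD sD semif spf BO f0 fN.
rewrite (sum_split rho0 oD sD semif spf BO us sP mP).
rewrite (real_sum oD sD semif spf BO us sP mP (mu := zero_mult) _ lr)//.
rewrite (real_sum oD sD semif spf BO us sP mP (mu := pole_mult) _ lp)//.
rewrite (sphere_sum oD sD semif spf BO us sP mP (mu := zero_mult) _ la)//.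
rewrite (sphere_sum oD sD semif spf BO us sP mP (mu := pole_mult) _ lb)//.
move: (_ * _)%E (_ * laplacian _ _) => X Y.
rewrite -!addeA -!EFinN -!EFinD; congr (_ + _%:E)%E.
(* Signed orders are split into zero and pole multiplicities, which separates the four families. *)
under eq_bigr do rewrite -mult_diff.
under [X in _ - (_ + X) = _]eq_bigr do rewrite -mult_diff.
by rewrite !sumrB; ring.
Qed.
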